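(* Let $d_1,d_2\ge 1$ and $d=d_1+d_2$. Let $R$ and $\tilde R$ be probability distributions on $\mathbb{R}^d=\mathbb{R}^{d_1}\times\mathbb{R}^{d_2}$, and let $Q=Q^{(1)}\otimes Q^{(2)}$ and $\tilde Q=\tilde Q^{(1)}\otimes\tilde Q^{(2)}$, where $Q^{(i)},\tilde Q^{(i)}$ are probability distributions on $\mathbb{R}^{d_i}$, $i\in\{1,2\}$. Assume that there exists $\rho<2$ such that $R$ and $\tilde R$ belong to $\mathcal{M}^d_\rho$, and assume that $R$ and $\tilde R$ both satisfy the following: for any $z_0\in\mathbb{C}^{d_1}$, the function $z\in\mathbb{C}^{d_2}\mapsto\Phi_R(z_0,z)$ is not the null function, and for any $z_0\in\mathbb{C}^{d_2}$, the function $z\in\mathbb{C}^{d_1}\mapsto\Phi_R(z,z_0)$ is not the null function (and likewise with $\tilde R$ in place of $R$). Then $\mathbb{P}_{R,Q}=\mathbb{P}_{\tilde R,\tilde Q}$ implies that $R=\tilde R$ and $Q=\tilde Q$ up to translation.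
   Context: The model is $\mathbf{Y}=\mathbf{X}+\boldsymbol{\varepsilon}$ with $\mathbf{Y}=(Y^{(1)},Y^{(2)})$, $\mathbf{X}=(X^{(1)},X^{(2)})$, $\boldsymbol\varepsilon=(\varepsilon^{(1)},\varepsilon^{(2)})$ taking values in $\mathbb{R}^{d_1}\times\mathbb{R}^{d_2}$, where $\boldsymbol\varepsilon$ is independent of $\mathbf{X}$ and $\varepsilon^{(1)}$ is independent of $\varepsilon^{(2)}$. $\mathbb{P}_{R,Q}$ denotes the distribution of $\mathbf{Y}$ when $\mathbf{X}$ has distribution $R$ and $\varepsilon^{(i)}$ has distribution $Q^{(i)}$, $i\in\{1,2\}$, $Q=Q^{(1)}\otimes Q^{(2)}$. For $\rho\ge 0$ and an integer $p\ge1$, $\mathcal{M}^p_\rho$ is the set of positive measures $\mu$ on $\mathbb{R}^p$ such that there exist $A,B>0$ with $\int\exp(\lambda^\top x)\,\mu(dx)\le A\exp(B\|\lambda\|^\rho)$ for all $\lambda\in\mathbb{R}^p$ ($\|\cdot\|$ the Euclidean norm). For $R\in\mathcal{M}^d_\rho$, $\Phi_R:\mathbb{C}^{d_1}\times\mathbb{C}^{d_2}\to\mathbb{C}$ is the (entire) function $\Phi_R(z_1,z_2)=\int\exp(iz_1^\top x_1+iz_2^\top x_2)\,R(dx_1,dx_2)$. ''$R=\tilde R$ and $Q=\tilde Q$ up to translation'' means: there exists $m=(m_1,m_2)\in\mathbb{R}^{d_1}\times\mathbb{R}^{d_2}$ such that, if $\mathbf{X}$ has distribution $R$ and $\varepsilon^{(i)}$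 has distribution $Q^{(i)}$ for $i\in\{1,2\}$, then $(X^{(1)}-m_1,X^{(2)}-m_2)$ has distribution $\tilde R$ and $\varepsilon^{(i)}+m_i$ has distribution $\tilde Q^{(i)}$ for $i\in\{1,2\}$. *)

(* Defs.v *)
From HB Require Import structures.
From mathcomp Require Import all_boot all_order all_algebra complex.
From mathcomp Require Import all_classical all_reals all_analysis measurable_realfun.

Set Implicit Arguments.
Unset Strict Implicit.
Unset Printing Implicit Defensive.

Import Order.TTheory GRing.Theory Num.Theory.
Import numFieldNormedType.Exports.

Local Open Scope classical_set_scope.
Local Open Scope ring_scope.
Local Open Scope complex_scope.

Definition measure_rV_display : measure_display -> measure_display.
Proof. exact. Qed.

(* The product sigma-algebra on row vectors, as the library does for tuples;
   [measurable_rV_open] shows that over a realType it is the Borel one. *)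
Section measurable_rV.
Context {d} {T : measurableType d} (n : nat).

Let coor : 'I_n -> 'rV[T]_n -> T := fun i x => x ord0 i.

Let rV_set0 : g_sigma_preimage coor set0.
Proof. exact: sigma_algebra0. Qed.

Let rV_setC A : g_sigma_preimage coor A -> g_sigma_preimage coor (~` A).
Proof. exact: sigma_algebraC. Qed.

Let rV_bigcup (F : _^nat) : (forall i, g_sigma_preimage coor (F i)) ->
  g_sigma_preimage coor (\bigcup_i (F i)).
Proof. exact: sigma_algebra_bigcup. Qed.

HB.instance Definition _ := @isMeasurable.Build (measure_rV_display d)
  'rV[T]_n (g_sigma_preimage coor) rV_set0 rV_setC rV_bigcup.

Lemma measurable_rV_coord (i : 'I_n) :
  measurable_fun [set: 'rV[T]_n] (fun x : 'rV[T]_n => x ord0 i).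
Proof.
move=> _ Y mY; rewrite setTI; apply: sub_sigma_algebra => /=.
rewrite -bigcup_seq/=; exists i => /=; first by rewrite mem_index_enum.
by exists Y => //; rewrite setTI.
Qed.

End measurable_rV.

Section borel_rV.
Variables (K : realType) (n : nat).

Let box (p : 'rV[rat]_n * rat) : set 'rV[K]_n :=
  [set x | forall i, ball (ratr (p.1 ord0 i) : K) (ratr p.2) (x ord0 i)].

Let measurable_box p : measurable (box p).
Proof.
have -> : box p = ~` \bigcup_(i : 'I_n) ~` ((fun x : 'rV[K]_n => x ord0 i) @^-1`
      ball (ratr (p.1 ord0 i) : K) (ratr p.2)).
  rewrite setC_bigcup; apply/seteqP; split => [x px i _|x px i].
    by rewrite setCK; exact: px.
  by have := px i Logic.I; rewrite setCK.
apply: measurableC; apply: countable_bigcupT_measurable => [|i].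
  exact: countableP.
apply: measurableC; rewrite -[X in measurable X]setTI.
apply: measurable_rV_coord => //.
by apply: open_measurable; apply: ball_open.
Qed.

Let open_subbox (U : set 'rV[K]_n) x : open U -> U x ->
  exists2 p, box p x & box p `<=` U.
Proof.
move=> oU Ux.
have /nbhs_ballP[e /= e0 eU] : nbhs x U by exact: open_nbhs_nbhs.
have [q] : exists q : rat, ratr q \in `]0, (e / 2)[%R.
  by have [|q qe] := @rat_in_itvoo K 0 (e / 2); [rewrite divr_gt0|exists q].
rewrite in_itv/= => /andP[q0 qe].
have /choice[c cP] i : exists c : rat, ball (ratr c : K) (ratr q) (x ord0 i).
  have [|c] := @rat_in_itvoo K (x ord0 i - ratr q) (x ord0 i + ratr q).
    by rewrite ltrD2l gtrN.
  rewrite in_itv/= => /andP[c1 c2]; exists c.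
  by rewrite /ball/= ltr_distl; apply/andP; split; rewrite ?ltrBlDr// -ltrBlDr.
exists (\row_i c i, q) => [i|y /= yb]; first by rewrite /= mxE.
apply: eU; split => // i j; rewrite ord1.
have := yb j; rewrite mxE => yj.
rewrite (splitr e); apply: ball_triangle.
  exact/ball_sym/(le_ball (ltW qe))/cP.
exact: le_ball (ltW qe) _ yj.
Qed.

Lemma measurable_rV_open : @measurable _ 'rV[K]_n = <<s @open 'rV[K]_n >>.
Proof.
apply/seteqP; split.
  apply: smallest_sub; first exact: smallest_sigma_algebra.
  rewrite -bigcup_seq => A [i _ mA]; move: A mA.
  have mcoor : measurable_fun [set: g_sigma_algebraType (@open 'rV[K]_n)]
      (fun x : 'rV[K]_n => x ord0 i).
    apply: (measurability _ (RGenOpens.measurableE K)) => _ [_ [a [b ->] <-]].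
    rewrite setTI; apply: sub_sigma_algebra.
    apply: open_comp; last exact: interval_open.
    by move=> x _; exact: coord_continuous.
  by move=> _ [B mB <-]; exact: mcoor.
apply: smallest_sub; first exact: sigma_algebra_measurable.
move=> U oU.
have -> : U = \bigcup_(p : 'rV[rat]_n * rat) (if `[< box p `<=` U >] then box p else set0).
  apply/seteqP; split => [x Ux|x [p _]].
    have [p px pU] := open_subbox oU Ux.
    by exists p => //; rewrite asboolT.
  by case: ifPn => // /asboolP; exact.
apply: countable_bigcupT_measurable => [|p]; first exact: countableP.
by case: ifPn.
Qed.

End borel_rV.

Definition dotv (F : pzRingType) n (u v : 'rV[F]_n) : F :=
  \sum_(i < n) u ord0 i * v ord0 i.

(* Not the library's norm [`|u|] on row vectors, which is the sup norm. *)
Definition enorm (K : rcfType) n (u : 'rV[K]_n) : K := Num.sqrt (dotv u u).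

Definition cexp (K : realType) (w : K[i]) : K[i] :=
  (expR (complex.Re w))%:C * (cos (complex.Im w) +i* sin (complex.Im w)).

Definition cintegral d (T : measurableType d) (K : realType)
    (mu : {measure set T -> \bar K}) (f : T -> K[i]) : K[i] :=
  (\int[mu]_x complex.Re (f x)) +i* (\int[mu]_x complex.Im (f x)).

Definition subexp_class (K : realType) (p : nat) (rho : K)
    (mu : {measure set 'rV[K]_p -> \bar K}) : Prop :=
  exists A B : K, [/\ 0 < A, 0 < B & forall l : 'rV[K]_p,
    (\int[mu]_x (expR (dotv l x))%:E
       <= (A * expR (B * enorm l `^ rho))%:E)%E].

(* R^d1 x R^d2 is encoded as 'rV_(d1 + d2), with blocks lsubmx and rsubmx. *)
Definition Phi (K : realType) d1 d2 (R : {measure set 'rV[K]_(d1 + d2) -> \bar K})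
    (z1 : 'rV[K[i]]_d1) (z2 : 'rV[K[i]]_d2) : K[i] :=
  cintegral R (fun x => cexp
    ('i%C * dotv z1 (map_mx (real_complex K) (lsubmx x)) +
     'i%C * dotv z2 (map_mx (real_complex K) (rsubmx x)))).

Definition nonnull_sections (K : realType) d1 d2
    (R : {measure set 'rV[K]_(d1 + d2) -> \bar K}) : Prop :=
  (forall z0 : 'rV[K[i]]_d1, (fun z : 'rV[K[i]]_d2 => Phi R z0 z) <> cst 0) /\
  (forall z0 : 'rV[K[i]]_d2, (fun z : 'rV[K[i]]_d1 => Phi R z z0) <> cst 0).

(* Set functions are total on [set T], with no constraint outside the
   sigma-algebra, so measures are compared on measurable sets only. *)
Definition eq_law d (T : measurableType d) (K : realType)
    (mu nu : set T -> \bar K) : Prop :=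
  forall A, measurable A -> mu A = nu A.

(* The law of X + (eps1, eps2), with (X, (eps1, eps2)) of law
   R \x (Q1 \x Q2): X, eps1 and eps2 are independent. *)
Definition noisy_law (K : realType) d1 d2 (R : probability 'rV[K]_(d1 + d2) K)
    (Q1 : probability 'rV[K]_d1 K) (Q2 : probability 'rV[K]_d2 K) :
    set 'rV[K]_(d1 + d2) -> \bar K :=
  pushforward (R \x (Q1 \x Q2))%E
    (fun w : 'rV[K]_(d1 + d2) * ('rV[K]_d1 * 'rV[K]_d2) =>
       w.1 + row_mx w.2.1 w.2.2).

Definition eq_up_to_translation (K : realType) d1 d2
    (R : probability 'rV[K]_(d1 + d2) K)
    (Q1 : probability 'rV[K]_d1 K) (Q2 : probability 'rV[K]_d2 K)
    (R' : probability 'rV[K]_(d1 + d2) K)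
    (Q1' : probability 'rV[K]_d1 K) (Q2' : probability 'rV[K]_d2 K) : Prop :=
  exists (m1 : 'rV[K]_d1) (m2 : 'rV[K]_d2),
    [/\ eq_law (pushforward R (fun x => x - row_mx m1 m2)) R',
        eq_law (pushforward Q1 (fun e => e + m1)) Q1' &
        eq_law (pushforward Q2 (fun e => e + m2)) Q2'].

(* Main.v *)
Require Import Defs.
From mathcomp Require Import all_boot all_order all_algebra complex.
From mathcomp Require Import all_classical all_reals all_analysis measurable_realfun.
From mathcomp Require separable cyclotomic cyclic.
From mathcomp Require Import ring lra zify.
Set Implicit Arguments.
Unset Strict Implicit.
Unset Printing Implicit Defensive.
Import Order.TTheory GRing.Theory Num.Theory.
Import numFieldNormedType.Exports.
Local Open Scope classical_set_scope.
Local Open Scope ring_scope.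
Local Open Scope complex_scope.

(** Characteristic functions turn the equality of the two noisy laws into
    Phi_R(s,t) phi_1(s) phi_2(t) = Phi_R'(s,t) phi_1'(s) phi_2'(t) for real s, t.
    Near 0 the noise factors do not vanish and can be eliminated, which gives
    Phi_R(s,t) Phi_R'(s,0) Phi_R'(0,t) = Phi_R'(s,t) Phi_R(s,0) Phi_R(0,t);
    by the identity theorem along complex lines this holds for all complex s, t.
    Since no section is null, f(w) = Phi_R(ws,0) and g(w) = Phi_R'(ws,0) then have
    the same zeros with the same multiplicities. Both have order < 2, so by Hadamard
    f/g = exp(cw), and c = f'(0) - g'(0) = i s.m, with m the difference of the means
    of R and R'. Hence Phi_R = Phi_R' exp(i m.), which identifies R', and then the
    noise laws because the zeros of Phi_R'(.,0) are isolated on real lines through 0.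

    The Hadamard step uses power series only. On |w| <= r, the common zeros in
    |w| <= r/3 are divided out of f and g; their number is bounded by the growth on
    |w| = r, so this terminates, and the quotients are still bounded by M = max(|f|, |g|)
    on |w| = r. A discrete Borel-Caratheodory estimate bounds the k-th coefficient of
    their logarithmic derivatives by O(log M / r^(k+1)) = O(r^(rho-k-1)). As the removed
    factors cancel in f'/f - g'/g, letting r go to infinity leaves only k = 0.

    Fourier uniqueness is obtained by approximating indicators of half-spaces with
    uniformly bounded trigonometric polynomials: (1 - f^n)^(n 2^n) tends to the
    indicator of f < 1/2, here for f = (1 + sin((x_j - a)/N))/2. *)

(** * Power series over K[i] *)

(** Transforms may vanish, so no factor is ever divided by pointwise. Cancellations take place among
    entire functions of one variable along complex lines, where a factor that is nonzero at 0 can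
    always be removed. The noise laws have no moments: their characteristic functions are only known
    at real vectors, continuous, equal to 1 at 0 and possibly zero elsewhere. Hence they are
    eliminated near 0, before any complex argument appears. Multiplicities are never counted: an
    identity g u = f v with v nonzero at the point compares them, and it survives division of f and
    g by a common linear factor. The bound rho < 2 is what separates a translation from a Gaussian
    factor: at order 2, the index k = 1 would survive in the difference of logarithmic derivatives,
    that is, a factor exp(c w^2). *)

Section complex_modulus.
Variable K : realType.
Implicit Types z w : K[i].

(** The norm of [K[i]] takes its values in [K[i]]; this one takes them in [K], where real estimates
    apply. *)
Definition cmod z : K := Normc.normc z.

Lemma cmodE z : cmod z = Num.sqrt (complex.Re z ^+ 2 + complex.Im z ^+ 2).
Proof. by case: z. Qed.

Lemma cmod_ge0 z : 0 <= cmod z.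
Proof. by rewrite cmodE sqrtr_ge0. Qed.

Lemma cmod0 : cmod 0 = 0. Proof. exact: Normc.normc0. Qed.

Lemma cmod1 : cmod 1 = 1. Proof. exact: Normc.normc1. Qed.

Lemma cmodM z w : cmod (z * w) = cmod z * cmod w.
Proof. exact: Normc.normcM. Qed.

Lemma cmodV z : cmod z^-1 = (cmod z)^-1.
Proof. exact: Normc.normcV. Qed.

Lemma cmodN z : cmod (- z) = cmod z.
Proof. by rewrite !cmodE; case: z => x y /=; rewrite !sqrrN. Qed.

Lemma cmodX z n : cmod (z ^+ n) = cmod z ^+ n.
Proof. by elim: n => [|n IH]; rewrite ?expr0 ?cmod1// !exprS cmodM IH. Qed.

Lemma cmodD z w : cmod (z + w) <= cmod z + cmod w.
Proof. exact: le_normcD. Qed.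

Lemma cmodB z w : cmod (z - w) <= cmod z + cmod w.
Proof. by rewrite -(cmodN w) cmodD. Qed.

Lemma cmodBC z w : cmod (z - w) = cmod (w - z).
Proof. by rewrite -cmodN opprB. Qed.

Lemma cmod_sum I (r : seq I) (P : pred I) (F : I -> K[i]) :
  cmod (\sum_(i <- r | P i) F i) <= \sum_(i <- r | P i) cmod (F i).
Proof.
elim/big_rec2: _ => [|i y x _ xy]; first by rewrite cmod0.
by rewrite (le_trans (cmodD _ _))// lerD2l.
Qed.

Lemma cmod_eq0 z : (cmod z == 0) = (z == 0).
Proof.
by apply/eqP/eqP => [/Normc.eq0_normc|->]; rewrite ?cmod0.
Qed.

Lemma cmod_gt0 z : (0 < cmod z) = (z != 0).
Proof. by rewrite lt_def cmod_ge0 andbT cmod_eq0. Qed.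

Lemma cmodR (x : K) : cmod x%:C = `|x|.
Proof. by rewrite cmodE/= expr0n addr0 sqrtr_sqr. Qed.

Lemma cmod_nat n : cmod n%:R = n%:R.
Proof.
have -> : (n%:R : K[i]) = n%:R%:C by rewrite rmorph_nat.
by rewrite cmodR ger0_norm.
Qed.

Lemma ler_Re_cmod z : `|complex.Re z| <= cmod z.
Proof.
by rewrite cmodE -sqrtr_sqr ler_sqrt ?lerDl ?sqr_ge0// addr_ge0// sqr_ge0.
Qed.

Lemma ler_Im_cmod z : `|complex.Im z| <= cmod z.
Proof.
by rewrite cmodE -sqrtr_sqr ler_sqrt ?lerDr ?sqr_ge0// addr_ge0// sqr_ge0.
Qed.

Lemma cmodi : cmod 'i%C = 1.
Proof. by rewrite cmodE /= expr0n expr1n add0r sqrtr1. Qed.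

Lemma cmod_le_ReIm z : cmod z <= `|complex.Re z| + `|complex.Im z|.
Proof.
have -> : cmod z = cmod ((complex.Re z)%:C + 'i%C * (complex.Im z)%:C).
  by congr cmod; exact: complexE.
by apply: (le_trans (cmodD _ _)); rewrite cmodM !cmodR cmodi mul1r.
Qed.

Lemma reD z w : complex.Re (z + w) = complex.Re z + complex.Re w.
Proof. by case: z; case: w. Qed.
Lemma imD z w : complex.Im (z + w) = complex.Im z + complex.Im w.
Proof. by case: z; case: w. Qed.
Lemma reN z : complex.Re (- z) = - complex.Re z.
Proof. by case: z. Qed.
Lemma imN z : complex.Im (- z) = - complex.Im z.
Proof. by case: z. Qed.
Lemma reM z w :
  complex.Re (z * w) = complex.Re z * complex.Re w - complex.Im z * complex.Im w.
Proof. by case: z; case: w. Qed.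
Lemma imM z w :
  complex.Im (z * w) = complex.Re z * complex.Im w + complex.Im z * complex.Re w.
Proof. by case: z; case: w. Qed.
Lemma re_sum I (r : seq I) (P : pred I) (F : I -> K[i]) :
  complex.Re (\sum_(i <- r | P i) F i) = \sum_(i <- r | P i) complex.Re (F i).
Proof. by elim/big_rec2: _ => // i y x _ <-; rewrite reD. Qed.
Lemma im_sum I (r : seq I) (P : pred I) (F : I -> K[i]) :
  complex.Im (\sum_(i <- r | P i) F i) = \sum_(i <- r | P i) complex.Im (F i).
Proof. by elim/big_rec2: _ => // i y x _ <-; rewrite imD. Qed.

Lemma cplxP z w :
  complex.Re z = complex.Re w -> complex.Im z = complex.Im w -> z = w.
Proof. by case: z; case: w => ? ? ? ? /= -> ->. Qed.

Lemma cmod_sqr z : cmod z ^+ 2 = complex.Re z ^+ 2 + complex.Im z ^+ 2.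
Proof. by rewrite cmodE sqr_sqrtr// addr_ge0// sqr_ge0. Qed.

Lemma cmodJ z : cmod (conjc z) = cmod z.
Proof. by rewrite !cmodE; case: z => x y /=; rewrite sqrrN. Qed.

(** Reduces a bound on a modulus to a bound on the real parts of [om * z] over all [om] in the unit
    disc. *)
Lemma cmod_phase z : exists2 om : K[i], cmod om <= 1 & om * z = (cmod z)%:C.
Proof.
have [z0|z0] := eqVneq (cmod z) 0.
  exists 0; first by rewrite cmod0.
  by rewrite mul0r z0.
exists (conjc z / (cmod z)%:C).
  by rewrite cmodM cmodV cmodJ cmodR ger0_norm ?cmod_ge0// divff.
have -> : conjc z / (cmod z)%:C * z = (cmod z ^+ 2 / cmod z)%:C.
  rewrite mulrAC rmorphM/= fmorphV/=; congr (_ / _).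
  by rewrite cmod_sqr; apply: cplxP; case: (z) => x y /=; ring.
by rewrite /= expr2 mulfK.
Qed.

(** Stands for the passage to the limit in every estimate with a geometric error term. *)
Lemma le_div2X (x A B : K) : (forall n, x <= B + A / 2 ^+ n) -> x <= B.
Proof.
move=> h; apply/ler_addgt0Pr => e e0.
have [n hn] : exists n : nat, `|A| / e < n%:R.
  exists (Num.bound (`|A| / e)).
  by apply: archi_boundP; rewrite divr_ge0// ltW.
apply: (le_trans (h n)); rewrite lerD2l.
rewrite ler_pdivrMr ?exprn_gt0// (le_trans (ler_norm _))//.
rewrite -ler_pdivrMl// mulrC (le_trans (ltW hn))//.
by rewrite -natrX ler_nat ltnW// ltn_expl.
Qed.

End complex_modulus.

(** * Everywhere convergent power series and the identity theorem *)

Section power_series.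
Variable K : realType.
Local Notation C := K[i].
Implicit Types (f g : C -> C) (a b : nat -> C).

Definition psum a n (w : C) : C := \sum_(k < n) a k * w ^+ k.

(* f is entire with Taylor coefficients a at 0: a geometric rate on every disc
   encodes the infinite radius of convergence, with no limit in K[i] involved. *)
Definition hasps f a := forall r : K, exists M : K,
  forall n w, cmod w <= r -> cmod (f w - psum a n w) <= M / 2 ^+ n.

Definition entire a :=
  forall r : K, 0 <= r -> exists M, forall k, cmod (a k) * r ^+ k <= M.

Lemma psum0 a w : psum a 0 w = 0.
Proof. by rewrite /psum big_ord0. Qed.

Lemma psumS a n w : psum a n.+1 w = psum a n w + a n * w ^+ n.
Proof. by rewrite /psum big_ord_recr. Qed.

Lemma psum_at0 a n : psum a n.+1 0 = a 0%N.
Proof.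
rewrite /psum big_ord_recl expr0 mulr1 big1 ?addr0// => i _.
by rewrite expr0n/= mulr0.
Qed.

(** Boundedness at radius q r is geometric decay of ratio 1/q at radius r, for any q chosen in
    advance. *)
Lemma entire_geo a (q r : K) : entire a -> 0 < q -> 0 <= r ->
  exists2 M, 0 < M & forall k, cmod (a k) * r ^+ k <= M / q ^+ k.
Proof.
move=> ea q0 r0; have [|M hM] := ea (q * r); first by rewrite mulr_ge0// ltW.
exists (`|M| + 1) => [|k]; first by rewrite ltr_wpDl.
rewrite ler_pdivlMr ?exprn_gt0// -mulrA [X in _ * X]mulrC -exprMn.
by rewrite (le_trans (hM k))// (le_trans (ler_norm _))// lerDl.
Qed.

(** The k-th term at w = r is a difference of two consecutive remainders, each at most M. *)
Lemma hasps_entire f a : hasps f a -> entire a.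
Proof.
move=> h r r0; have [M hM] := h r.
have r1 : cmod r%:C <= r by rewrite cmodR ger0_norm.
have M0 : 0 <= M by have := hM 0%N _ r1; rewrite expr0 divr1; exact/le_trans/cmod_ge0.
have le1 n : M / 2 ^+ n <= M.
  by rewrite ler_pdivrMr ?exprn_gt0// ler_peMr// exprn_ege1// ler1n.
exists (M + M) => k.
have -> : cmod (a k) * r ^+ k = cmod ((f r%:C - psum a k r%:C) - (f r%:C - psum a k.+1 r%:C)).
  rewrite psumS; have -> (x y z : C) : x - y - (x - (y + z)) = z by ring.
  by rewrite cmodM cmodX cmodR ger0_norm.
by rewrite (le_trans (cmodB _ _))// lerD// (le_trans (hM _ _ r1)).
Qed.

(** The right-hand side is the exact sum of M / 2^k for n <= k < m; keeping the subtracted term lets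
    the induction close. *)
Lemma psum_tail a (M r : K) w : (forall k, cmod (a k) * r ^+ k <= M / 2 ^+ k) ->
  cmod w <= r -> forall n m, (n <= m)%N ->
  cmod (psum a m w - psum a n w) <= (2 * M) / 2 ^+ n - (2 * M) / 2 ^+ m.
Proof.
move=> hM wr n m nm; rewrite -(subnK nm); elim: (m - n)%N => [|p IH].
  by rewrite add0n !subrr cmod0.
rewrite addSn psumS addrAC (le_trans (cmodD _ _))//.
have -> : 2 * M / 2 ^+ n - 2 * M / 2 ^+ (p + n).+1 =
  (2 * M / 2 ^+ n - 2 * M / 2 ^+ (p + n)) + M / 2 ^+ (p + n).
  by rewrite exprS; field; rewrite ?expf_neq0 ?pnatr_eq0.
rewrite lerD// (le_trans _ (hM _))// cmodM cmodX ler_wpM2l ?cmod_ge0//.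
by rewrite lerXn2r ?nnegrE ?cmod_ge0// (le_trans _ wr)// cmod_ge0.
Qed.

(** The intervals of radius B / 2^n about [u n] meet pairwise; the limit is the supremum of their
    lower ends. *)
Lemma geometric_limit (u : nat -> K) (B : K) :
  (forall n m, (n <= m)%N -> `|u m - u n| <= B / 2 ^+ n) ->
  exists l, forall n, `|l - u n| <= B / 2 ^+ n.
Proof.
move=> hu.
have B0 : 0 <= B.
  by have := hu 0%N 0%N (leqnn _); rewrite expr0 divr1; exact/le_trans/normr_ge0.
have Bn n : 0 <= B / 2 ^+ n by rewrite divr_ge0// exprn_ge0.
have key n m : u n - B / 2 ^+ n <= u m + B / 2 ^+ m.
  have [nm|/ltnW mn] := leqP n m.
    have := hu _ _ nm; rewrite ler_norml => /andP[h _].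
    by have := Bn m; lra.
  have := hu _ _ mn; rewrite ler_norml => /andP[_ h].
  by have := Bn n; lra.
pose S := [set u n - B / 2 ^+ n | n in setT].
have ubS m : ubound S (u m + B / 2 ^+ m) by move=> _ [n _ <-].
exists (sup S) => n; rewrite ler_distl; apply/andP; split.
  by apply: sup_upper_bound; [split; [exists (u 0%N - B / 2 ^+ 0); exists 0%N|exists (u 0%N + B / 2 ^+ 0)]|exists n].
by apply: sup_le_ub => //; exists (u 0%N - B / 2 ^+ 0); exists 0%N.
Qed.

Lemma entire_hasps a : entire a -> exists f, hasps f a.
Proof.
move=> ea.
(* r and M are quantified after l: the value at w depends on w alone, whereas [hasps] asks for one
   constant on a whole disc. *)
have lim (w : C) : exists l : C, forall r, cmod w <= r -> forall M,
    (forall k, cmod (a k) * r ^+ k <= M / 2 ^+ k) ->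
    forall n, cmod (l - psum a n w) <= (4 * M) / 2 ^+ n.
  have [M0 M00 hM0] := entire_geo ea (ltr0n K 2) (cmod_ge0 w).
  have cau n m : (n <= m)%N -> cmod (psum a m w - psum a n w) <= 2 * M0 / 2 ^+ n.
    move=> nm; apply: (le_trans (psum_tail hM0 (lexx _) nm)).
    by rewrite gerBl divr_ge0 ?exprn_ge0 ?mulr_ge0// ltW.
  have [|x hx] := @geometric_limit (fun n => complex.Re (psum a n w)) (2 * M0).
    move=> n m nm; rewrite -reN -reD (le_trans (ler_Re_cmod _))//; exact: cau.
  have [|y hy] := @geometric_limit (fun n => complex.Im (psum a n w)) (2 * M0).
    move=> n m nm; rewrite -imN -imD (le_trans (ler_Im_cmod _))//; exact: cau.
  exists (x +i* y) => r wr M hM n.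
  have M1 : 0 <= M by have := hM 0%N; rewrite !expr0 divr1 mulr1; exact/le_trans/cmod_ge0.
  apply: (@le_div2X _ _ (4 * M0)) => m.
  pose p := maxn m n.
  have -> : x +i* y - psum a n w =
      (x +i* y - psum a p w) + (psum a p w - psum a n w) by rewrite addrA subrK.
  rewrite (le_trans (cmodD _ _))// addrC lerD//.
    apply: (le_trans (psum_tail hM wr (leq_maxr m n))).
    have : 0 <= 2 * M / 2 ^+ maxn m n by rewrite divr_ge0 ?exprn_ge0 ?mulr_ge0.
    have : 0 <= M / 2 ^+ n by rewrite divr_ge0 ?exprn_ge0.
    set t1 := M / _; have -> : 2 * M / 2 ^+ n = 2 * t1 by rewrite mulrA.
    have -> : 4 * M / 2 ^+ n = 4 * t1 by rewrite mulrA.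
    by lra.
  apply: (le_trans (cmod_le_ReIm _)); rewrite reD reN imD imN /=.
  have h : 2 * M0 / 2 ^+ p <= 4 * M0 / 2 ^+ m / 2.
    have -> : 4 * M0 / 2 ^+ m / 2 = 2 * M0 / 2 ^+ m.
      by field; rewrite expf_neq0 ?pnatr_eq0.
    rewrite ler_wpM2l ?mulr_ge0 ?(ltW M00)// lef_pV2 ?posrE ?exprn_gt0//.
    by rewrite ler_weXn2l ?ler1n// leq_maxl.
  have := hx p; have := hy p; lra.
have [f hf] := choice lim; exists f => r.
have [r0|r0] := leP 0 r; last first.
  by exists 0 => n w wr; have := cmod_ge0 w; lra.
have [M M0 hM] := entire_geo ea (ltr0n K 2) r0.
by exists (4 * M) => n w wr; exact: hf wr _ hM n.
Qed.

Lemma hasps_at0 f a : hasps f a -> f 0 = a 0%N.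
Proof.
move=> h; have [M hM] := h 0; apply/eqP; rewrite -subr_eq0 -cmod_eq0.
rewrite eq_le cmod_ge0 andbT; apply: (@le_div2X _ _ M) => -[|n].
  rewrite add0r -[a 0%N](psum_at0 a 0); apply: le_trans (hM 1%N _ _) _.
    by rewrite cmod0.
  have M0 : 0 <= M.
    by have := hM 0%N 0; rewrite cmod0 expr0 divr1 => /(_ (lexx _)); exact/le_trans/cmod_ge0.
  by rewrite expr0 expr1 ler_pdivrMr// divr1 ler_peMr// ler1n.
by rewrite add0r -[a 0%N](psum_at0 a n); apply: hM; rewrite cmod0.
Qed.

(** The remainder vanishes at 0 to order m, which the rate 2^-m of [hasps] does not show. *)
Lemma hasps_tail f a : hasps f a -> exists2 A, 0 < A &
  forall m w, cmod w <= 1 -> cmod (f w - psum a m w) <= A * cmod w ^+ m.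
Proof.
move=> h; have [A A0 hA] := entire_geo (hasps_entire h) (ltr0n K 2) ler01.
have {}hA k : cmod (a k) <= A / 2 ^+ k by have := hA k; rewrite expr1n mulr1.
exists (2 * A) => [|m w w1]; first by rewrite mulr_gt0.
have [M hM] := h 1.
have c0 := cmod_ge0 w.
apply: (@le_div2X _ _ M) => p; pose q := maxn p m.
have -> : f w - psum a m w = (f w - psum a q w) + (psum a q w - psum a m w).
  by rewrite addrA subrK.
rewrite (le_trans (cmodD _ _))// addrC lerD//; last first.
  apply: (le_trans (hM _ _ w1)).
  have M0 : 0 <= M by have := hM 0%N w w1; rewrite expr0 divr1; exact/le_trans/cmod_ge0.
  rewrite ler_wpM2l// lef_pV2 ?posrE ?exprn_gt0//.
  by rewrite ler_weXn2l ?ler1n// leq_maxl.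
have mq : (m <= q)%N by rewrite leq_maxr.
have : cmod (psum a q w - psum a m w) <= (2 * A / 2 ^+ m - 2 * A / 2 ^+ q) * cmod w ^+ m.
  rewrite -(subnK mq); elim: (q - m)%N => [|i IH].
    by rewrite add0n !subrr cmod0 mul0r.
  rewrite addSn psumS addrAC (le_trans (cmodD _ _))//.
  have -> : 2 * A / 2 ^+ m - 2 * A / 2 ^+ (i + m).+1 =
    (2 * A / 2 ^+ m - 2 * A / 2 ^+ (i + m)) + A / 2 ^+ (i + m).
    by rewrite exprS; field; rewrite ?expf_neq0 ?pnatr_eq0.
  rewrite mulrDl lerD// cmodM cmodX ler_pM ?cmod_ge0 ?exprn_ge0//.
  by rewrite exprD ler_piMl ?exprn_ge0// exprn_ile1.
move/le_trans; apply; rewrite ler_wpM2r ?exprn_ge0//.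
have : 0 <= 2 * A / 2 ^+ q by rewrite divr_ge0 ?exprn_ge0 ?mulr_ge0// ltW.
have : 2 * A / 2 ^+ m <= 2 * A.
  rewrite ler_pdivrMr ?exprn_gt0// ler_peMr ?exprn_ege1 ?ler1n// mulr_ge0// ltW//.
by lra.
Qed.

(** Nonzero points accumulating at 0. They are real, so that identities known at real vectors only
    can feed the identity theorem. *)
Definition inv_seq n : C := (n.+1%:R^-1 : K)%:C.

Lemma cmod_inv_seq n : cmod (inv_seq n) = n.+1%:R^-1.
Proof. by rewrite cmodR ger0_norm. Qed.

Lemma inv_seq_small (e : K) : 0 < e ->
  exists N, forall n, (N <= n)%N -> cmod (inv_seq n) < e.
Proof.
move=> e0; exists (Num.bound e^-1) => n Nn; rewrite cmod_inv_seq.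
have /archi_boundP lt : 0 <= e^-1 by rewrite invr_ge0 ltW.
rewrite invf_plt ?posrE//; apply: (lt_le_trans lt).
by rewrite ler_nat (leq_trans Nn).
Qed.

(** If the coefficients below k vanish, then f(w) = a_k w^k + O(w^(k+1)); at a zero w this gives
    |a_k| <= A |w| with w arbitrarily small. *)
Lemma hasps_id0 f a N : hasps f a -> (forall n, (N <= n)%N -> f (inv_seq n) = 0) ->
  forall k, a k = 0.
Proof.
move=> h hf k; elim/ltn_ind: k => k IH.
have [A A0 hA] := hasps_tail h.
apply/eqP; apply: contraT; rewrite -cmod_gt0 => ak.
have [N' hN'] := inv_seq_small (divr_gt0 ak A0).
pose n := maxn N N'; have w0 : 0 < cmod (inv_seq n) by rewrite cmod_inv_seq.
have := hA k.+1 (inv_seq n); rewrite hf ?leq_maxl// sub0r cmodN psumS.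
rewrite /psum big1 ?add0r => [|i _]; last by rewrite IH ?mul0r.
rewrite cmodM cmodX exprSr mulrA mulrAC ler_pM2r ?exprn_gt0//.
have w1 : cmod (inv_seq n) <= 1 by rewrite cmod_inv_seq invf_le1// ler1n.
move=> /(_ w1); rewrite leNgt mulrC -ltr_pdivlMr// => /negP[].
by apply: hN'; rewrite leq_maxr.
Qed.

Lemma hasps0 f a : hasps f a -> (forall k, a k = 0) -> forall w, f w = 0.
Proof.
move=> h a0 w; have [M hM] := h (cmod w); apply/eqP; rewrite -cmod_eq0.
rewrite eq_le cmod_ge0 andbT; apply: (@le_div2X _ _ M) => n.
have := hM n w (lexx _); rewrite /psum big1 ?subr0 ?add0r// => i _.
by rewrite a0 mul0r.
Qed.

Lemma identity_theorem f a N : hasps f a ->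
  (forall n, (N <= n)%N -> f (inv_seq n) = 0) -> forall w, f w = 0.
Proof. by move=> h hf; apply: (hasps0 h); exact: hasps_id0 hf. Qed.

Lemma hasps_near0 f a : hasps f a -> f 0 != 0 ->
  exists N, forall n, (N <= n)%N -> f (inv_seq n) != 0.
Proof.
move=> h; rewrite (hasps_at0 h) -cmod_gt0 => a0.
have [A A0 hA] := hasps_tail h.
have [N hN] := inv_seq_small (divr_gt0 a0 A0).
exists N => n /hN; rewrite ltr_pdivlMr// => lt.
have w1 : cmod (inv_seq n) <= 1 by rewrite cmod_inv_seq invf_le1// ler1n.
have := hA 1%N _ w1; rewrite psumS psum0 add0r expr0 mulr1 expr1 => hf.
apply: contraTneq lt => f0; rewrite -leNgt mulrC.
by move: hf; rewrite f0 sub0r cmodN.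
Qed.

Lemma hasps_ext f g a : (forall w, f w = g w) -> hasps f a -> hasps g a.
Proof. by move=> /funext ->. Qed.

Lemma hasps_ext_coef f a b : (forall k, a k = b k) -> hasps f a -> hasps f b.
Proof. by move=> /funext ->. Qed.

Lemma haspsD f g a b : hasps f a -> hasps g b ->
  hasps (fun w => f w + g w) (fun k => a k + b k).
Proof.
move=> hf hg r; have [M hM] := hf r; have [L hL] := hg r.
exists (M + L) => n w wr.
have -> : psum (fun k => a k + b k) n w = psum a n w + psum b n w.
  by rewrite /psum -big_split/=; apply: eq_bigr => i _; rewrite mulrDl.
rewrite opprD addrACA (le_trans (cmodD _ _))// mulrDl lerD//; [exact: hM|exact: hL].
Qed.

Lemma haspsZ (c : C) f a : hasps f a -> hasps (fun w => c * f w) (fun k => c * a k).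
Proof.
move=> hf r; have [M hM] := hf r; exists (cmod c * M) => n w wr.
have -> : psum (fun k => c * a k) n w = c * psum a n w.
  by rewrite /psum mulr_sumr; apply: eq_bigr => i _; rewrite mulrA.
by rewrite -mulrBr cmodM -mulrA ler_wpM2l ?cmod_ge0//; exact: hM.
Qed.

Lemma haspsB f g a b : hasps f a -> hasps g b ->
  hasps (fun w => f w - g w) (fun k => a k - b k).
Proof.
move=> hf /(haspsZ (-1)) hg; have := haspsD hf hg.
move=> /hasps_ext_coef h; apply: hasps_ext (h _ _) => [w|k]; by rewrite mulN1r.
Qed.

Lemma hasps_horner (p : {poly C}) : hasps (fun w => p.[w]) (fun k => p`_k).
Proof.
move=> r; have [r0|r0] := leP 0 r; last first.
  by exists 0 => n w wr; have := cmod_ge0 w; lra.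
pose B := \sum_(k < size p) cmod p`_k * r ^+ k.
have B0 : 0 <= B by apply: sumr_ge0 => k _; rewrite mulr_ge0 ?cmod_ge0// exprn_ge0.
(* The power of 2 pays for the rate 2^-n while n < [size p]; from there on the remainder is zero. *)
exists (B * 2 ^+ size p) => n w wr.
have -> : p.[w] = psum (fun k => p`_k) (size p) w by rewrite horner_coef.
have [np|pn] := leqP (size p) n.
  suff -> : psum (fun k => p`_k) n w = psum (fun k => p`_k) (size p) w.
    by rewrite subrr cmod0 mulr_ge0 ?invr_ge0 ?exprn_ge0// mulr_ge0// exprn_ge0.
  rewrite -(subnK np); elim: (n - size p)%N => // i IH.
  by rewrite addSn psumS IH nth_default ?mul0r ?addr0// leq_addl.
have -> : psum (fun k => p`_k) (size p) w - psum (fun k => p`_k) n w =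
   \sum_(k < size p | (n <= k)%N) p`_k * w ^+ k.
  rewrite /psum (bigID (fun k : 'I__ => (n <= k)%N))/= addrC.
  rewrite (eq_bigl (fun k : 'I__ => (k < n)%N)) => [|k]; last by rewrite ltnNge.
  by rewrite -(big_ord_widen _ (fun k => p`_k * w ^+ k) (ltnW pn)) addrAC subrr add0r.
apply: (le_trans (cmod_sum _ _ _)).
have : \sum_(i < size p | (n <= i)%N) cmod (p`_i * w ^+ i) <= B.
  rewrite /B [leRHS](bigID (fun k : 'I__ => (n <= k)%N))/= -[leLHS]addr0 lerD//.
    apply: ler_sum => k _; rewrite cmodM cmodX ler_wpM2l ?cmod_ge0//.
    by rewrite lerXn2r ?nnegrE ?cmod_ge0.
  by apply: sumr_ge0 => k _; rewrite mulr_ge0 ?cmod_ge0// exprn_ge0.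
move=> /le_trans; apply; rewrite -mulrA ler_peMr//.
rewrite ler_pdivlMr ?exprn_gt0// mul1r.
by rewrite ler_weXn2l ?ler1n// ltnW.
Qed.

End power_series.

(** * Cauchy products and formal logarithmic derivatives *)

Section convolution.
Variable K : realType.
Local Notation C := K[i].
Implicit Types (f g : C -> C) (a b c u v : nat -> C).

Definition conv a b k : C := \sum_(i < k.+1) a i * b (k - i)%N.

(** A coefficient of a Cauchy product involves lower indices only, so the ring identities of [conv]
    are inherited from truncations in [{poly C}]. *)
Definition tpoly n a : {poly C} := \poly_(i < n) a i.

Lemma coef_tpoly n a k : (k < n)%N -> (tpoly n a)`_k = a k.
Proof. by move=> kn; rewrite coef_poly kn. Qed.

Lemma conv_tpoly n a b k : (k < n)%N -> conv a b k = (tpoly n a * tpoly n b)`_k.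
Proof.
move=> kn; rewrite coefM; apply: eq_bigr => i _; rewrite !coef_tpoly//.
  by rewrite (leq_ltn_trans _ kn)// leq_subr.
by rewrite (leq_ltn_trans _ kn)// -ltnS.
Qed.

Lemma conv_poly (p q : {poly C}) k :
  conv (fun i => p`_i) (fun i => q`_i) k = (p * q)`_k.
Proof. by rewrite coefM. Qed.

Lemma convC a b : conv a b =1 conv b a.
Proof. by move=> k; rewrite !(@conv_tpoly k.+1)// mulrC. Qed.

Lemma eq_conv n a a' b b' : (forall k, (k < n)%N -> a k = a' k) ->
  (forall k, (k < n)%N -> b k = b' k) -> forall k, (k < n)%N -> conv a b k = conv a' b' k.
Proof.
move=> ha hb k kn; apply: eq_bigr => i _; congr (_ * _).
  by apply: ha; rewrite (leq_ltn_trans _ kn)// -ltnS.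
by apply: hb; rewrite (leq_ltn_trans _ kn)// leq_subr.
Qed.

Lemma convA a b c : conv a (conv b c) =1 conv (conv a b) c.
Proof.
move=> k; have kS := ltnSn k.
have low x y i : (i < k.+1)%N -> conv x y i = (tpoly k.+1 x * tpoly k.+1 y)`_i.
  exact: conv_tpoly.
have lo x i : (i < k.+1)%N -> x i = (tpoly k.+1 x)`_i by move=> ?; rewrite coef_tpoly.
rewrite (eq_conv (lo a) (low b c) kS) (eq_conv (low a b) (lo c) kS).
by rewrite !conv_poly mulrA.
Qed.

Lemma convDr a b c : conv a (fun k => b k + c k) =1 (fun k => conv a b k + conv a c k).
Proof. by move=> k; rewrite /conv -big_split/=; apply: eq_bigr => i _; rewrite mulrDr. Qed.

(** Besides the remainders of f and g, the error consists of the terms of degree n to 2n - 1 in the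
    product of the truncations. Ratio 8 for each factor leaves 4^-k on its k-th coefficient, since k
    + 1 <= 2^k, and n such terms leave 2^-n. *)
Lemma hasps_mul f g a b : hasps f a -> hasps g b ->
  hasps (fun w => f w * g w) (conv a b).
Proof.
move=> hf hg r; have [r0|r0] := leP 0 r; last first.
  by exists 0 => n w wr; have := cmod_ge0 w; lra.
have [A A0 hA] := entire_geo (hasps_entire hf) (ltr0n K 8) r0.
have [B B0 hB] := entire_geo (hasps_entire hg) (ltr0n K 8) r0.
have [M hM] := hf r; have [L hL] := hg r.
exists (M * L + (M + M) * L + A * B) => n w wr.
have M0 : 0 <= M by have := hM 0%N w wr; rewrite expr0 divr1; exact/le_trans/cmod_ge0.
have L0 : 0 <= L by have := hL 0%N w wr; rewrite expr0 divr1; exact/le_trans/cmod_ge0.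
have x0 : 0 <= (2 ^+ n : K)^-1 by rewrite invr_ge0 exprn_ge0.
have x1 : (2 ^+ n : K)^-1 <= 1 by rewrite invf_le1 ?exprn_gt0// exprn_ege1// ler1n.
have -> : f w * g w - psum (conv a b) n w =
  (f w - psum a n w) * g w + psum a n w * (g w - psum b n w) +
  (psum a n w * psum b n w - psum (conv a b) n w) by ring.
rewrite (le_trans (cmodD _ _))// (mulrDl (M * L + _)) lerD//.
  rewrite (mulrDl (M * L)).
  rewrite (le_trans (cmodD _ _))// lerD// cmodM.
    rewrite mulrAC ler_pM ?cmod_ge0//; first exact: hM.
    by have := hL 0%N w wr; rewrite psum0 subr0 expr0 divr1.
  rewrite -mulrA ler_pM ?cmod_ge0//; last exact: hL.
  have -> : psum a n w = (f w - psum a 0 w) - (f w - psum a n w).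
    by rewrite psum0 subr0 opprB addrCA subrr addr0.
  rewrite (le_trans (cmodB _ _))// lerD//.
    by have := hM 0%N w wr; rewrite expr0 divr1.
  by rewrite (le_trans (hM _ _ wr))// ler_piMr.
pose P := tpoly n a; pose Q := tpoly n b.
have psumP c : psum c n w = (tpoly n c).[w].
  rewrite (horner_coef_wide w (size_poly n c)); apply: eq_bigr => i _.
  by rewrite coef_tpoly.
have sPQ : (size (P * Q)%R <= n + n)%N.
  rewrite (leq_trans (size_polyMleq _ _))//.
  rewrite (leq_trans (leq_pred _))// leq_add//; exact: size_poly.
have -> : psum a n w * psum b n w - psum (conv a b) n w =
    \sum_(k < n) (P * Q)`_(n + k) * w ^+ (n + k).
  rewrite !psumP -hornerM -psumP (horner_coef_wide w sPQ) big_split_ord/=.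
  rewrite addrAC [X in X - _](_ : _ = psum (conv a b) n w) ?subrr ?add0r//.
  by apply: eq_bigr => i _; rewrite (@conv_tpoly n).
have cPQ k : cmod ((P * Q)`_k) * r ^+ k <= A * B / 4 ^+ k.
  rewrite coefM (le_trans (ler_wpM2r (exprn_ge0 _ r0) (cmod_sum _ _ _)))//.
  rewrite mulr_suml.
  have step (i : 'I_k.+1) : cmod (P`_i * Q`_(k - i)) * r ^+ k <= A * B / 8 ^+ k.
    have hP : cmod P`_i * r ^+ i <= A / 8 ^+ i.
      rewrite coef_poly; case: ifP => _; first exact: hA.
      by rewrite cmod0 mul0r divr_ge0 ?exprn_ge0// ltW.
    have hQ : cmod Q`_(k - i) * r ^+ (k - i) <= B / 8 ^+ (k - i).
      rewrite coef_poly; case: ifP => _; first exact: hB.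
      by rewrite cmod0 mul0r divr_ge0 ?exprn_ge0// ltW.
    have ik : (i <= k)%N by rewrite -ltnS.
    have -> : r ^+ k = r ^+ i * r ^+ (k - i) by rewrite -exprD subnKC.
    have -> : (8 : K) ^+ k = 8 ^+ i * 8 ^+ (k - i) by rewrite -exprD subnKC.
    rewrite cmodM invfM mulrACA [leRHS]mulrACA.
    by rewrite ler_pM ?mulr_ge0 ?cmod_ge0 ?exprn_ge0.
  apply: le_trans (ler_sum _ (fun i _ => step i)) _.
  rewrite sumr_const card_ord -[_ *+ k.+1]mulr_natl.
  have -> : (8 : K) ^+ k = 2 ^+ k * 4 ^+ k by rewrite -exprMn; congr (_ ^+ _); ring.
  have -> : k.+1%:R * (A * B / (2 ^+ k * 4 ^+ k)) = (k.+1%:R / 2 ^+ k) * (A * B / 4 ^+ k).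
    by field; rewrite !expf_neq0 ?pnatr_eq0.
  rewrite ler_piMl ?divr_ge0 ?mulr_ge0 ?exprn_ge0 ?(ltW A0) ?(ltW B0)//.
  by rewrite ler_pdivrMr ?exprn_gt0// mul1r -natrX ler_nat ltn_expl.
rewrite (le_trans (cmod_sum _ _ _))//.
have step (k : 'I_n) : cmod ((P * Q)`_(n + k) * w ^+ (n + k)) <= A * B / 4 ^+ n.
  have wn : cmod w ^+ (n + k) <= r ^+ (n + k) by rewrite lerXn2r ?nnegrE ?cmod_ge0.
  rewrite cmodM cmodX; apply: le_trans (ler_wpM2l (cmod_ge0 _) wn) _.
  apply: le_trans (cPQ _) _.
  rewrite ler_wpM2l ?mulr_ge0 ?(ltW A0) ?(ltW B0)//.
  rewrite lef_pV2 ?posrE ?exprn_gt0// ler_weXn2l ?ler1n//.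
  exact: leq_addr.
apply: le_trans (ler_sum _ (fun i _ => step i)) _.
rewrite sumr_const card_ord -[_ *+ n]mulr_natl.
have -> : (4 : K) ^+ n = 2 ^+ n * 2 ^+ n by rewrite -exprMn; congr (_ ^+ _); ring.
have -> : n%:R * (A * B / (2 ^+ n * 2 ^+ n)) = (n%:R / 2 ^+ n) * (A * B / 2 ^+ n).
  by field; rewrite !expf_neq0 ?pnatr_eq0.
rewrite ler_piMl ?mulr_ge0 ?(ltW A0) ?(ltW B0)//.
by rewrite ler_pdivrMr ?exprn_gt0// mul1r -natrX ler_nat ltnW// ltn_expl.
Qed.

Lemma hasps_mul_eq0 f g a b : hasps f a -> hasps g b -> g 0 != 0 ->
  (forall w, f w * g w = 0) -> forall w, f w = 0.
Proof.
move=> hf hg g0 fg0; have [N hN] := hasps_near0 hg g0.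
apply: (identity_theorem (N := N) hf) => n /hN gn.
by have /eqP := fg0 (inv_seq K n); rewrite mulf_eq0 (negbTE gn) orbF => /eqP.
Qed.

Lemma hasps_uniq f a b : hasps f a -> hasps f b -> a =1 b.
Proof.
move=> ha hb k; have := haspsB ha hb.
move=> /(@hasps_id0 _ _ _ 0) h; apply/eqP; rewrite -subr_eq0; apply/eqP.
by apply: h => n _; rewrite subrr.
Qed.

(** Each value of [logd] depends on all earlier ones, so the recursion carries the list of them. *)
Fixpoint logd_seq a n : seq C :=
  if n is m.+1 then
    rcons (logd_seq a m)
      (m.+1%:R * a m.+1 - \sum_(i < m) (logd_seq a m)`_i * a (m - i)%N)
  else [::].

(* Coefficients of the formal logarithmic derivative a'/a, meaningful when a 0 = 1. *)
Definition logd a n : C := (logd_seq a n.+1)`_n.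

Lemma size_logd_seq a n : size (logd_seq a n) = n.
Proof. by elim: n => //= n IH; rewrite size_rcons IH. Qed.

Lemma nth_logd_seq a n i : (i < n)%N -> (logd_seq a n)`_i = logd a i.
Proof.
elim: n => // n IH; rewrite ltnS leq_eqVlt => /predU1P[->//|lt] /=.
by rewrite nth_rcons size_logd_seq lt IH.
Qed.

Lemma logdE a n :
  logd a n = n.+1%:R * a n.+1 - \sum_(i < n) logd a i * a (n - i)%N.
Proof.
rewrite {1}/logd /= nth_rcons size_logd_seq ltnn eqxx; congr (_ - _).
by apply: eq_bigr => i _; rewrite nth_logd_seq.
Qed.

(** The coefficients of the derivative. *)
Definition dseq a k : C := k.+1%:R * a k.+1.

Lemma conv_logd a : a 0%N = 1 -> conv (logd a) a =1 dseq a.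
Proof.
move=> a0 k; rewrite /conv big_ord_recr/= subnn a0 mulr1 (logdE a k).
by rewrite addrC subrK.
Qed.

(** With a_0 = 1, the equation u a = a' is a unitriangular system in u. *)
Lemma logd_uniq a u : a 0%N = 1 -> conv u a =1 dseq a -> u =1 logd a.
Proof.
move=> a0 h k; elim/ltn_ind: k => k IH; rewrite logdE.
have := h k; rewrite /conv big_ord_recr/= subnn a0 mulr1 /dseq => <-.
rewrite addrC -addrA [X in X - _](eq_bigr (fun i : 'I_k => logd a i * a (k - i)%N)).
  by rewrite subrr addr0.
by move=> i _; rewrite IH.
Qed.

Lemma dseq_conv a b : dseq (conv a b) =1 (fun k => conv (dseq a) b k + conv a (dseq b) k).
Proof.
move=> k; rewrite /dseq /conv mulr_sumr.
have -> : \sum_(i < k.+2) k.+1%:R * (a i * b (k.+1 - i)%N) =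
  \sum_(i < k.+2) (i%:R * a i * b (k.+1 - i)%N) +
  \sum_(i < k.+2) a i * ((k.+1 - i)%:R * b (k.+1 - i)%N).
  rewrite -big_split/=; apply: eq_bigr => i _.
  have -> : k.+1%:R = i%:R + (k.+1 - i)%:R :> C by rewrite -natrD subnKC// -ltnS.
  by ring.
congr (_ + _).
  by rewrite big_ord_recl !mul0r add0r; apply: eq_bigr => i _; rewrite lift0 subSS.
rewrite big_ord_recr/= subnn mul0r mulr0 addr0; apply: eq_bigr => i _.
by rewrite subSn// -ltnS.
Qed.

Lemma conv0 a b : conv a b 0%N = a 0%N * b 0%N.
Proof. by rewrite /conv big_ord_recl big_ord0 addr0. Qed.

(** By the Leibniz rule, the sum solves the equation that characterizes the logarithmic derivative
    of the product. *)
Lemma logd_conv a b : a 0%N = 1 -> b 0%N = 1 ->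
  logd (conv a b) =1 (fun k => logd a k + logd b k).
Proof.
move=> a0 b0 k; apply/esym; move: k; apply: logd_uniq.
  by rewrite conv0 a0 b0 mulr1.
move=> k; rewrite dseq_conv -(funext (conv_logd a0)) -(funext (conv_logd b0)).
rewrite convC convDr -(convA a b (logd b)) (convC _ (logd a)) convA; congr (_ + conv a _ k).
by apply: funext; exact: convC.
Qed.

Lemma logd_ext n a b : (forall k, (k <= n.+1)%N -> a k = b k) -> logd a n = logd b n.
Proof.
elim/ltn_ind: n => n IH h; rewrite !logdE h//; congr (_ - _).
apply: eq_bigr => i _; rewrite h ?(leq_trans (leq_subr _ _))//; congr (_ * _).
by apply: IH => // k ki; apply: h; rewrite (leq_trans ki)// ltnS ltnW.
Qed.

(** The equation a' = L a with a_0 = 1 determines a recursively, after division by k + 1. *)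
Lemma logd_inj a b : a 0%N = 1 -> b 0%N = 1 -> logd a =1 logd b -> a =1 b.
Proof.
move=> a0 b0 h k; elim/ltn_ind: k => -[|k] IH; first by rewrite a0.
have := conv_logd a0 k; have := conv_logd b0 k.
rewrite (@eq_conv k.+1 _ (logd a) _ a) => [->||i ik|//]; last by rewrite IH.
  by move/(mulfI _) => -> //; rewrite pnatr_eq0.
by move=> i _; rewrite h.
Qed.

(** The geometric series of - x / (1 - x w). *)
Lemma logd_lin (x : C) k : logd (fun i => (1 - x *: 'X)`_i) k = - x ^+ k.+1.
Proof.
have ck i : (1 - x *: 'X)`_i = (i == 0%N)%:R - x * (i == 1%N)%:R.
  by rewrite coefB coef1 coefZ coefX.
apply/esym; move: k.
apply: (@logd_uniq _ (fun k => - x ^+ k.+1)); first by rewrite ck/= mulr0 subr0.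
move=> [|k]; rewrite /conv /dseq.
  by rewrite big_ord_recl big_ord0 !ck /= expr1; ring.
rewrite 2!big_ord_recr/= big1 ?add0r => [|i _].
  rewrite subnn subSn// subnn !ck/=. rewrite (exprS x k.+1); move: (x ^+ _) => y; ring.
rewrite !ck; have -> : (k.+1 - i == 0)%N = false by apply/eqP; have := ltn_ord i; lia.
have -> : (k.+1 - i == 1)%N = false by apply/eqP; have := ltn_ord i; lia.
by rewrite mulr0 subr0 mulr0.
Qed.

End convolution.

(** * Entire functions of order less than 2 *)

Section roots_of_unity.
Variable K : realType.
Local Notation C := K[i].

(** X^n - 1 splits and is separable, so it has n distinct roots, and a group of n such roots has a
    generator. *)
Lemma closed_prim_root (F : closedFieldType) n : (0 < n)%N -> n%:R != 0 :> F ->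
  exists z : F, n.-primitive_root z.
Proof.
move=> n0 nF; pose p : {poly F} := 'X^n - 1.
have [r Dp] := closed_field_poly_normal p.
have lp : lead_coef p = 1 by apply/monicP; exact: monicXnsubC.
rewrite lp scale1r in Dp.
have rn1 : all n.-unity_root r by apply/allP => z; rewrite -root_prod_XsubC -Dp.
have sr : (n < (size r).+1)%N by rewrite -(size_prod_XsubC r id) -Dp size_XnsubC.
have [|z] := hasP (cyclic.has_prim_root n0 rn1 _ sr); last by exists z.
by rewrite -separable.separable_prod_XsubC -Dp cyclotomic.separable_Xn_sub_1.
Qed.

Lemma prim_root_exists n : (0 < n)%N -> exists z : C, n.-primitive_root z.
Proof. by move=> n0; apply: closed_prim_root => //; rewrite pnatr_eq0 -lt0n. Qed.

Lemma sum_prim_root n (z : C) j : n.-primitive_root z -> ~~ (n %| j)%N ->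
  \sum_(l < n) z ^+ (l * j) = 0.
Proof.
move=> hz nj; have zj : z ^+ j != 1 by rewrite -(prim_order_dvd hz).
have := subrX1 (z ^+ j) n; rewrite -exprM mulnC exprM (prim_expr_order hz) expr1n subrr.
move=> /esym/eqP; rewrite mulf_eq0 subr_eq0 (negbTE zj)/= => /eqP h.
by rewrite -[RHS]h; apply: eq_bigr => l _; rewrite -exprM mulnC.
Qed.

Lemma cmod_prim_root n (z : C) : n.-primitive_root z -> cmod z = 1.
Proof.
move=> hz; have /eqP := congr1 (@cmod K) (prim_expr_order hz).
by rewrite cmodX cmod1 pexpr_eq1 ?(prim_order_gt0 hz) ?cmod_ge0// => /eqP.
Qed.

Lemma conjc_unit (z : C) : cmod z = 1 -> conjc z = z^-1.
Proof.
move=> z1; rewrite invc_norm (_ : `|z| = (cmod z)%:C)//.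
by rewrite z1 expr1n invr1 mul1r.
Qed.

(** A discrete Cauchy formula: the mean over the n-th roots of unity isolates a_k exactly in the
    partial sum of length n > k, and replacing f by this partial sum costs a geometric error. *)
Lemma cauchy_estimate (f : C -> C) a (r S : K) : hasps f a -> 0 <= r ->
  (forall w, cmod w = r -> cmod (f w) <= S) -> forall k, cmod (a k) * r ^+ k <= S.
Proof.
move=> hf r0 hS k; have [M hM] := hf r.
apply: (@le_div2X _ _ (`|M| * 2 ^+ k.+1)) => p.
pose n := (p + k.+1)%N.
have n0 : (0 < n)%N by rewrite /n addnS.
have kn : (k < n)%N by rewrite /n leq_addl.
have nK : (n%:R : K) > 0 by rewrite ltr0n.
have nC : (n%:R : C) != 0 by rewrite pnatr_eq0 -lt0n.
have [z hz] := prim_root_exists n0.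
have z1 := cmod_prim_root hz.
have wr l : cmod (r%:C * z ^+ l) = r by rewrite cmodM cmodX z1 expr1n mulr1 cmodR ger0_norm.
(* The exponent [l * (n - k)] plays the role of [- l * k], with no negative powers. *)
have key : a k * r%:C ^+ k * n%:R = \sum_(l < n) z ^+ (l * (n - k)) * psum a n (r%:C * z ^+ l).
  rewrite /psum (eq_bigr (fun l : 'I_n => \sum_(j < n) a j * r%:C ^+ j * z ^+ (l * (n - k + j)))); last first.
    move=> l _; rewrite mulr_sumr; apply: eq_bigr => j _.
    by rewrite mulnDr exprD exprMn -(exprM z l j); ring.
  rewrite exchange_big (bigD1 (Ordinal kn))//= [X in _ + X]big1 ?addr0; last first.
    move=> j jk; rewrite -mulr_sumr (sum_prim_root hz) ?mulr0//.
    have {}jk : (j : nat) != k by [].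
    apply/negP => /dvdnP[q hq]; have := ltn_ord j; case: q hq => [|[|q]] hq.
    - by rewrite mul0n in hq; lia.
    - by rewrite mul1n in hq; move/eqP: jk; lia.
    - by rewrite !mulSn in hq; lia.
  rewrite subnK ?(ltnW kn)// -mulr_sumr; congr (_ * _).
  rewrite (eq_bigr (fun=> 1)) => [|l _]; first by rewrite sumr_const card_ord.
  by rewrite mulnC exprM (prim_expr_order hz) expr1n.
have : cmod (a k) * r ^+ k * n%:R <= (S + `|M| / 2 ^+ n) * n%:R.
  have -> : cmod (a k) * r ^+ k * n%:R = cmod (a k * r%:C ^+ k * n%:R).
    by rewrite !cmodM cmodX cmodR cmod_nat (ger0_norm r0).
  rewrite key (le_trans (cmod_sum _ _ _))// [leRHS]mulr_natr.
  rewrite -[X in _ *+ X]card_ord -sumr_const; apply: ler_sum => l _.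
  rewrite cmodM cmodX z1 expr1n mul1r.
  have -> : psum a n (r%:C * z ^+ l) = f (r%:C * z ^+ l) - (f (r%:C * z ^+ l) - psum a n (r%:C * z ^+ l)).
    by rewrite opprB addrC subrK.
  rewrite (le_trans (cmodB _ _))// lerD//; first exact: hS.
  rewrite (le_trans (hM _ _ _)) ?wr// ler_wpM2r ?ler_norm// invr_ge0 exprn_ge0//.
rewrite ler_pM2r// => /le_trans; apply; rewrite lerD2l.
have -> : `|M| * 2 ^+ k.+1 / 2 ^+ p = `|M| / 2 ^+ p * 2 ^+ k.+1 by rewrite mulrAC.
rewrite /n exprD invfM mulrA ler_wpM2l ?divr_ge0 ?exprn_ge0//.
rewrite (@le_trans _ _ 1)//; last by rewrite exprn_ege1// ler1n.
by rewrite invf_le1 ?exprn_gt0// exprn_ege1// ler1n.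
Qed.

End roots_of_unity.

(** * A lower bound for ln |1 - b| from its truncated expansion *)

Section log_modulus.
Variable K : realType.
Local Notation C := K[i].

Lemma ndecr01 (f df : K -> K) :
  (forall x : K, 0 <= x <= 1 -> is_derive x 1 f (df x)) ->
  (forall x : K, 0 <= x <= 1 -> 0 <= df x) -> f 0 <= f 1.
Proof.
move=> fd d0; have [x||c c01 h] := @MVT_segment K f df 0 1 ler01.
- by rewrite in_itv/= => /andP[a b]; apply: fd; rewrite !ltW.
- apply: derivable_within_continuous => x; rewrite in_itv/= => x01.
  by have [] := fd x x01.
- by rewrite -subr_ge0 h subr0 mulr1; apply: d0; rewrite in_itv/= in c01.
Qed.

Lemma deriv_powsum (c : nat -> K) n (x : K) :
  is_derive x 1 (fun t : K => \sum_(j < n) c j / j.+1%:R * t ^+ j.+1)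
    (\sum_(j < n) c j * x ^+ j).
Proof.
elim: n => [|n IH].
  rewrite big_ord0 (_ : (fun _ => _) = cst 0).
    exact: is_derive_cst.
  by apply/funext => t; rewrite big_ord0.
rewrite big_ord_recr/= (_ : (fun _ => _) = (fun t : K => \sum_(j < n) c j / j.+1%:R * t ^+ j.+1)
   + (c n / n.+1%:R) \*: (fun t : K => t) ^+ n.+1); last first.
  by apply/funext => t; rewrite big_ord_recr/= !fctE.
apply: is_deriveD; apply: is_derive_eq.
rewrite /GRing.scale/= mulr1 [X in _ * X](_ : _ = n.+1%:R * x ^+ n).
  by rewrite mulrA divfK// pnatr_eq0.
by [].
Qed.

(** The gap between the two sides, with b replaced by t b and the error term by t e, is zero at t =
    0 and nondecreasing on [0, 1]: its derivative is e + Re(- b (t b)^N / (1 - t b)), and |1 - t b|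
    >= 1 - |b|. Only real derivatives occur, through q(t) = |1 - t b|^2. *)
Lemma ln_cmod1B_ge (b : C) N : cmod b < 1 ->
  - complex.Re (\sum_(j < N) b ^+ j.+1 / j.+1%:R) - cmod b ^+ N.+1 / (1 - cmod b)
    <= ln (cmod (1 - b)).
Proof.
move=> b1; set e := cmod b ^+ N.+1 / _.
have b1' : 0 < 1 - cmod b by rewrite subr_gt0.
pose x := complex.Re b; pose y := complex.Im b.
pose q (t : K) := (1 - t * x) ^+ 2 + (t * y) ^+ 2.
have tb (t : K) : 0 <= t <= 1 -> cmod (t%:C * b) <= cmod b.
  by move=> /andP[t0 t1]; rewrite cmodM cmodR ger0_norm// ler_piMl// cmod_ge0.
have qE (t : K) : q t = cmod (1 - t%:C * b) ^+ 2.
  rewrite cmod_sqr /q !(reD, reN, reM, imD, imN, imM)/= -/x -/y; ring.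
have nz (t : K) : 0 <= t <= 1 -> 1 - cmod b <= cmod (1 - t%:C * b).
  move=> /tb h; have := cmodD (1 - t%:C * b) (t%:C * b); rewrite subrK cmod1; lra.
have q0 (t : K) : 0 <= t <= 1 -> 0 < q t.
  by move=> /nz h; rewrite qE exprn_gt0// (lt_le_trans b1').
pose c (j : nat) := complex.Re (b ^+ j.+1).
pose h (t : K) := ln (q t) / 2 + \sum_(j < N) c j / j.+1%:R * t ^+ j.+1 + t * e.
pose dh (t : K) := (x * (t * x - 1) + y * (t * y)) / q t + \sum_(j < N) c j * t ^+ j + e.
have hd (t : K) : 0 <= t <= 1 -> is_derive t 1 h (dh t).
  move=> t01; rewrite /h /dh.
  have dq : is_derive t 1 q (2 * (x * (t * x - 1) + y * (t * y))).
    have -> : q = (fun t => 1 - t * x) ^+ 2 + (fun t => t * y) ^+ 2.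
      by apply/funext => s; rewrite !fctE.
    have d1 : is_derive t 1 (fun t : K => 1 - t * x) (- x).
      have -> : (fun t : K => 1 - t * x) = cst 1 - (x \*: id).
        by apply/funext => s; rewrite /= /GRing.scale/= mulrC.
      by apply: is_derive_eq; rewrite sub0r /GRing.scale/= mulr1.
    have d2 : is_derive t 1 (fun t : K => t * y) y.
      have -> : (fun t : K => t * y) = (y \*: id).
        by apply/funext => s; rewrite /= /GRing.scale/= mulrC.
      by apply: is_derive_eq; rewrite /GRing.scale/= mulr1.
    apply: is_derive_eq; rewrite /GRing.scale/= !expr1; ring.
  have dl : is_derive t 1 (fun t => ln (q t) / 2) ((x * (t * x - 1) + y * (t * y)) / q t).
    have -> : (fun t => ln (q t) / 2) = (2^-1 \*: (@ln K \o q)).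
      by apply/funext => s; rewrite /= /GRing.scale/= mulrC.
    have := is_deriveZ (2^-1 : K) (is_derive1_comp (is_derive1_ln (q0 _ t01)) dq).
    move=> /is_derive_eq; apply; rewrite /GRing.scale/=; field.
    by rewrite gt_eqF ?q0.
  have de : is_derive t 1 (fun t : K => t * e) e.
    have -> : (fun t : K => t * e) = (e \*: id).
      by apply/funext => s; rewrite /= /GRing.scale/= mulrC.
    by apply: is_derive_eq; rewrite /GRing.scale/= mulr1.
  apply: (@is_deriveD _ _ _ (fun t => ln (q t) / 2 + \sum_(j < N) c j / j.+1%:R * t ^+ j.+1)) => //.
  apply: (@is_deriveD _ _ _ (fun t => ln (q t) / 2)) => //.
  exact: deriv_powsum.
have dh0 (t : K) : 0 <= t <= 1 -> 0 <= dh t.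
  move=> t01; pose u := 1 - t%:C * b.
  have u0 : u != 0 by rewrite -cmod_gt0 (lt_le_trans b1')// nz.
  have -> : dh t = complex.Re (- b * (t%:C * b) ^+ N / u) + e.
    rewrite /dh; congr (_ + _).
    have -> : \sum_(j < N) c j * t ^+ j = complex.Re (\sum_(j < N) b * (t%:C * b) ^+ j).
      rewrite re_sum; apply: eq_bigr => j _; rewrite exprMn mulrCA -exprS -rmorphXn /= reM /=.
      by rewrite mul0r subr0 mulrC.
    have -> : (x * (t * x - 1) + y * (t * y)) / q t = complex.Re (- b / u).
      rewrite invc_norm (_ : `|u| = (cmod u)%:C)// -rmorphXn/= -fmorphV/= qE -/u.
      have [rJ iJ] : complex.Re (conjc u) = complex.Re u /\ complex.Im (conjc u) = - complex.Im u.
        by case: (u).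
      rewrite [LHS]mulrC [in RHS]mulrCA reM mul0r subr0; congr (_ * _).
      by rewrite reM rJ iJ !(reD, reN, reM, imD, imN, imM)/= -/x -/y; ring.
    rewrite -reD; congr complex.Re.
    have := subrX1 (t%:C * b) N; rewrite -mulr_sumr => hg.
    have {hg} -> : \sum_(i < N) (t%:C * b) ^+ i = (1 - (t%:C * b) ^+ N) / u.
      apply: (mulIf u0); rewrite divfK//.
      by rewrite -[1 - _]opprB hg /u; ring.
    by field.
  have : cmod (- b * (t%:C * b) ^+ N / u) <= e.
    rewrite !cmodM cmodV cmodN cmodX /e exprS ler_pM ?mulr_ge0 ?exprn_ge0 ?invr_ge0 ?cmod_ge0//.
      by rewrite ler_wpM2l ?cmod_ge0// lerXn2r ?nnegrE ?cmod_ge0// tb.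
    by rewrite lef_pV2 ?posrE// ?cmod_gt0// nz.
  have := ler_Re_cmod (- b * (t%:C * b) ^+ N / u); rewrite ler_norml => /andP[]; lra.
have q00 : q 0 = 1 by rewrite /q; ring.
have := ndecr01 hd dh0; rewrite /h q00 ln1 !mul0r addr0 add0r big1; last first.
  by move=> j _; rewrite expr0n/= mulr0.
rewrite mul1r => h1.
rewrite -subr_ge0; apply: (le_trans h1).
have -> : cmod (1 - b) = Num.sqrt (q 1).
  by rewrite qE sqrtr_sqr ger0_norm ?cmod_ge0// mul1r.
have -> : ln (Num.sqrt (q 1)) = ln (q 1) / 2.
  have q1 : 0 < q 1 by apply: q0; rewrite ler01 lexx.
  have -> : ln (q 1) = ln (Num.sqrt (q 1)) + ln (Num.sqrt (q 1)).
    by rewrite -lnM ?posrE ?sqrtr_gt0// -expr2 sqr_sqrtr// ltW.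
  by rewrite mulrDl -splitr.
rewrite /q !mul1r re_sum.
rewrite [X in _ + X + _](_ : _ = \sum_(i < N) complex.Re (b ^+ i.+1 / i.+1%:R)).
  by rewrite opprB opprK addrA addrAC; set s := \sum_(i < N) _; set l := ln _; lra.
apply: eq_bigr => j _; rewrite expr1n mulr1 /c.
have -> : (j.+1%:R : C)^-1 = (j.+1%:R^-1 : K)%:C by rewrite fmorphV rmorph_nat.
by rewrite reM/= mulr0 subr0.
Qed.

End log_modulus.

(** * Minimum of the modulus on a disc and weighted means of logarithms *)

Section borel_caratheodory.
Variable K : realType.
Local Notation C := K[i].
Implicit Types (f g : C -> C) (a b : nat -> C).

Lemma cmod_subXn (w v : C) (R : K) k : 1 <= R -> cmod w <= R -> cmod v <= R ->
  cmod (w ^+ k - v ^+ k) <= k%:R * R ^+ k * cmod (w - v).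
Proof.
move=> R1 wR vR; have R0 : 0 <= R by lra.
elim: k => [|k IH]; first by rewrite !expr0 subrr cmod0 !mul0r.
have -> : w ^+ k.+1 - v ^+ k.+1 = w * (w ^+ k - v ^+ k) + (w - v) * v ^+ k.
  by rewrite !exprS; ring.
rewrite (le_trans (cmodD _ _))// !cmodM cmodX -natr1 mulrDl mul1r mulrDl lerD//.
  by rewrite exprS mulrCA -mulrA ler_pM ?cmod_ge0.
rewrite mulrC ler_wpM2r ?cmod_ge0// (@le_trans _ _ (R ^+ k))//.
  by rewrite lerXn2r ?nnegrE ?cmod_ge0.
by rewrite exprS ler_peMl ?exprn_ge0.
Qed.

(** Termwise, with |w^n - v^n| <= n R^n |w - v|: decay of ratio 4 absorbs the factor n and leaves
    2^-n. *)
Lemma hasps_lipschitz f a (R : K) : hasps f a -> 1 <= R ->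
  exists2 L, 0 < L & forall w v, cmod w <= R -> cmod v <= R ->
    cmod (f w - f v) <= L * cmod (w - v).
Proof.
move=> hf R1; have R0 : 0 <= R by lra.
have [A A0 hA] := entire_geo (hasps_entire hf) (ltr0n K 4) R0.
have [M hM] := hf R.
exists (2 * A) => [|w v wR vR]; first by rewrite mulr_gt0.
have ps n : cmod (psum a n w - psum a n v) <= (2 * A - 2 * A / 2 ^+ n) * cmod (w - v).
  elim: n => [|n IH]; first by rewrite !psum0 expr0 divr1 !subrr cmod0 mul0r.
  rewrite !psumS opprD addrACA (le_trans (cmodD _ _))//.
  have -> : 2 * A - 2 * A / 2 ^+ n.+1 = (2 * A - 2 * A / 2 ^+ n) + A / 2 ^+ n.
    by rewrite exprS; field; rewrite ?expf_neq0 ?pnatr_eq0.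
  rewrite mulrDl lerD// -mulrBr cmodM.
  apply: (le_trans (ler_wpM2l (cmod_ge0 _) (cmod_subXn n R1 wR vR))).
  rewrite mulrA ler_wpM2r ?cmod_ge0// mulrCA.
  apply: (@le_trans _ _ (n%:R * (A / 4 ^+ n))); first by rewrite ler_wpM2l.
  have -> : (4 : K) ^+ n = 2 ^+ n * 2 ^+ n by rewrite -exprMn; congr (_ ^+ _); ring.
  have -> : n%:R * (A / (2 ^+ n * 2 ^+ n)) = (n%:R / 2 ^+ n) * (A / 2 ^+ n).
    by field; rewrite !expf_neq0 ?pnatr_eq0.
  rewrite ler_piMl ?divr_ge0 ?exprn_ge0 ?(ltW A0)//.
  by rewrite ler_pdivrMr ?exprn_gt0// mul1r -natrX ler_nat ltnW// ltn_expl.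
apply: (@le_div2X _ _ (M + M)) => n.
have -> : f w - f v = (psum a n w - psum a n v) + ((f w - psum a n w) - (f v - psum a n v)).
  by ring.
rewrite (le_trans (cmodD _ _))// lerD//.
  rewrite (le_trans (ps n))// ler_wpM2r ?cmod_ge0// gerBl.
  by rewrite divr_ge0 ?exprn_ge0 ?mulr_ge0 ?(ltW A0).
by rewrite (le_trans (cmodB _ _))// mulrDl lerD// hM.
Qed.

(** Real coordinates make the disc a closed part of a product of segments, so that a minimum of the
    modulus is attained on it. *)
Lemma hasps_continuous f a : hasps f a ->
  continuous (fun p : K * K => cmod (f (p.1 +i* p.2))).
Proof.
move=> hf p; set z := p.1 +i* p.2.
have R1 : 1 <= cmod z + 2 by have := cmod_ge0 z; lra.
have [L L0 hL] := hasps_lipschitz hf R1.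
apply/cvgrPdist_lt => e e0.
(* A ball of [K * K] bounds each coordinate, so the complex distance is below twice this radius: at
   most 2, which stays where L is valid, and at most e / L. *)
have d0 : 0 < Num.min 1 (e / (2 * L)).
  by rewrite lt_min ltr01 divr_gt0// mulr_gt0.
near=> q; rewrite -/z.
have hq : cmod (z - (q.1 +i* q.2)) < 2 * Num.min 1 (e / (2 * L)).
  apply: (le_lt_trans (cmod_le_ReIm _)); rewrite reD imD reN imN /=.
  have [b1 b2] : ball p (Num.min 1 (e / (2 * L))) q.
    near: q; apply: (@nbhsx_ballx _ (K * K)%type p _ d0).
  move: b1 b2; rewrite /ball/= /ball/= => b1 b2.
  by rewrite mulr_natl mulr2n ltrD.
have hq1 : cmod (q.1 +i* q.2) <= cmod z + 2.
  have -> : q.1 +i* q.2 = z - (z - (q.1 +i* q.2)) by rewrite opprB addrC subrK.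
  rewrite (le_trans (cmodB _ _))// lerD2l (le_trans (ltW hq))//.
  by rewrite ler_piMr// ge_min lexx.
have zR : cmod z <= cmod z + 2 by rewrite lerDl.
have : `|cmod (f z) - cmod (f (q.1 +i* q.2))| <= cmod (f z - f (q.1 +i* q.2)).
  have := cmodD (f z - f (q.1 +i* q.2)) (f (q.1 +i* q.2)).
  have := cmodD (f (q.1 +i* q.2) - f z) (f z).
  by rewrite !subrK (cmodBC (f (q.1 +i* q.2))) ler_norml; lra.
move=> /le_lt_trans; apply; apply: (le_lt_trans (hL _ _ zR hq1)).
rewrite mulrC -ltr_pdivlMr//; apply: (lt_le_trans hq).
apply: (@le_trans _ _ (2 * (e / (2 * L)))); first by rewrite ler_pM2l// ge_min lexx orbT.
by rewrite le_eqVlt; apply/orP; left; apply/eqP; field; rewrite gt_eqF.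
Unshelve. all: by end_near.
Qed.

Lemma hasps_lower_bound f a (r : K) : hasps f a -> 0 <= r ->
  (forall w, cmod w <= r -> f w != 0) ->
  exists2 d, 0 < d & forall w, cmod w <= r -> d <= cmod (f w).
Proof.
move=> hf r0 nz.
pose A := [set p : K * K | cmod (p.1 +i* p.2) <= r].
have cA : compact A.
  apply: (@subclosed_compact _ _ (`[- r, r]%classic `*` `[- r, r]%classic)).
  - have -> : A = (fun p : K * K => cmod ('X : {poly C}).[p.1 +i* p.2]) @^-1` [set x | x <= r].
      by apply/seteqP; split => p /=; rewrite hornerX.
    apply: closed_comp; last exact: closed_le.
    by move=> p _; exact: (hasps_continuous (hasps_horner 'X)).
  - by apply: compact_setX; exact: segment_compact.
  - move=> p; rewrite /A/= => pr; rewrite !in_itv/= -!ler_norml; split.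
      exact: le_trans (ler_Re_cmod (p.1 +i* p.2)) pr.
    exact: le_trans (ler_Im_cmod (p.1 +i* p.2)) pr.
have A0 : A !=set0 by exists (0, 0); change (cmod (0 : C) <= r); rewrite cmod0.
have [|c cin hc] := @compact_EVT_min _ _ (fun p : K * K => cmod (f (p.1 +i* p.2))) _ A0 cA.
  by apply: continuous_subspaceT; exact: hasps_continuous hf.
exists (cmod (f (c.1 +i* c.2))) => [|w wr].
  by rewrite cmod_gt0; apply: nz; move: cin; rewrite inE.
case: w wr => x y wr; have := hc (x, y); apply; by rewrite inE.
Qed.

Lemma sum_weight (z om : C) m k : m.-primitive_root z -> (0 < k < m)%N ->
  \sum_(l < m) (1 + complex.Re (om * z ^+ (l * (m - k)))) = m%:R.
Proof.
move=> hz km; rewrite big_split/= sumr_const card_ord -re_sum -mulr_sumr.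
rewrite (sum_prim_root hz) ?mulr0 ?addr0//.
by apply/negP => /dvdn_leq; lia.
Qed.

(** Nonnegative weights allow one-sided bounds on the logarithms to be averaged. *)
Lemma weight_ge0 (z om : C) m n : m.-primitive_root z -> cmod om <= 1 ->
  0 <= 1 + complex.Re (om * z ^+ n).
Proof.
move=> hz om1; have := ler_Re_cmod (om * z ^+ n).
rewrite cmodM cmodX (cmod_prim_root hz) expr1n mulr1 ler_norml.
by case/andP; lra.
Qed.

(* Only the terms of index 0 and k of the expansion of ln |1 - b z| survive the
   average over the m-th roots of unity against the weight 1 + Re (om z^-k). *)
Lemma weighted_log_mean (z b om : C) m k : m.-primitive_root z ->
  (0 < k)%N -> (2 * k < m)%N -> cmod om <= 1 -> cmod b < 1 ->
  - (m%:R * (complex.Re (om * b ^+ k) / k%:R / 2 + cmod b ^+ (m - k) / (1 - cmod b)))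
  <= \sum_(l < m) (1 + complex.Re (om * z ^+ (l * (m - k)))) * ln (cmod (1 - b * z ^+ l)).
Proof.
move=> hz k0 km om1 b1.
have z1 := cmod_prim_root hz.
have zl1 l : cmod (z ^+ l) = 1 by rewrite cmodX z1 expr1n.
(* This cut-off keeps [j.+1 + k < m]: the frequencies [j.+1] and [k + j.+1] average to zero, and so
   does [m - k + j.+1] unless [j.+1 = k]. The assumption [2 * k < m] keeps the term of index k. *)
pose N := (m - k).-1; have NE : N.+1 = (m - k)%N by rewrite /N; lia.
set E := cmod b ^+ (m - k) / _.
pose wt (l : 'I_m) := 1 + complex.Re (om * z ^+ (l * (m - k))).
have wt0 l : 0 <= wt l by exact: weight_ge0 hz om1.
have sumwt : \sum_l wt l = m%:R by apply: sum_weight => //; lia.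
have step l : wt l * (- complex.Re (\sum_(j < N) (b * z ^+ l) ^+ j.+1 / j.+1%:R) - E)
    <= wt l * ln (cmod (1 - b * z ^+ l)).
  rewrite ler_wpM2l//; have bz : cmod (b * z ^+ l) = cmod b by rewrite cmodM zl1 mulr1.
  by have := @ln_cmod1B_ge K (b * z ^+ l) N; rewrite bz NE; apply.
apply: le_trans (ler_sum _ (fun l _ => step l)).
rewrite (eq_bigr (fun l => - (wt l * complex.Re (\sum_(j < N) (b * z ^+ l) ^+ j.+1 / j.+1%:R)) - wt l * E)); last first.
  by move=> l _; rewrite mulrBr mulrN.
rewrite big_split/=. rewrite !sumrN.  rewrite -mulr_suml sumwt mulrDr opprD.
apply: lerD; last exact: lexx.
rewrite lerN2.
have conjz l : conjc (z ^+ l) = (z ^+ l)^-1.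
  by rewrite conjc_unit ?zl1.
have reM2 (x y : C) : complex.Re x * complex.Re y = complex.Re (x * y + conjc x * y) / 2.
  by rewrite reD !reM; case: x => x1 x2 /=; field.
suff -> : \sum_(l < m) wt l * complex.Re (\sum_(j < N) (b * z ^+ l) ^+ j.+1 / j.+1%:R) =
    m%:R * (complex.Re (om * b ^+ k) / k%:R / 2) by [].
have kN : (k.-1 < N)%N by lia.
have term (j : 'I_N) : \sum_(l < m) wt l * complex.Re ((b * z ^+ l) ^+ j.+1 / j.+1%:R) =
   if j == Ordinal kN then m%:R * (complex.Re (om * b ^+ k) / k%:R / 2) else 0.
  pose cj := b ^+ j.+1 / j.+1%:R.
  have jm : (j.+1 + k < m)%N by have := ltn_ord j; lia.
  have E1 l : (b * z ^+ l) ^+ j.+1 / j.+1%:R = cj * z ^+ (l * j.+1).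
    by rewrite /cj exprMn -exprM mulrAC.
  rewrite (eq_bigr (fun l : 'I_m => complex.Re (cj * z ^+ (l * j.+1)) +
     (complex.Re (om * cj * z ^+ (l * (m - k + j.+1))) +
      complex.Re (conjc om * cj * z ^+ (l * (k + j.+1)))) / 2)); last first.
    move=> l _; rewrite E1 /wt mulrDl mul1r reM2 reD; congr (_ + (complex.Re _ + complex.Re _) / 2).
      by rewrite mulnDr exprD; ring.
    have cM (x y : C) : conjc (x * y) = conjc x * conjc y by exact: rmorphM.
    rewrite cM conjz mulnDr exprD mulrACA; congr (_ * (_ * _)).
    have z0 : z != 0 by rewrite -cmod_eq0 z1 oner_eq0.
    apply: (mulIf (expf_neq0 (l * (m - k)) z0)).
    rewrite mulVf; last by rewrite -cmod_eq0 zl1 oner_eq0.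
    rewrite -exprD -mulnDr subnKC ?(prim_expr_mod hz)//; last by lia.
    by rewrite mulnC exprM (prim_expr_order hz) expr1n.
  rewrite big_split/= -mulr_suml big_split/= -!re_sum -!mulr_sumr.
  have nd n : (0 < n < m)%N -> ~~ (m %| n)%N.
    by move=> /andP[n0 nm]; apply/negP => /dvdn_leq; lia.
  rewrite (sum_prim_root hz) ?nd//; last by have := ltn_ord j; lia.
  rewrite (sum_prim_root (j := k + j.+1) hz) ?nd//; last by lia.
  rewrite !mulr0 !add0r addr0; case: eqP => [jk|/eqP jk].
    have jk1 : j.+1 = k by rewrite jk/= prednK.
    rewrite (eq_bigr (fun=> 1)); last first.
      move=> l _; rewrite jk1 subnK; last by lia.
      by rewrite mulnC exprM (prim_expr_order hz) expr1n.
    rewrite sumr_const card_ord /cj jk1.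
    have -> : om * (b ^+ k / k%:R) * m%:R = (m%:R / k%:R : K)%:C * (om * b ^+ k).
      by rewrite rmorphM/= fmorphV/= !rmorph_nat; ring.
    by rewrite reM/= mul0r subr0; ring.
  rewrite (sum_prim_root hz) ?mulr0 ?mul0r//.
  have {}jk : (j : nat) != k.-1 by [].
  apply/negP => /dvdnP[q hq]; have := ltn_ord j.
  case: q hq => [|[|q]] hq; rewrite ?mul0n ?mul1n ?mulSn in hq; move/eqP: jk; lia.
rewrite (eq_bigr (fun l => \sum_(j < N) wt l * complex.Re ((b * z ^+ l) ^+ j.+1 / j.+1%:R))).
  rewrite exchange_big/= (eq_bigr _ (fun j _ => term j)).
  by rewrite -big_mkcond big_pred1_eq.
by move=> l _; rewrite re_sum mulr_sumr.
Qed.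

End borel_caratheodory.

(** * Logarithmic derivatives without zeros in a disc, and division by a root *)

Section hadamard.
Variable K : realType.
Local Notation C := K[i].
Implicit Types (f g u v : C -> C) (a b : nat -> C).

Lemma expr_small (q e : K) : 0 <= q < 1 -> 0 < e ->
  exists N, forall n, (N <= n)%N -> q ^+ n <= e.
Proof.
move=> /andP[q0 q1] e0.
have q1' : `|q| < 1 by rewrite ger0_norm.
have /cvgrPdist_lt/(_ _ e0)[N _ hN] := cvg_expr q1'.
exists N => n Nn; have := hN n Nn.
by rewrite sub0r normrN ger0_norm ?exprn_ge0// => /ltW.
Qed.

Lemma sum_expr_small (s : seq C) (e : K) :
  (forall x, x \in s -> cmod x < 1) -> 0 < e ->
  exists N, forall n, (N <= n)%N ->
    \sum_(x <- s) cmod x ^+ n / (1 - cmod x) <= e.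
Proof.
elim: s e => [|x s IH] e hs e0.
  by exists 0%N => n _; rewrite big_nil ltW.
have e20 : 0 < e / 2 by rewrite divr_gt0.
have [|N hN] := IH (e / 2) _ e20; first by move=> y ys; apply: hs; rewrite inE ys orbT.
have x1 : cmod x < 1 by apply: hs; rewrite mem_head.
have x1' : 0 < 1 - cmod x by rewrite subr_gt0.
have [|N' hN'] := @expr_small (cmod x) (e / 2 * (1 - cmod x)) _ (mulr_gt0 e20 x1').
  by rewrite cmod_ge0.
exists (maxn N N') => n; rewrite geq_max => /andP[Nn N'n].
rewrite big_cons [leRHS]splitr lerD ?hN// ler_pdivrMr//; exact: hN'.
Qed.

(** The weighted mean of ln |P| over m points of the circle is at most ln M, P being the product of
    the 1 - x w. The expansion of each factor bounds the same mean below by |S| / (2 k), where S is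
    the power sum scaled by r^k, up to an error that vanishes as m grows. *)
Lemma power_sum_bound (s : seq C) (r M : K) k : 0 <= r ->
  (forall x, x \in s -> cmod x * r < 1) ->
  (forall w, cmod w = r -> cmod (\prod_(x <- s) (1 - x *: 'X)).[w] <= M) ->
  (0 < k)%N -> cmod (\sum_(x <- s) x ^+ k) * r ^+ k <= 2 * k%:R * ln M.
Proof.
move=> r0 hs hM k0.
have k0' : 0 < k%:R :> K by rewrite ltr0n.
pose bs := [seq x * r%:C | x <- s].
have hbs x : x \in bs -> cmod x < 1.
  by move=> /mapP[y ys ->]; rewrite cmodM cmodR ger0_norm// hs.
pose S := \sum_(x <- bs) x ^+ k.
have SE : cmod (\sum_(x <- s) x ^+ k) * r ^+ k = cmod S.
  have -> : S = (\sum_(x <- s) x ^+ k) * r%:C ^+ k.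
    by rewrite /S big_map mulr_suml; apply: eq_bigr => x _; rewrite exprMn.
  by rewrite cmodM cmodX cmodR ger0_norm.
rewrite SE -ler_pdivrMl ?mulr_gt0//.
(* The sign makes [om * S] equal to - |S|, which the minus sign of the lower bound turns into +
   |S|. *)
have [om' om'1 om'S] := cmod_phase S; pose om := - om'.
have om1 : cmod om <= 1 by rewrite cmodN.
have omS : complex.Re (om * S) = - cmod S by rewrite mulNr om'S reN.
apply/ler_addgt0Pr => e e0.
have [N hN] := sum_expr_small hbs e0.
pose m := (2 * k + N).+1; have m0 : (0 < m)%N by [].
have m0' : 0 < m%:R :> K by rewrite ltr0n.
have [z hz] := prim_root_exists K m0.
have Nm : (N <= m - k)%N by rewrite /m; lia.
have km : (2 * k < m)%N by rewrite /m; lia.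
have zl1 l : cmod (z ^+ l) = 1 by rewrite cmodX (cmod_prim_root hz) expr1n.
have lnp (l : nat) : \sum_(x <- bs) ln (cmod (1 - x * z ^+ l)) =
    ln (cmod (\prod_(x <- s) (1 - x *: 'X)).[r%:C * z ^+ l])
    /\ 0 < cmod (\prod_(x <- s) (1 - x *: 'X)).[r%:C * z ^+ l].
  rewrite /bs; elim: (s) hs => [|x s' IH] hs'.
    by rewrite !big_nil hornerC cmod1 ln1.
  have [|E P] := IH; first by move=> y ys; apply: hs'; rewrite inE ys orbT.
  rewrite !big_cons hornerM hornerD hornerN hornerZ hornerX hornerC.
  have xl : x * r%:C * z ^+ l = x * (r%:C * z ^+ l) by rewrite mulrA.
  have p0 : 0 < cmod (1 - x * (r%:C * z ^+ l)).
    rewrite cmod_gt0 subr_eq0; apply/eqP => h.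
    have := hs' x (mem_head _ _); have := congr1 (@cmod K) h.
    by rewrite !cmodM zl1 mulr1 cmodR cmod1 ger0_norm// => <-; rewrite ltxx.
  by rewrite xl E cmodM mulr_gt0// lnM ?posrE.
have up : \sum_(x <- bs) \sum_(l < m) (1 + complex.Re (om * z ^+ (l * (m - k)))) *
    ln (cmod (1 - x * z ^+ l)) <= m%:R * ln M.
  rewrite exchange_big/= -(@sum_weight K z om m k hz); last by rewrite k0/=; lia.
  rewrite mulr_suml; apply: ler_sum => l _; rewrite -mulr_sumr.
  have [-> P] := lnp l; rewrite ler_wpM2l ?(weight_ge0 _ hz)//.
  have h := hM (r%:C * z ^+ l).
  rewrite ler_ln ?posrE//.
    by apply: h; rewrite cmodM zl1 mulr1 cmodR ger0_norm.
  by apply: (lt_le_trans P); apply: h; rewrite cmodM zl1 mulr1 cmodR ger0_norm.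
have low : - (m%:R * (- cmod S / k%:R / 2 + \sum_(x <- bs) cmod x ^+ (m - k) / (1 - cmod x)))
   <= \sum_(x <- bs) \sum_(l < m) (1 + complex.Re (om * z ^+ (l * (m - k)))) *
    ln (cmod (1 - x * z ^+ l)).
  rewrite -omS /S mulr_sumr re_sum 2!mulr_suml -big_split/= mulr_sumr -sumrN.
  rewrite big_seq [leRHS]big_seq; apply: ler_sum => x xbs.
  by apply: weighted_log_mean => //; exact: hbs.
have := le_trans low up; have := hN _ Nm; set E := \sum_(x <- bs) _ => hE.
rewrite -mulrN ler_pM2l// => h.
have -> : (2 * k%:R)^-1 * cmod S = cmod S / k%:R / 2 by field; rewrite gt_eqF.
have : - (- cmod S / k%:R / 2) = cmod S / k%:R / 2 by rewrite !mulNr opprK.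
by move: h hE; lra.
Qed.

Lemma prod_lin_at0 (s : seq C) : (\prod_(x <- s) (1 - x *: 'X)).[0] = 1.
Proof.
elim: s => [|x s IH]; first by rewrite big_nil hornerC.
rewrite big_cons hornerM IH mulr1 hornerD hornerN hornerZ hornerX hornerC.
by rewrite mulr0 subr0.
Qed.

Lemma logd_prod (s : seq C) k :
  logd (fun i => (\prod_(x <- s) (1 - x *: 'X))`_i) k = - \sum_(x <- s) x ^+ k.+1.
Proof.
have c0 (s' : seq C) : (\prod_(x <- s') (1 - x *: 'X))`_0 = 1.
  by rewrite -horner_coef0 prod_lin_at0.
elim: s => [|x s IH].
  rewrite !big_nil oppr0; apply/esym.
  apply: (@logd_uniq _ _ (fun=> 0)); first by rewrite coef1.
  by move=> j; rewrite /conv big1 ?/dseq ?coef1 ?mulr0// => i _; rewrite mul0r.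
rewrite !big_cons opprD -IH -logd_lin -logd_conv ?c0//.
  by congr logd; apply: funext => i; rewrite conv_poly.
by rewrite coefB coef1 coefZ coefX mulr0 subr0.
Qed.

(* Taylor polynomials of f of large degree do not vanish on the disc either, and their
   logarithmic derivatives are power sums of the inverses of their roots. *)
Lemma borel_caratheodory f a (r M : K) : hasps f a -> a 0%N = 1 -> 0 < r ->
  (forall w, cmod w <= r -> f w != 0) ->
  (forall k, cmod (a k) * (3 * r) ^+ k <= M) ->
  forall k, cmod (logd a k) * r ^+ k.+1 <= 2 * k.+1%:R * ln (2 * M).
Proof.
move=> hf a0 r0 nz hM k.
have M0 : 0 <= M by have := hM 0%N; rewrite expr0 mulr1; exact/le_trans/cmod_ge0.
(* As 3 r >= 2 r, every Taylor polynomial is bounded by 2 M on |w| = r; hence the [ln (2 * M)]. *)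
have hM2 j : cmod (a j) * r ^+ j <= M / 2 ^+ j.
  rewrite ler_pdivlMr ?exprn_gt0// -mulrA -exprMn (le_trans _ (hM j))//.
  by rewrite ler_wpM2l ?cmod_ge0// lerXn2r ?nnegrE ?mulr_ge0 ?(ltW r0)//; lra.
have [d d0 hd] := hasps_lower_bound hf (ltW r0) nz.
have [L hL] := hf r.
(* [logd a k] reads the coefficients up to k + 1, which a truncation of length at least k + 2 keeps;
   an error below d keeps it from vanishing on the disc. *)
have [n nk hn] : exists2 n, (k.+2 <= n)%N & L / 2 ^+ n < d.
  have h2 : 0 <= (2^-1 : K) < 1 by rewrite invr_ge0 ler0n/= invf_lt1 ?ltr1n.
  have [|N hN] := @expr_small 2^-1 (d / (`|L| + 1)) h2.
    by rewrite divr_gt0// ltr_wpDl.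
  exists (maxn N k.+2); first by rewrite leq_maxr.
  have := hN _ (leq_maxl N k.+2); rewrite ler_pdivlMr ?ltr_wpDl// exprVn => h.
  apply: lt_le_trans h; rewrite mulrC ltr_pM2l ?invr_gt0 ?exprn_gt0//.
  by rewrite (le_lt_trans (ler_norm L))// ltrDl.
pose p := tpoly n a.
have pE w : p.[w] = psum a n w.
  rewrite (horner_coef_wide w (size_poly n a)); apply: eq_bigr => i _.
  by rewrite coef_tpoly.
have p0 : p.[0] = 1.
  by rewrite pE -(prednK (leq_trans (ltn0Sn _) nk)) psum_at0.
have pnz w : cmod w <= r -> p.[w] != 0.
  move=> wr; apply/eqP => pw.
  have := hL n _ wr; rewrite -pE pw subr0; have := hd _ wr; lra.
have [rs Dp] := closed_field_poly_normal p.
have rsr z : z \in rs -> r < cmod z.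
  move=> zrs; rewrite ltNge; apply/negP => /pnz/eqP; apply.
  rewrite Dp hornerZ horner_prod (big_rem z)//= hornerD hornerN hornerX hornerC.
  by rewrite subrr mul0r mulr0.
pose s := [seq z^-1 | z <- rs].
have Ds : p = \prod_(x <- s) (1 - x *: 'X).
  (* The leading coefficient and the factors - z are gathered into one constant, which is p(0) =
     1. *)
  have [c Dc] : exists c, p = c *: \prod_(x <- s) (1 - x *: 'X).
    rewrite Dp /s; move: (lead_coef p) => l.
    elim: (rs) rsr l => [|z zs IH] hz l; first by exists l; rewrite !big_nil.
    have [|c Dc] := IH _ (l * - z); first by move=> y ys; apply: hz; rewrite inE ys orbT.
    exists c; rewrite big_cons map_cons big_cons.
    have z0 : z != 0 by rewrite -cmod_gt0 (lt_trans r0)// hz// mem_head.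
    have -> : 'X - z%:P = (- z) *: (1 - z^-1 *: 'X).
      by rewrite scalerBr scaleNr scalerA mulNr mulfV// scaleN1r opprK addrC alg_polyC.
    by rewrite -scalerAl scalerA [LHS]scalerAr Dc -scalerAr.
  have c1 : c = 1 by have := p0; rewrite Dc hornerZ prod_lin_at0 mulr1.
  by rewrite Dc c1 scale1r.
have -> : logd a k = logd (fun i => p`_i) k.
  by apply: logd_ext => j jk; rewrite coef_tpoly// (leq_ltn_trans jk).
rewrite Ds logd_prod cmodN; apply: power_sum_bound => //; first exact: ltW.
  move=> _ /mapP[z zrs ->]; rewrite cmodV mulrC ltr_pdivrMr ?mul1r ?rsr//.
  by rewrite (lt_trans r0)// rsr.
move=> w wr; rewrite -Ds pE -[psum a n w]subr0 -(psum0 a w).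
have wr' : cmod w <= r by rewrite wr.
apply: (le_trans (psum_tail hM2 wr' (leq0n n))).
rewrite expr0 divr1 gerBl divr_ge0 ?exprn_ge0// mulr_ge0//.
Qed.

Definition ent f := exists a, hasps f a.

Lemma hasps_fun_uniq f g a : hasps f a -> hasps g a -> forall w, f w = g w.
Proof.
move=> hf hg w; apply/eqP; rewrite -subr_eq0; apply/eqP.
by apply: (hasps0 (haspsB hf hg)) => k; rewrite subrr.
Qed.

(** Formally g(w) = f(w) / (1 - w/z) has coefficients z^-k (a_0 + ... + a_k z^k). As f(z) = 0, this
    partial sum is minus the tail of the series at z, which decays faster than any geometric
    sequence, so g is entire. *)
Lemma ent_div_root f z : ent f -> f z = 0 -> z != 0 ->
  exists2 g, ent g & forall w, f w = (1 - w / z) * g w.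
Proof.
move=> [a hf] fz z0; have cz0 : 0 < cmod z by rewrite cmod_gt0.
pose b k := psum a k.+1 z * z^-1 ^+ k.
have eb : entire b.
  (* With ratio 2 Q, the factor 2 makes the tail summable and Q compensates the growth of (r /
     |z|)^k. *)
  move=> r r0; pose Q := Num.max 1 (r / cmod z).
  have Q1 : 1 <= Q by rewrite le_max lexx.
  have Q0 : 0 < Q by lra.
  have [M M0 hM] := entire_geo (hasps_entire hf) (mulr_gt0 (ltr0n K 2) Q0) (ltW cz0).
  have ps n m : (n <= m)%N ->
      cmod (psum a m z - psum a n z) <= M / Q ^+ n * (2 / 2 ^+ n - 2 / 2 ^+ m).
    move=> nm; rewrite -(subnK nm); elim: (m - n)%N => [|p IH].
      by rewrite add0n !subrr cmod0 mulr0.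
    rewrite addSn psumS addrAC (le_trans (cmodD _ _))//.
    have -> : 2 / 2 ^+ n - 2 / 2 ^+ (p + n).+1 =
       (2 / 2 ^+ n - 2 / 2 ^+ (p + n)) + (2 ^+ (p + n))^-1 :> K.
      by rewrite exprS; field; rewrite ?expf_neq0 ?pnatr_eq0.
    rewrite mulrDr lerD// cmodM cmodX (le_trans (hM _))// exprMn.
    rewrite -mulrA -invfM ler_wpM2l ?(ltW M0)// lef_pV2 ?posrE ?mulr_gt0 ?exprn_gt0//.
    by rewrite mulrC ler_wpM2l ?exprn_ge0// ler_weXn2l// leq_addl.
  have psz n : cmod (psum a n z) <= M / Q ^+ n * 2.
    have [L hL] := hf (cmod z).
    apply: (@le_div2X _ _ L) => q; pose m := maxn q n.
    have -> : psum a n z = psum a m z - (psum a m z - psum a n z) by rewrite opprB addrC subrK.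
    rewrite (le_trans (cmodB _ _))// addrC lerD//.
      rewrite (le_trans (ps _ _ (leq_maxr q n)))// ler_wpM2l//.
        by rewrite divr_ge0 ?exprn_ge0 ?ltW.
      rewrite (@le_trans _ _ (2 / 2 ^+ n))//; first by rewrite gerBl divr_ge0 ?exprn_ge0.
      by rewrite ler_pdivrMr ?exprn_gt0// ler_peMr// exprn_ege1// ler1n.
    have := hL m z (lexx _); rewrite fz sub0r cmodN => /le_trans; apply.
    have L0 : 0 <= L.
      by have := hL 0%N z (lexx _); rewrite expr0 divr1; exact/le_trans/cmod_ge0.
    by rewrite ler_wpM2l// lef_pV2 ?posrE ?exprn_gt0// ler_weXn2l ?ler1n// leq_maxl.
  exists (M * 2) => k; rewrite /b cmodM cmodX cmodV -mulrA -exprMn.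
  rewrite (le_trans (ler_wpM2r _ (psz _)))//.
    by rewrite exprn_ge0// mulr_ge0// invr_ge0 ltW.
  rewrite mulrAC ler_wpM2r// -mulrA ler_piMr ?(ltW M0)//.
  rewrite mulrC ler_pdivrMr ?exprn_gt0// mul1r.
  rewrite (@le_trans _ _ (Q ^+ k))//.
    have h0 : 0 <= (cmod z)^-1 * r by rewrite mulr_ge0// invr_ge0 ltW.
    have hQ : (cmod z)^-1 * r <= Q by rewrite mulrC /Q le_max lexx orbT.
    by rewrite lerXn2r ?nnegrE ?(ltW Q0).
  by rewrite ler_weXn2l.
have [g hg] := entire_hasps eb; exists g; first by exists b.
have := hasps_mul (hasps_horner (1 - z^-1 *: 'X)) hg.
move=> /(hasps_ext_coef (b := a)) h; move=> w.
have {}h := h _; rewrite (hasps_fun_uniq hf (h _)).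
  by rewrite hornerD hornerN hornerZ hornerX hornerC (mulrC z^-1).
have ck i : (1 - z^-1 *: 'X)`_i = (i == 0%N)%:R - z^-1 * (i == 1%N)%:R.
  by rewrite coefB coef1 coefZ coefX.
move=> [|k].
  by rewrite conv0 ck /b psumS psum0 !expr0/= mulr0 subr0 mul1r add0r !mulr1.
rewrite /conv 2!big_ord_recl big1 => [|i _]; last by rewrite ck !lift0/= mulr0 subrr mul0r.
rewrite !lift0 !ck/= !subSS !subn0 /b psumS exprS.
have zk : z * z ^+ k * (z^-1 * z^-1 ^+ k) = 1.
  by rewrite -!exprS exprVn mulfV// expf_neq0.
rewrite exprS; set Z := z^-1 ^+ k; set P := psum _ _ _.
transitivity (a k.+1 * (z * z ^+ k * (z^-1 * Z))); last by rewrite zk mulr1.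
by move: z^-1 => y; ring.
Qed.

End hadamard.

(** * Quotients of entire functions of order less than 2 *)

Section hadamard_quotient.
Variable K : realType.
Local Notation C := K[i].
Implicit Types (f g u v : C -> C) (a b : nat -> C).

(* Every zero of g is a zero of f, with at least the same multiplicity. *)
Definition zeros_le g f := forall z, exists u v,
  [/\ ent u, ent v, v z != 0 & forall w, g w * u w = f w * v w].

Lemma zeros_le0 g f z : zeros_le g f -> g z = 0 -> f z = 0.
Proof.
move=> /(_ z)[u [v [_ _ vz /(_ z)]]] E g0; move/eqP: E.
by rewrite g0 mul0r eq_sym mulf_eq0 (negbTE vz) orbF => /eqP.
Qed.

Lemma entM f g : ent f -> ent g -> ent (fun w => f w * g w).
Proof. by move=> [a hf] [b hg]; exists (conv a b); exact: hasps_mul. Qed.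

Lemma entB f g : ent f -> ent g -> ent (fun w => f w - g w).
Proof. by move=> [a hf] [b hg]; exists (fun k => a k - b k); exact: haspsB. Qed.

Lemma ent_mul_eq0 f g : ent f -> ent g -> g 0 != 0 ->
  (forall w, f w * g w = 0) -> forall w, f w = 0.
Proof. by move=> [a hf] [b hg]; exact: hasps_mul_eq0 hf hg. Qed.

Lemma ent_lin (c : C) : ent (fun w => 1 - w / c).
Proof.
exists (fun k => (1 - c^-1 *: 'X)`_k).
apply: hasps_ext (hasps_horner (1 - c^-1 *: 'X)) => w.
by rewrite hornerD hornerN hornerZ hornerX hornerC mulrC.
Qed.

(** The witnesses u and v are kept; the factor 1 - w/z, equal to 1 at 0, cancels from their
    identity. *)
Lemma zeros_le_div g f g' f' z : ent f' -> ent g' -> z != 0 ->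
  (forall w, f w = (1 - w / z) * f' w) -> (forall w, g w = (1 - w / z) * g' w) ->
  zeros_le g f -> zeros_le g' f'.
Proof.
move=> ef eg z0 hf hg h y; have [u [v [eu ev vy E]]] := h y.
exists u, v; split=> // w; apply/eqP; rewrite -subr_eq0; apply/eqP; move: w.
apply: (@ent_mul_eq0 _ (fun w => 1 - w / z)).
- by apply: entB; exact: entM.
- exact: ent_lin.
- by rewrite mul0r subr0 oner_neq0.
- by move=> w; have := E w; rewrite hf hg => /eqP; rewrite -subr_eq0 => /eqP <-; ring.
Qed.

(* Dividing by 1 - w / z with |z| <= R / 3 halves the bound on |w| = R, whereas the
   value 1 at 0 is preserved: at most log2 M zeros can be removed. *)
Lemma strip_zeros n : forall f g (M M' R : K), ent f -> ent g -> f 0 = 1 -> g 0 = 1 ->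
  0 < R -> (forall w, cmod w = R -> cmod (f w) <= M) ->
  (forall w, cmod w = R -> cmod (g w) <= M') ->
  zeros_le g f -> zeros_le f g -> M < 2 ^+ n ->
  exists f1 g1, [/\ ent f1 /\ ent g1, f1 0 = 1 /\ g1 0 = 1,
    (forall w, cmod w = R -> cmod (f1 w) <= M) /\
    (forall w, cmod w = R -> cmod (g1 w) <= M'),
    (forall w, cmod w <= R / 3 -> f1 w != 0 /\ g1 w != 0) &
    forall w, f w * g1 w = g w * f1 w].
Proof.
elim: n => [|n IH] f g M M' R ef eg f0 g0 R0 hM hM' zg zf Mn.
  (* The Cauchy estimate for the constant coefficient gives 1 <= M, against M < 1. *)
  have [a ha] := ef; have := cauchy_estimate ha (ltW R0) hM 0.
  by rewrite -(hasps_at0 ha) f0 cmod1 expr0 mul1r; move: Mn; rewrite expr0; lra.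
have [[z zR fz]|nz] := pselect (exists2 z, cmod z <= R / 3 & f z = 0); last first.
  exists f, g; split=> // [w wR|w]; last by rewrite mulrC.
  have fw : f w != 0 by apply/eqP => fw; apply: nz; exists w.
  by split=> //; apply: contra_neq fw; exact: zeros_le0 zg.
have z0 : z != 0 by apply: contra_eq_neq fz => ->; rewrite f0 oner_neq0.
have [f' ef' hf'] := ent_div_root ef fz z0.
have [g' eg' hg'] := ent_div_root eg (zeros_le0 zf fz) z0.
have two w : cmod w = R -> 2 <= cmod (1 - w / z).
  move=> wR; have := cmodB (1 - w / z) 1; rewrite addrAC subrr sub0r cmodN cmod1.
  rewrite cmodM cmodV wR => h; have : 3 <= R / cmod z.
    by rewrite ler_pdivlMr ?cmod_gt0// mulrC -ler_pdivlMr.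
  lra.
have hM2 w : cmod w = R -> cmod (f' w) <= M / 2.
  move=> wR; have := hM _ wR; rewrite hf' cmodM ler_pdivlMr// => h.
  by rewrite (le_trans _ h)// mulrC ler_wpM2r ?cmod_ge0// two.
(* The number of steps is governed by the bound of f alone; the bound of g just has to be
   preserved. *)
have hM2' w : cmod w = R -> cmod (g' w) <= M'.
  move=> wR; have := hM' _ wR; rewrite hg' cmodM => h.
  rewrite (le_trans _ h)// ler_peMl ?cmod_ge0//.
  by have := two _ wR; lra.
have f'0 : f' 0 = 1 by have := hf' 0; rewrite f0 mul0r subr0 mul1r.
have g'0 : g' 0 = 1 by have := hg' 0; rewrite g0 mul0r subr0 mul1r.
have [|f1 [g1 [e1 e2 [e3 e3'] e4 e5]]] := IH f' g' (M / 2) M' R ef' eg' f'0 g'0 R0 hM2 hM2'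
    (zeros_le_div ef' eg' z0 hf' hg' zg) (zeros_le_div eg' ef' z0 hg' hf' zf).
  by rewrite ltr_pdivrMr// mulrC -exprS.
exists f1, g1; split=> //; last by move=> w; rewrite hf' hg' -!mulrA e5.
split=> // w wR; apply: le_trans (e3 _ wR) _.
have : 0 <= M.
  have cR : cmod (R%:C) = R by rewrite cmodR gtr0_norm.
  exact: le_trans (cmod_ge0 _) (hM _ cR).
by lra.
Qed.

Lemma logd_eq_growth f g a b (A B rho : K) : hasps f a -> hasps g b ->
  a 0%N = 1 -> b 0%N = 1 -> 0 < A -> 0 < B -> 0 <= rho < 2 ->
  (forall w, cmod (f w) <= A * expR (B * cmod w `^ rho)) ->
  (forall w, cmod (g w) <= A * expR (B * cmod w `^ rho)) ->
  zeros_le g f -> zeros_le f g ->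
  forall k, (0 < k)%N -> logd a k = logd b k.
Proof.
move=> hf hg a0 b0 A0 B0 /andP[rho0 rho2] fA gA zg zf k k0.
have f0 : f 0 = 1 by rewrite (hasps_at0 hf).
have g0 : g 0 = 1 by rewrite (hasps_at0 hg).
pose D := cmod (logd a k - logd b k).
(* The 4 adds up the two Borel-Caratheodory estimates, and the power of 3 comes from their radius R
   / 3. *)
have main (R : K) : 1 <= R ->
    D * R ^+ k.+1 <= 4 * k.+1%:R * 3 ^+ k.+1 * (ln (2 * A) + B * R `^ rho).
  move=> R1; have R0 : 0 < R by lra.
  pose M := A * expR (B * R `^ rho).
  have M0 : 0 < M by rewrite mulr_gt0// expR_gt0.
  have [n hn] : exists n : nat, M < 2 ^+ n.
    exists (Num.bound M); apply: (lt_trans (archi_boundP (ltW M0))).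
    by rewrite -natrX ltr_nat ltn_expl.
  have [||f1 [g1 [[[a1 h1] [b1 h2]] [e1 e2] [m1 m2] nz E]]] :=
    @strip_zeros n f g M M R (ex_intro _ _ hf) (ex_intro _ _ hg) f0 g0 R0 _ _ zg zf hn.
  - by move=> w wR; rewrite (le_trans (fA w))// wR.
  - by move=> w wR; rewrite (le_trans (gA w))// wR.
  have a10 : a1 0%N = 1 by rewrite -(hasps_at0 h1).
  have b10 : b1 0%N = 1 by rewrite -(hasps_at0 h2).
  have R3 : 0 < R / 3 by rewrite divr_gt0.
  have R33 : 3 * (R / 3) = R by field.
  have bc1 := @borel_caratheodory _ f1 a1 (R / 3) M h1 a10 R3 (fun w wR => (nz w wR).1).
  have bc2 := @borel_caratheodory _ g1 b1 (R / 3) M h2 b10 R3 (fun w wR => (nz w wR).2).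
  rewrite R33 in bc1; rewrite R33 in bc2.
  have {}bc1 := bc1 (cauchy_estimate h1 (ltW R0) m1) k.
  have {}bc2 := bc2 (cauchy_estimate h2 (ltW R0) m2) k.
  (* From f g1 = g f1, the difference of the logarithmic derivatives of f and g is that of the
     zero-free quotients. *)
  have Econv : conv a b1 =1 conv b a1.
    apply: (hasps_uniq (hasps_mul hf h2)).
    by apply: hasps_ext (hasps_mul hg h1) => w; rewrite E.
  have : logd (conv a b1) k = logd (conv b a1) k by rewrite (funext Econv).
  rewrite !logd_conv// => EL.
  have DE : logd a k - logd b k = logd a1 k - logd b1 k.
    apply/eqP; rewrite -subr_eq0 -(subrr (logd b k + logd a1 k)) -{1}EL.
    by apply/eqP; ring.
  have lnM2 : ln (2 * M) = ln (2 * A) + B * R `^ rho.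
    by rewrite /M mulrA lnM ?posrE ?mulr_gt0 ?expR_gt0// expRK.
  have h : D * (R / 3) ^+ k.+1 <= 4 * k.+1%:R * ln (2 * M).
    rewrite /D DE; apply: (@le_trans _ _ ((cmod (logd a1 k) + cmod (logd b1 k)) * (R / 3) ^+ k.+1)).
      by rewrite ler_wpM2r ?cmodB// exprn_ge0// ltW.
    by rewrite mulrDl; move: bc1 bc2; lra.
  rewrite -lnM2 -{1}R33 exprMn mulrCA.
  have -> : 4 * k.+1%:R * 3 ^+ k.+1 * ln (2 * M) = 3 ^+ k.+1 * (4 * k.+1%:R * ln (2 * M)) by ring.
  by rewrite ler_wpM2l// exprn_ge0.
apply/eqP; rewrite -subr_eq0 -cmod_eq0 -/D; apply: contraT => Dn0.
have D0 : 0 < D by rewrite lt_def Dn0 cmod_ge0.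
pose c := 4 * k.+1%:R * 3 ^+ k.+1 * (`|ln (2 * A)| + B).
have c0 : 0 < c.
  by rewrite !mulr_gt0 ?exprn_gt0// ltr_wpDl.
have main2 (R : K) : 1 <= R -> D * R `^ (2 - rho) <= c.
  move=> R1; have R0 : 0 < R by lra.
  have Rr : 0 < R `^ rho by rewrite powR_gt0.
  rewrite -(ler_pM2r Rr) -mulrA -powRD ?(gt_eqF R0) ?implybT// subrK.
  have -> : R `^ 2 = R ^+ 2 by rewrite -powR_mulrn ?(ltW R0).
  apply: (@le_trans _ _ (D * R ^+ k.+1)).
    by rewrite ler_pM2l// ler_weXn2l.
  apply: (le_trans (main R R1)); rewrite /c -[leRHS]mulrA ler_wpM2l ?mulr_ge0 ?exprn_ge0//.
  rewrite [leRHS]mulrDl lerD2r (le_trans (ler_norm _))// ler_peMr//.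
  by rewrite -(powRr0 R) ler_powR.
have e0 : 0 < 2 - rho by lra.
have y1 : 1 <= c / D + 1 by rewrite lerDr divr_ge0 ?ltW.
(* At this R, the left-hand side of [main2] is c + D, which exceeds c. Such an R exists because k +
   1 >= 2 > rho. *)
have := main2 ((c / D + 1) `^ (2 - rho)^-1).
rewrite -powRrM mulVf ?gt_eqF// powRr1; last by lra.
rewrite -[X in X <= _](powRr0 (c / D + 1)) ler_powR//; last by rewrite invr_ge0 ltW.
move=> /(_ isT); rewrite mulrDr mulr1 mulrC divfK ?gt_eqF//; lra.
Qed.

(** The function e is exp(mu w), with logarithmic derivative mu. So f and g e have the same
    logarithmic derivative: at index 0 by the choice of mu, at higher indices by the growth
    argument. *)
Lemma entire_quotient_exp f g a b e (A B rho : K) (mu : C) : hasps f a -> hasps g b ->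
  a 0%N = 1 -> b 0%N = 1 -> 0 < A -> 0 < B -> 0 <= rho < 2 ->
  (forall w, cmod (f w) <= A * expR (B * cmod w `^ rho)) ->
  (forall w, cmod (g w) <= A * expR (B * cmod w `^ rho)) ->
  zeros_le g f -> zeros_le f g ->
  hasps e (fun k => mu ^+ k / k`!%:R) -> mu = a 1%N - b 1%N ->
  forall w, f w = g w * e w.
Proof.
move=> hf hg a0 b0 A0 B0 hrho fA gA zg zf he mue.
pose ex k : C := mu ^+ k / k`!%:R.
have ex0 : ex 0%N = 1 by rewrite /ex expr0 fact0 invr1 mulr1.
have l1 (x : nat -> C) : logd x 0 = x 1%N by rewrite logdE big_ord0 subr0 mul1r.
have lex : logd ex =1 (fun k => (k == 0%N)%:R * mu).
  move=> k; apply/esym; move: k; apply: logd_uniq => // k.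
  rewrite /conv big_ord_recl big1; last by move=> i _; rewrite /= !mul0r.
  rewrite /= subn0 mul1r addr0 /dseq /ex factS natrM exprS.
  have k1 : k.+1%:R != 0 :> C by rewrite pnatr_eq0.
  have kf : k`!%:R != 0 :> C by rewrite pnatr_eq0 -lt0n fact_gt0.
  move: (mu ^+ k) (k.+1%:R : C) (k`!%:R : C) k1 kf => p q t q0 t0.
  rewrite invfM; transitivity (q * q^-1 * (mu * (p / t))).
    by rewrite mulfV// mul1r.
  by move: q^-1 t^-1 => *; ring.
have E : a =1 conv b ex.
  apply: logd_inj => //; first by rewrite conv0 b0 ex0 mulr1.
  move=> k; rewrite logd_conv// lex; case: k => [|k].
    by rewrite !l1 mul1r mue addrC subrK.
  by rewrite mul0r addr0; exact: (logd_eq_growth hf hg a0 b0 A0 B0 hrho).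
apply: (hasps_fun_uniq hf); apply: hasps_ext_coef (hasps_mul hg he).
by move=> k; rewrite E.
Qed.

End hadamard_quotient.

(** * Fourier uniqueness *)

Section bounded_measurable.
Context d (T : measurableType d) (K : realType).
Implicit Types (f g : T -> K) (mu : probability T K).

Definition bmeas f :=
  measurable_fun setT f /\ exists M, forall x, `|f x| <= M.

Lemma bmeas_integrable mu f : bmeas f -> mu.-integrable setT (EFin \o f).
Proof.
move=> [mf [M hM]]; have fin : (mu setT < +oo)%E by rewrite probability_setT ltry.
apply: measurable_bounded_integrable => //.
exists M; split; first exact: num_real.
by move=> x xM y _; exact: le_trans (hM y) (ltW xM).
Qed.

Lemma bmeas_cst c : bmeas (fun=> c).
Proof. by split; [exact: measurable_cst|exists `|c|]. Qed.

Lemma bmeasD f g : bmeas f -> bmeas g -> bmeas (fun x => f x + g x).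
Proof.
move=> [mf [M hM]] [mg [L hL]]; split; first exact: measurable_funD.
by exists (M + L) => x; rewrite (le_trans (ler_normD _ _))// lerD.
Qed.

Lemma bmeasM f g : bmeas f -> bmeas g -> bmeas (fun x => f x * g x).
Proof.
move=> [mf [M hM]] [mg [L hL]]; split; first exact: measurable_funM.
by exists (M * L) => x; rewrite normrM ler_pM.
Qed.

Lemma bmeas_cos f : measurable_fun setT f -> bmeas (fun x => cos (f x)).
Proof.
move=> mf; split; last by exists 1 => x; rewrite ler_norml cos_geN1 cos_le1.
by apply: measurableT_comp => //; apply: continuous_measurable_fun; exact: continuous_cos.
Qed.

Lemma bmeas_sin f : measurable_fun setT f -> bmeas (fun x => sin (f x)).
Proof.
move=> mf; split; last by exists 1 => x; rewrite ler_norml sin_geN1 sin_le1.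
by apply: measurableT_comp => //; apply: continuous_measurable_fun; exact: continuous_sin.
Qed.

Lemma bmeas_lim (f_ : (T -> K)^nat) f M : (forall n, measurable_fun setT (f_ n)) ->
  (forall n x, `|f_ n x| <= M) -> (forall x, f_ ^~ x @ \oo --> f x) -> bmeas f.
Proof.
move=> mf hM fl; split.
  by apply: (@measurable_fun_cvg _ _ _ _ f_) => // x _; exact: fl.
exists M => x; have h : (fun n => `|f_ n x|) @ \oo --> `|f x| by apply: cvg_norm; exact: fl.
by apply: (cvgr_to_le h); apply: nearW => n; exact: hM.
Qed.

Lemma Rintegral_lim mu (f_ : (T -> K)^nat) f M :
  (forall n, measurable_fun setT (f_ n)) -> (forall n x, `|f_ n x| <= M) ->
  (forall x, f_ ^~ x @ \oo --> f x) ->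
  (fun n => \int[mu]_x f_ n x) @ \oo --> \int[mu]_x f x.
Proof.
move=> mf hM fl; have bf := bmeas_lim mf hM fl.
have ig : mu.-integrable setT (EFin \o (cst M : T -> K)).
  exact/bmeas_integrable/bmeas_cst.
have [||||i1 _ h] := @dominated_convergence _ _ _ mu setT measurableT
  (fun n x => (f_ n x)%:E) (EFin \o f) (EFin \o (cst M : T -> K)) _ _ _ ig.
- by move=> n; apply/measurable_EFinP.
- by apply/measurable_EFinP; exact: bf.1.
- by apply: aeW => x _; apply: cvg_EFin; [exact: nearW|exact: fl].
- by apply: aeW => x n _; rewrite lee_fin.
apply: fine_cvg; rewrite fineK; first exact: h.
exact: integrable_fin_num i1.
Qed.

End bounded_measurable.

(** * Polynomial thresholds and the sign of a real number *)

Section threshold.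
Variable K : realType.
Implicit Types x : K.

Lemma bernoulli_le x n : -1 <= x -> 1 + n%:R * x <= (1 + x) ^+ n.
Proof.
move=> x1; elim: n => [|n IH]; first by rewrite mul0r addr0 expr0.
rewrite exprS; have h : 0 <= 1 + x by lra.
apply: le_trans (ler_wpM2l h IH).
have : 0 <= n%:R * x ^+ 2 by rewrite mulr_ge0// sqr_ge0.
rewrite -natr1 expr2; nra.
Qed.

Lemma expr1B_le x n : 0 <= x <= 1 -> (1 - x) ^+ n * (1 + n%:R * x) <= 1.
Proof.
move=> /andP[x0 x1].
have h : 0 <= (1 - x) ^+ n by apply: exprn_ge0; lra.
apply: (@le_trans _ _ ((1 - x) ^+ n * (1 + x) ^+ n)).
  by rewrite ler_wpM2l// bernoulli_le//; lra.
by rewrite -exprMn exprn_ile1//; nra.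
Qed.

Lemma natr_expr_le x n : 0 <= x < 1 -> n%:R * x ^+ n * (1 - x) <= 1.
Proof.
move=> /andP[x0 x1].
have : n%:R * x ^+ n <= \sum_(i < n) x ^+ i.
  rewrite -[n in n%:R]card_ord mulr_natl -sumr_const; apply: ler_sum => i _.
  by apply: ler_wiXn2l; rewrite ?(ltW x1) ?(ltnW (ltn_ord i)).
have := subrX1 x n; have : 0 <= x ^+ n by rewrite exprn_ge0.
set S := \sum_(i < n) _; set y := x ^+ n => y0 E h.
have : (x - 1) * S = y - 1 by []. 
nra.
Qed.

(** With s the square root of x, n x^n = (n s^n) s^n: the first factor is bounded and the second
    tends to 0. *)
Lemma natr_expr_small x (e : K) : 0 <= x < 1 -> 0 < e ->
  exists N, forall n, (N <= n)%N -> n%:R * x ^+ n <= e.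
Proof.
move=> /andP[x0 x1] e0; pose s := Num.sqrt x.
have s0 : 0 <= s by rewrite sqrtr_ge0.
have s1 : s < 1 by rewrite -sqrtr1 ltr_sqrt.
have s1' : 0 < 1 - s by lra.
have [|N hN] := @expr_small K s (e * (1 - s)) _ (mulr_gt0 e0 s1').
  by rewrite s0.
exists N => n /hN h.
have -> : x ^+ n = s ^+ n * s ^+ n by rewrite -exprMn -expr2 sqr_sqrtr.
have := @natr_expr_le s n; rewrite s0 s1 => /(_ isT) h2.
rewrite -(ler_pM2r s1') mulrA mulrAC (le_trans _ h)//.
by rewrite ler_piMl// exprn_ge0.
Qed.

(** With (2 x)^n = 2^n x^n, Bernoulli bounds the power below by 1 - n (2 x)^n, which tends to 1 if x
    < 1/2, and above by 1 / (1 + n (2 x)^n), which tends to 0 otherwise. The factor n in the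
    exponent settles the case x = 1/2. *)
Lemma threshold_cvg x : 0 <= x <= 1 ->
  (fun n => (1 - x ^+ n) ^+ (n * 2 ^ n)%N) @ \oo --> ((x < 2^-1)%R%:R : K).
Proof.
move=> /andP[x0 x1]; apply/cvgrPdist_le => e e0.
have [x2|x2] := ltP x 2^-1.
  have [|N hN] := @natr_expr_small (2 * x) e _ e0; first by lra.
  exists N => // n /= /hN h.
  have xn0 : 0 <= x ^+ n by rewrite exprn_ge0.
  have xn1 : x ^+ n <= 1 by rewrite exprn_ile1.
  have := @bernoulli_le (- x ^+ n) (n * 2 ^ n)%N; rewrite lerN2 => /(_ xn1).
  have le1 : (1 - x ^+ n) ^+ (n * 2 ^ n)%N <= 1 by rewrite exprn_ile1//; lra.
  rewrite natrM natrX mulrN -mulrA -exprMn => h2.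
  by rewrite ger0_norm ?subr_ge0//; lra.
have [|N hN] := @natr_expr_small 2^-1 e _ e0; first by lra.
pose N2 := Num.bound e^-1.
exists N2 => // n /= nN; rewrite sub0r normrN.
have xn0 : 0 <= x ^+ n by rewrite exprn_ge0.
have xn1 : x ^+ n <= 1 by rewrite exprn_ile1.
have := @expr1B_le (x ^+ n) (n * 2 ^ n)%N; rewrite xn0 xn1 => /(_ isT).
have p0 : 0 <= (1 - x ^+ n) ^+ (n * 2 ^ n) by apply: exprn_ge0; lra.
rewrite ger0_norm// natrM natrX -mulrA -exprMn.
have h2 : 1 <= (2 * x) ^+ n by rewrite exprn_ege1//; lra.
have h3 : n%:R <= n%:R * (2 * x) ^+ n by rewrite ler_peMr.
have h4 : e^-1 <= n%:R.
  apply: ltW; apply: (lt_le_trans (archi_boundP _)); first by rewrite invr_ge0 ltW.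
  by rewrite ler_nat.
have h5 : 1 <= e * (1 + n%:R * (2 * x) ^+ n).
  by rewrite -ler_pdivrMl// mulr1; lra.
move=> h6; have h7 : 0 < 1 + n%:R * (2 * x) ^+ n.
  by have := ler0n K n; lra.
by rewrite -(ler_pM2r h7) (le_trans h6).
Qed.

(* Scaling y by 1/(n+1) eventually brings it into (-pi/2, pi/2), where sin has the sign of y. *)
Lemma sin_sign_cvg (y : K) :
  (fun n => (((1 + sin (n.+1%:R^-1 * y)) / 2 < 2^-1)%R%:R : K)) @ \oo --> ((y < 0)%R%:R : K).
Proof.
apply/cvgrPdist_le => e e0.
pose N := Num.bound (`|y| / (pi / 2)).
exists N => // n /= nN.
have p2 : 0 < pi / 2 :> K by rewrite divr_gt0// pi_gt0.
have hy : `|n.+1%:R^-1 * y| < pi / 2.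
  rewrite normrM ger0_norm// ltr_pdivrMl// -ltr_pdivrMr//.
  apply: (lt_le_trans (archi_boundP _)); first by rewrite divr_ge0// ltW.
  by rewrite ler_nat (leq_trans nN).
have n0 : 0 < n.+1%:R^-1 :> K by rewrite invr_gt0.
suff -> : ((1 + sin (n.+1%:R^-1 * y)) / 2 < 2^-1) = (y < 0).
  by rewrite subrr normr0 ltW.
have -> : ((1 + sin (n.+1%:R^-1 * y)) / 2 < 2^-1) = (sin (n.+1%:R^-1 * y) < 0).
  by apply/idP/idP; lra.
move: hy; rewrite ltr_norml => /andP[hl hr].
have [yn|yp|->] := ltgtP y 0; last by rewrite mulr0 sin0 ltxx.
  have ny : 0 < - (n.+1%:R^-1 * y) < pi / 2.
    by rewrite oppr_gt0 pmulr_rlt0// yn ltrNl.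
  by have := sin_gt0_pihalf ny; rewrite sinN oppr_gt0.
have ny : 0 < n.+1%:R^-1 * y < pi / 2 by rewrite pmulr_rgt0// yp.
by apply/negbTE; rewrite -leNgt ltW// sin_gt0_pihalf.
Qed.

End threshold.

(** * Bilinearity of the dot product and measurability on row vectors *)

Section dotv_theory.
Variables (F : comPzRingType) (n : nat).
Implicit Types u v w : 'rV[F]_n.

Lemma dotvDl u v w : dotv (u + v) w = dotv u w + dotv v w.
Proof. by rewrite /dotv -big_split/=; apply: eq_bigr => i _; rewrite mxE mulrDl. Qed.

Lemma dotvZl (c : F) u v : dotv (c *: u) v = c * dotv u v.
Proof. by rewrite /dotv mulr_sumr; apply: eq_bigr => i _; rewrite mxE mulrA. Qed.

Lemma dotvC u v : dotv u v = dotv v u.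
Proof. by apply: eq_bigr => i _; rewrite mulrC. Qed.

Lemma dotvDr u v w : dotv w (u + v) = dotv w u + dotv w v.
Proof. by rewrite dotvC dotvDl ![dotv _ w]dotvC. Qed.

Lemma dotvZr (c : F) u v : dotv v (c *: u) = c * dotv v u.
Proof. by rewrite dotvC dotvZl dotvC. Qed.

Lemma dotv0l v : dotv 0 v = 0.
Proof. by rewrite /dotv big1// => i _; rewrite mxE mul0r. Qed.

Lemma dotv_delta (i : 'I_n) v : dotv (delta_mx 0 i) v = v ord0 i.
Proof.
rewrite /dotv (bigD1 i)//= big1 ?addr0 => [|j ji]; first by rewrite mxE !eqxx mul1r.
by rewrite mxE (negbTE ji) andbF mul0r.
Qed.

End dotv_theory.

Section measurable_rV_theory.
Variables (K : realType) (n : nat).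

Lemma measurable_dotv (t : 'rV[K]_n) : measurable_fun setT (fun x : 'rV[K]_n => dotv t x).
Proof.
rewrite /dotv; apply: (@measurable_sum _ _ _ _ _ _ (fun i (x : 'rV[K]_n) => t ord0 i * x ord0 i)) => i.
by apply: measurable_funM => //; exact: measurable_rV_coord.
Qed.

Lemma measurable_fun_rV d (T : measurableType d) (f : T -> 'rV[K]_n) :
  (forall i, measurable_fun setT (fun x => f x ord0 i)) -> measurable_fun setT f.
Proof.
move=> mf; apply: (measurability (\big[setU/set0]_(i < n)
  preimage_set_system setT (fun x : 'rV[K]_n => x ord0 i) measurable)) => //.
move=> _ [B + <-]; rewrite -bigcup_seq => -[i _ [A mA <-]].
rewrite !setTI; have := mf i measurableT A mA; rewrite setTI; exact.
Qed.

End measurable_rV_theory.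

(** * From integrals of cosines to laws *)

Section fourier_uniqueness.
Variables (K : realType) (n : nat) (mu nu : probability 'rV[K]_n K).
Implicit Types (f g : 'rV[K]_n -> K).

(* The functions f such that g f is in cos_equal for all g in cos_equal form an algebra
   containing x |-> cos (s.x + b) and closed under bounded pointwise limits. *)
Definition cos_equal g := bmeas g /\ forall t c,
  \int[mu]_x (g x * cos (dotv t x + c)) = \int[nu]_x (g x * cos (dotv t x + c)).

Definition multiplier f := bmeas f /\
  forall g, cos_equal g -> cos_equal (fun x => g x * f x).

Let mcos t c : bmeas (fun x : 'rV[K]_n => cos (dotv t x + c)).
Proof. by apply: bmeas_cos; apply: measurable_funD => //; exact: measurable_dotv. Qed.

Lemma cos_equalD g1 g2 : cos_equal g1 -> cos_equal g2 -> cos_equal (fun x => g1 x + g2 x).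
Proof.
move=> [b1 h1] [b2 h2]; split; first exact: bmeasD.
move=> t c.
have E (m : probability 'rV[K]_n K) : \int[m]_x ((g1 x + g2 x) * cos (dotv t x + c)) =
  \int[m]_x (g1 x * cos (dotv t x + c)) + \int[m]_x (g2 x * cos (dotv t x + c)).
  rewrite -RintegralD//; try by apply: bmeas_integrable; exact: bmeasM.
  by apply: eq_Rintegral => x _; rewrite mulrDl.
by rewrite !E h1 h2.
Qed.

Lemma cos_equalZ k g : cos_equal g -> cos_equal (fun x => k * g x).
Proof.
move=> [b1 h1]; split; first by apply: bmeasM => //; exact: bmeas_cst.
move=> t c.
have E (m : probability 'rV[K]_n K) : \int[m]_x (k * g x * cos (dotv t x + c)) =
  k * \int[m]_x (g x * cos (dotv t x + c)).
  rewrite -RintegralZl//; last by apply: bmeas_integrable; exact: bmeasM.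
  by apply: eq_Rintegral => x _; rewrite mulrA.
by rewrite !E h1.
Qed.

Lemma cos_equal_lim (f_ : ('rV[K]_n -> K)^nat) f M :
  (forall k, cos_equal (f_ k)) -> (forall k x, `|f_ k x| <= M) ->
  (forall x, f_ ^~ x @ \oo --> f x) -> cos_equal f.
Proof.
move=> hf hM fl; split; first by apply: (bmeas_lim _ hM fl) => k; have [[]] := hf k.
move=> t c.
have cv (m : probability 'rV[K]_n K) : (fun k => \int[m]_x (f_ k x * cos (dotv t x + c))) @ \oo -->
    \int[m]_x (f x * cos (dotv t x + c)).
  apply: (@Rintegral_lim _ _ _ m (fun k x => f_ k x * cos (dotv t x + c)) _ M) => [k|k x|x].
  - by have [/bmeasM/(_ (mcos t c))[]] := hf k.
  - rewrite normrM (le_trans _ (hM k x))// ler_piMr//.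
    by rewrite ler_norml cos_geN1 cos_le1.
  - by apply: cvgM; [exact: fl|exact: cvg_cst].
have := cv mu; have <- : (fun k => \int[nu]_x (f_ k x * cos (dotv t x + c))) =
    (fun k => \int[mu]_x (f_ k x * cos (dotv t x + c))).
  by apply/funext => k; have [_ ->] := hf k.
by move=> /(cvg_lim (@Rhausdorff K)) <-; rewrite (cvg_lim (@Rhausdorff K) (cv nu)).
Qed.

Lemma multiplier_cst k : multiplier (fun=> k).
Proof.
split; first exact: bmeas_cst.
by move=> g /(cos_equalZ k); under eq_fun do rewrite mulrC.
Qed.

Lemma multiplierD f1 f2 : multiplier f1 -> multiplier f2 ->
  multiplier (fun x => f1 x + f2 x).
Proof.
move=> [b1 h1] [b2 h2]; split; first exact: bmeasD.
by move=> g hg; under eq_fun do rewrite mulrDr; exact: cos_equalD (h1 _ hg) (h2 _ hg).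
Qed.

Lemma multiplierM f1 f2 : multiplier f1 -> multiplier f2 ->
  multiplier (fun x => f1 x * f2 x).
Proof.
move=> [b1 h1] [b2 h2]; split; first exact: bmeasM.
by move=> g hg; under eq_fun do rewrite mulrA; exact: h2 (h1 _ hg).
Qed.

Lemma multiplierX f k : multiplier f -> multiplier (fun x => f x ^+ k).
Proof.
move=> hf; elim: k => [|k IH]; first by under eq_fun do rewrite expr0; exact: multiplier_cst.
by under eq_fun do rewrite exprS; exact: multiplierM.
Qed.

(** The product of two cosines is a half-sum of cosines of frequencies s + t and s - t, already
    covered by the quantification over t and c in [cos_equal]. *)
Lemma multiplier_cos s b : multiplier (fun x => cos (dotv s x + b)).
Proof.
split=> // g [bg hg]; split; first exact: bmeasM.
move=> t c.
have E (m : probability 'rV[K]_n K) :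
  \int[m]_x (g x * cos (dotv s x + b) * cos (dotv t x + c)) =
  2^-1 * \int[m]_x (g x * cos (dotv (s + t) x + (b + c))) +
  2^-1 * \int[m]_x (g x * cos (dotv (s - t) x + (b - c))).
  have i1 t' c' : m.-integrable setT (EFin \o (fun x => g x * cos (dotv t' x + c'))).
    by apply: bmeas_integrable; exact: bmeasM.
  rewrite -!RintegralZl// -RintegralD//; first last.
  - by apply: bmeas_integrable; apply: bmeasM; [exact: bmeas_cst|exact: bmeasM].
  - by apply: bmeas_integrable; apply: bmeasM; [exact: bmeas_cst|exact: bmeasM].
  apply: eq_Rintegral => x _.
  have -> : dotv (s + t) x + (b + c) = (dotv s x + b) + (dotv t x + c).
    by rewrite dotvDl; ring.
  have -> : dotv (s - t) x + (b - c) = (dotv s x + b) - (dotv t x + c).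
    by rewrite dotvDl -scaleN1r dotvZl; ring.
  move: (dotv s x + b) (dotv t x + c) => A B.
  by rewrite cosD cosB; field.
by rewrite !E !hg.
Qed.

Lemma multiplier_lim (f_ : ('rV[K]_n -> K)^nat) f :
  (forall k, multiplier (f_ k)) -> (forall k x, `|f_ k x| <= 1) ->
  (forall x, f_ ^~ x @ \oo --> f x) -> multiplier f.
Proof.
move=> hf h1 fl; split; first by apply: (bmeas_lim _ h1 fl) => k; have [[]] := hf k.
move=> g hg; have [[mg [M hM]] _] := hg.
apply: (@cos_equal_lim (fun k x => g x * f_ k x) _ M) => [k|k x|x].
- by have [_ h] := hf k; exact: h.
- by rewrite normrM (le_trans _ (hM x))// ler_piMr.
- by apply: cvgM; [exact: cvg_cst|exact: fl].
Qed.

(** Two nested limits: the threshold at a fixed period, then the period grows so that the sign of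
    the sine becomes that of x_j - a. *)
Lemma multiplier_ltr (j : 'I_n) (a : K) :
  multiplier (fun x : 'rV[K]_n => (x ord0 j < a)%R%:R).
Proof.
apply: (@multiplier_lim (fun k (x : 'rV[K]_n) => ((1 + sin (k.+1%:R^-1 * (x ord0 j - a))) / 2 < 2^-1)%R%:R)).
- move=> k; pose f (x : 'rV[K]_n) := (1 + sin (k.+1%:R^-1 * (x ord0 j - a))) / 2 : K.
  have hf : multiplier f.
    (* A sine is a cosine with phase - pi/2. *)
    have -> : f = fun x => (1 + cos (dotv (k.+1%:R^-1 *: delta_mx 0 j) x +
         (- (k.+1%:R^-1 * a) - pi / 2))) * 2^-1.
      apply/funext => x; rewrite dotvZl dotv_delta addrA -mulrBr /f.
      by rewrite cosB cos_pihalf sin_pihalf mulr0 add0r mulr1.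
    apply: multiplierM; last exact: multiplier_cst.
    by apply: multiplierD; [exact: multiplier_cst|exact: multiplier_cos].
  have f01 x : 0 <= f x <= 1.
    by rewrite /f; have := sin_geN1 (k.+1%:R^-1 * (x ord0 j - a));
       have := sin_le1 (k.+1%:R^-1 * (x ord0 j - a)); lra.
  apply: (@multiplier_lim (fun m x => (1 - f x ^+ m) ^+ (m * 2 ^ m)%N)).
  + move=> m; apply: multiplierX; apply: multiplierD; first exact: multiplier_cst.
    under eq_fun do rewrite -mulN1r.
    by apply: multiplierM; [exact: multiplier_cst|exact: multiplierX].
  + move=> m x; have /andP[f0 f1] := f01 x.
    have h0 : 0 <= f x ^+ m by rewrite exprn_ge0.
    have h1 : f x ^+ m <= 1 by rewrite exprn_ile1.
    rewrite normrX exprn_ile1// ger0_norm; lra.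
  + by move=> x; exact: threshold_cvg.
- by move=> k x; case: (_ < _)%R; rewrite ?normr1 ?normr0.
- by move=> x; rewrite -subr_lt0; exact: sin_sign_cvg.
Qed.

(** Encoded by lists of constraints: concatenation is intersection, which gives a pi-system, and the
    empty list is the whole space. *)
Definition box (s : seq ('I_n * K)) : set 'rV[K]_n :=
  [set x | all (fun p => x ord0 p.1 < p.2)%R s].

Lemma multiplier_box s : multiplier (\1_(box s) : 'rV[K]_n -> K).
Proof.
elim: s => [|p s IH].
  rewrite (_ : \1__ = fun=> 1); first exact: multiplier_cst.
  by apply/funext => x; rewrite indicE mem_set.
rewrite (_ : \1__ = (fun x : 'rV[K]_n => (x ord0 p.1 < p.2)%R%:R * \1_(box s) x)).
  by apply: multiplierM => //; exact: multiplier_ltr.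
apply/funext => x; rewrite !indicE -natrM mulnb; congr (_%:R); congr nat_of_bool.
by apply/idP/andP; rewrite !inE /box/= => /andP.
Qed.

Lemma measurable_box : @measurable _ 'rV[K]_n = <<s [set A | exists s, A = box s] >>.
Proof.
apply/seteqP; split; last first.
  apply: smallest_sub; first exact: sigma_algebra_measurable.
  move=> _ [s ->]; have [[mb _] _] := multiplier_box s.
  have := mb measurableT [set 1] (measurable_set1 _); rewrite setTI.
  congr measurable; apply/seteqP; split => x; rewrite /preimage/= indicE.
    by move=> /eqP; case: (boolP (x \in box s)) => [/set_mem//|_]; rewrite eq_sym oner_eq0.
  by move=> bx; rewrite mem_set.
apply: smallest_sub; first exact: smallest_sigma_algebra.
rewrite -bigcup_seq => A [i _ mA]; move: A mA.
have mcoor : measurable_fun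
    [set: g_sigma_algebraType [set A : set 'rV[K]_n | exists s, A = box s]]
    (fun x : 'rV[K]_n => x ord0 i).
  apply: (measurability _ (RGenInftyO.measurableE K)) => _ [_ [a ->] <-].
  rewrite setTI; apply: sub_sigma_algebra; exists [:: (i, a)].
  by apply/seteqP; split => x /=; rewrite /box/= in_itv/= andbT.
by move=> _ [B mB <-]; exact: mcoor.
Qed.

(** The constant 1 is [cos_equal] by assumption, hence so are indicators of boxes; t = 0 and c = 0
    then give equal masses on a generating pi-system. *)
Lemma fourier_uniqueness :
  (forall t c, \int[mu]_x cos (dotv t x + c) = \int[nu]_x cos (dotv t x + c)) ->
  eq_law mu nu.
Proof.
move=> h; have h1 : cos_equal (fun=> 1).
  split; first exact: bmeas_cst.
  move=> t c; have E (m : probability 'rV[K]_n K) :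
      \int[m]_x (1 * cos (dotv t x + c)) = \int[m]_x cos (dotv t x + c).
    by apply: eq_Rintegral => x _; rewrite mul1r.
  by rewrite !E.
move=> A mA; have lt : (mu setT < +oo)%E by rewrite probability_setT ltry.
apply: (@measure_unique _ _ _ [set A | exists s, A = box s] (fun=> setT)) => //.
- exact: measurable_box.
- move=> _ _ [s1 ->] [s2 ->]; exists (s1 ++ s2).
  by apply/seteqP; split => x; rewrite /box/= all_cat => /andP.
- by move=> _; exists [::]; apply/seteqP; split.
- by rewrite bigcup_const.
- move=> _ [s ->]; have [bb hb] := multiplier_box s.
  have mb : measurable (box s).
    by rewrite measurable_box; apply: sub_sigma_algebra; exists s.
  have [_ /(_ 0 0)] := hb _ h1.
  have E (m : probability 'rV[K]_n K) :
    \int[m]_x (1 * (\1_(box s) x : K) * cos (dotv 0 x + 0)) = fine (m (box s)).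
    rewrite /Rintegral -[in RHS](setIT (box s)) -integral_indic//; congr fine.
    by apply: eq_integral => x _; rewrite dotv0l addr0 cos0 mulr1 mul1r.
  have fin (m : probability 'rV[K]_n K) : m (box s) \is a fin_num.
    exact: fin_num_measure.
  by rewrite !E => E2; rewrite -[LHS]fineK ?fin// -[RHS]fineK ?fin// E2.
Qed.

End fourier_uniqueness.

(** * Characteristic functions *)

Section complex_exponential.
Variable K : realType.
Local Notation C := K[i].

Lemma cexpD (u v : C) : cexp (u + v) = cexp u * cexp v.
Proof.
by apply: cplxP; rewrite /cexp !(reD, imD, reM, imM)/= expRD sinD cosD; ring.
Qed.

Lemma cmod_cexp (v : C) : cmod (cexp v) = expR (complex.Re v).
Proof.
rewrite /cexp cmodM cmodR ger0_norm ?expR_ge0// [cmod (_ +i* _)]cmodE /=.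
by rewrite cos2Dsin2 sqrtr1 mulr1.
Qed.

Lemma cexp0 : cexp (0 : C) = 1.
Proof. by rewrite /cexp /= expR0 cos0 sin0 mul1r. Qed.

Lemma cmod_cexp_le (v : C) : cmod (cexp v) <= expR (cmod v).
Proof. by rewrite cmod_cexp ler_expR (le_trans (ler_norm _))// ler_Re_cmod. Qed.

Lemma powfact_le_expR (x : K) n : 0 <= x -> x ^+ n / n`!%:R <= expR x.
Proof.
move=> x0; case: n => [|n]; last by have := expR_ge1Dxn n x0; lra.
by rewrite expr0 fact0 divr1 -expR0 ler_expR.
Qed.

Definition ctaylor (v : C) n : C := \sum_(k < n) v ^+ k / k`!%:R.

(** Along t v with t in [0, 1], the derivative of the remainder of order n + 1 is v times the
    remainder of order n. A phase [om] reduces to real parts, where a nonnegative derivative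
    suffices. *)
Lemma cexp_taylor n (v : C) :
  cmod (cexp v - ctaylor v n) <= cmod v ^+ n / n`!%:R * expR (cmod v).
Proof.
elim: n v => [|n IH] v.
  by rewrite /ctaylor big_ord0 subr0 expr0 fact0 divr1 mul1r cmod_cexp_le.
have [->|v0] := eqVneq v 0.
  rewrite /ctaylor cexp0 big_ord_recl big1 ?addr0 => [|i _].
    by rewrite expr0 fact0 divr1 subrr !cmod0 mulr_ge0 ?expR_ge0// divr_ge0// exprn_ge0.
  by rewrite expr0n/= mul0r.
pose B := cmod v ^+ n.+1 / n`!%:R * expR (cmod v).
have B0 : 0 <= B by rewrite mulr_ge0 ?expR_ge0// divr_ge0// exprn_ge0// cmod_ge0.
suff key (om : C) : cmod om <= 1 ->
    complex.Re (om * (cexp v - ctaylor v n.+1)) <= B / n.+1%:R.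
  set E := cexp v - ctaylor v n.+1 in key *.
  have -> : cmod v ^+ n.+1 / n.+1`!%:R * expR (cmod v) = B / n.+1%:R.
    rewrite /B factS natrM invfM; move: (n.+1%:R^-1) (n`!%:R^-1 : K) => p q; ring.
  by have [om om1 omE] := cmod_phase E; have := key om om1; rewrite omE.
move=> om1; pose x := complex.Re v; pose y := complex.Im v.
pose c j := complex.Re (om * v ^+ j.+1 / j`!%:R).
pose h (t : K) := B / n.+1%:R * t ^+ n.+1 - (expR (t * x) * (complex.Re om * cos (t * y) - complex.Im om * sin (t * y))
   - \sum_(j < n) c j / j.+1%:R * t ^+ j.+1).
have invnat j : (j%:R : C)^-1 = (j%:R^-1 : K)%:C by rewrite fmorphV rmorph_nat.
have tv (t : K) : t%:C * v = (t * x) +i* (t * y).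
  by apply: cplxP; rewrite (reM, imM)/= mul0r ?subr0 ?addr0.
have cexpt (t : K) : complex.Re (om * cexp (t%:C * v)) =
    expR (t * x) * (complex.Re om * cos (t * y) - complex.Im om * sin (t * y)).
  by rewrite tv /cexp/= !(reM, imM)/=; ring.
have cexpt' (t : K) : complex.Re (om * v * cexp (t%:C * v)) =
    expR (t * x) * (x * (complex.Re om * cos (t * y) - complex.Im om * sin (t * y))
     + y * (- complex.Re om * sin (t * y) - complex.Im om * cos (t * y))).
  by rewrite tv /cexp/= !(reM, imM)/= -/x -/y; ring.
pose dh (t : K) := B * t ^+ n - (complex.Re (om * v * cexp (t%:C * v)) - \sum_(j < n) c j * t ^+ j).
have hd (t : K) : 0 <= t <= 1 -> is_derive t 1 h (dh t).
  move=> t01; rewrite /h /dh.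
  have dx (z : K) : is_derive t 1 (fun t : K => t * z) z.
    have -> : (fun t : K => t * z) = (z \*: id).
      by apply/funext => s; rewrite /= /GRing.scale/= mulrC.
    by apply: is_derive_eq; rewrite /GRing.scale/= mulr1.
  have de := @is_derive1_comp K (@expR K) (fun t => t * x) t _ _ (is_derive_expR (t * x)) (dx x).
  have dc := @is_derive1_comp K (@cos K) (fun t => t * y) t _ _ (is_derive_cos (t * y)) (dx y).
  have ds := @is_derive1_comp K (@sin K) (fun t => t * y) t _ _ (is_derive_sin (t * y)) (dx y).
  have dm := is_deriveM de (is_deriveB (is_deriveZ (complex.Re om) dc) (is_deriveZ (complex.Im om) ds)).
  have dB : is_derive t 1 (fun t : K => B / n.+1%:R * t ^+ n.+1) (B * t ^+ n).
    have -> : (fun t : K => B / n.+1%:R * t ^+ n.+1) = (B / n.+1%:R) \*: (fun t : K => t) ^+ n.+1.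
      by apply/funext => s; rewrite /= !fctE.
    apply: is_derive_eq; rewrite /GRing.scale/= mulr1 [X in _ * X](_ : _ = n.+1%:R * t ^+ n)//.
    by rewrite mulrA divfK// pnatr_eq0.
  have := is_deriveB dB (is_deriveB dm (deriv_powsum c n t)).
  move=> /is_derive_eq; apply; rewrite cexpt' /GRing.scale/= !fctE/= /GRing.scale/=.
  by congr (_ - (_ - _)); ring.
have dh0 (t : K) : 0 <= t <= 1 -> 0 <= dh t.
  move=> /andP[t0 t1]; rewrite /dh.
  have -> : \sum_(j < n) c j * t ^+ j = complex.Re (om * v * ctaylor (t%:C * v) n).
    rewrite /ctaylor mulr_sumr re_sum; apply: eq_bigr => j _; rewrite /c.
    have -> : om * v * ((t%:C * v) ^+ j / j`!%:R) = (t ^+ j)%:C * (om * v ^+ j.+1 / j`!%:R).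
      by rewrite exprMn exprS rmorphXn/=; ring.
    by rewrite [RHS]reM/= mul0r subr0 mulrC.
  rewrite -reN -reD -mulrBr subr_ge0 (le_trans (ler_norm _))// (le_trans (ler_Re_cmod _))//.
  rewrite !cmodM -mulrA.
  have tvv : cmod (t%:C * v) = t * cmod v by rewrite cmodM cmodR ger0_norm.
  have := IH (t%:C * v); rewrite tvv => h1.
  have h2 : t * cmod v <= cmod v by rewrite ler_piMl ?cmod_ge0.
  have h3 : expR (t * cmod v) <= expR (cmod v) by rewrite ler_expR.
  have h4 : cmod (cexp (t%:C * v) - ctaylor (t%:C * v) n) <= (t * cmod v) ^+ n / n`!%:R * expR (cmod v).
    by rewrite (le_trans h1)// ler_wpM2l// divr_ge0// exprn_ge0// mulr_ge0// cmod_ge0.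
  rewrite (le_trans (ler_piMl _ om1)) ?mulr_ge0 ?cmod_ge0//.
  rewrite (le_trans (ler_wpM2l (cmod_ge0 _) h4))// /B exprMn exprS.
  by rewrite le_eqVlt; apply/orP; left; apply/eqP; move: (n`!%:R^-1 : K) => q; ring.
have := ndecr01 hd dh0; rewrite /h !mul0r expR0 cos0 sin0 expr0n/= mulr0.
rewrite big1 => [|j _]; last by rewrite expr0n/= mulr0.
rewrite mulr1 mulr0 !subr0 mul1r sub0r expr1n mulr1 => h01.
have -> : complex.Re (om * (cexp v - ctaylor v n.+1)) =
   complex.Re (om * cexp (1%:C * v)) - (complex.Re om + \sum_(j < n) c j / j.+1%:R * 1 ^+ j.+1).
  rewrite mulrBr reD reN mul1r; congr (_ - _).
  rewrite /ctaylor big_ord_recl expr0 fact0 divr1 mulrDr mulr1 reD; congr (_ + _).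
  rewrite mulr_sumr re_sum; apply: eq_bigr => j _; rewrite /c expr1n mulr1 lift0 factS natrM.
  rewrite invfM (invnat j.+1).
  have -> : om * (v ^+ j.+1 * ((j.+1%:R^-1)%:C / j`!%:R)) = (j.+1%:R^-1)%:C * (om * v ^+ j.+1 / j`!%:R).
    by move: ((j.+1%:R^-1)%:C : C) => p; ring.
  by rewrite [LHS]reM/= mul0r subr0 mulrC.
rewrite cexpt; move: h01; set S := \sum_(j < n) _; set X := expR _ * _.
by set Y := B / _; lra.
Qed.

Lemma hasps_cexp (mu : C) : hasps (fun w => cexp (mu * w)) (fun k => mu ^+ k / k`!%:R).
Proof.
(* With m = |mu w|, (2 m)^n / n! is at most exp(2 m), and the Taylor remainder brings one more
   exp(m). *)
move=> r; exists (expR (3 * (cmod mu * r))) => n w wr.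
have -> : psum (fun k => mu ^+ k / k`!%:R) n w = ctaylor (mu * w) n.
  by apply: eq_bigr => k _; rewrite exprMn mulrAC.
apply: (le_trans (cexp_taylor n _)).
have m0 := cmod_ge0 (mu * w).
rewrite ler_pdivlMr ?exprn_gt0//.
have -> : cmod (mu * w) ^+ n / n`!%:R * expR (cmod (mu * w)) * 2 ^+ n =
    (2 * cmod (mu * w)) ^+ n / n`!%:R * expR (cmod (mu * w)).
  by rewrite [in RHS]exprMn; move: (n`!%:R^-1 : K) (2 ^+ n : K) => p q; ring.
apply: (@le_trans _ _ (expR (2 * cmod (mu * w)) * expR (cmod (mu * w)))).
  by rewrite ler_wpM2r ?expR_ge0// powfact_le_expR// mulr_ge0.
rewrite -expRD ler_expR cmodM.
have : cmod mu * cmod w <= cmod mu * r by rewrite ler_wpM2l ?cmod_ge0.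
lra.
Qed.

End complex_exponential.

(** * Integrals of complex-valued functions *)

Section complex_integral.
Context d (T : measurableType d) (K : realType).
Variable mu : {measure set T -> \bar K}.
Local Notation C := K[i].
Implicit Types (f g : T -> C) (b : T -> K).

Definition cmeas f := measurable_fun setT (fun x => complex.Re (f x)) /\
  measurable_fun setT (fun x => complex.Im (f x)).

Lemma cmeas_cst c : cmeas (fun=> c).
Proof. by split; exact: measurable_cst. Qed.

Lemma cmeas_real b : measurable_fun setT b -> cmeas (fun x => (b x)%:C).
Proof. by move=> mb; split=> //=; exact: measurable_cst. Qed.

Lemma cmeasD f g : cmeas f -> cmeas g -> cmeas (fun x => f x + g x).
Proof.
by move=> [f1 f2] [g1 g2]; split;
  [under eq_fun do rewrite reD|under eq_fun do rewrite imD]; exact: measurable_funD.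
Qed.

Lemma cmeasM f g : cmeas f -> cmeas g -> cmeas (fun x => f x * g x).
Proof.
move=> [f1 f2] [g1 g2]; split.
  under eq_fun do rewrite reM.
  by apply: measurable_funB; exact: measurable_funM.
under eq_fun do rewrite imM.
by apply: measurable_funD; exact: measurable_funM.
Qed.

Lemma cmeasX f n : cmeas f -> cmeas (fun x => f x ^+ n).
Proof.
move=> mf; elim: n => [|n IH].
  by under eq_fun do rewrite expr0; exact: cmeas_cst.
by under eq_fun do rewrite exprS; exact: cmeasM.
Qed.

Lemma cmeas_cexp f : cmeas f -> cmeas (fun x => cexp (f x)).
Proof.
move=> [f1 f2]; apply: cmeasM.
  by apply: cmeas_real; apply: measurableT_comp => //; exact: measurable_expR.
split=> /=; apply: measurableT_comp => //; apply: continuous_measurable_fun.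
  exact: continuous_cos.
exact: continuous_sin.
Qed.

Definition cintble f := cmeas f /\
  exists2 b, mu.-integrable setT (EFin \o b) & forall x, cmod (f x) <= b x.

Lemma le_bound_integrable (h : T -> K) b : measurable_fun setT h ->
  (forall x, `|h x| <= b x) -> mu.-integrable setT (EFin \o b) ->
  mu.-integrable setT (EFin \o h).
Proof.
move=> mh hb ib; apply: le_integrable ib => //; first exact/measurable_EFinP.
by move=> x _; rewrite /= lee_fin (le_trans (hb x))// ler_norm.
Qed.

Lemma cintble_Re f : cintble f -> mu.-integrable setT (EFin \o (fun x => complex.Re (f x))).
Proof.
move=> [[m _] [b ib hb]]; apply: (le_bound_integrable m _ ib) => x.
exact: le_trans (ler_Re_cmod _) (hb x).
Qed.

Lemma cintble_Im f : cintble f -> mu.-integrable setT (EFin \o (fun x => complex.Im (f x))).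
Proof.
move=> [[_ m] [b ib hb]]; apply: (le_bound_integrable m _ ib) => x.
exact: le_trans (ler_Im_cmod _) (hb x).
Qed.

Lemma cintbleD f g : cintble f -> cintble g -> cintble (fun x => f x + g x).
Proof.
move=> [mf [b ib hb]] [mg [e ie he]]; split; first exact: cmeasD.
exists (fun x => b x + e x).
  by have := integrableD measurableT ib ie; apply: eq_integrable => // x _.
by move=> x; rewrite (le_trans (cmodD _ _))// lerD.
Qed.

Lemma cintbleZ c f : cintble f -> cintble (fun x => c * f x).
Proof.
move=> [mf [b ib hb]]; split; first by apply: cmeasM => //; exact: cmeas_cst.
exists (fun x => cmod c * b x).
  by have := integrableZl measurableT (cmod c) ib; apply: eq_integrable => // x _.
by move=> x; rewrite cmodM ler_wpM2l ?cmod_ge0.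
Qed.

Lemma re_cintegral f : complex.Re (cintegral mu f) = \int[mu]_x complex.Re (f x).
Proof. by []. Qed.

Lemma im_cintegral f : complex.Im (cintegral mu f) = \int[mu]_x complex.Im (f x).
Proof. by []. Qed.

Lemma eq_cintegral f g : (forall x, f x = g x) -> cintegral mu f = cintegral mu g.
Proof. by move=> fg; congr cintegral; exact/funext. Qed.

Lemma cintegralD f g : cintble f -> cintble g ->
  cintegral mu (fun x => f x + g x) = cintegral mu f + cintegral mu g.
Proof.
move=> hf hg; apply: cplxP.
  rewrite reD !re_cintegral -RintegralD//; [|exact: cintble_Re|exact: cintble_Re].
  by apply: eq_Rintegral => x _; rewrite reD.
rewrite imD !im_cintegral -RintegralD//; [|exact: cintble_Im|exact: cintble_Im].
by apply: eq_Rintegral => x _; rewrite imD.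
Qed.

Lemma cintegralZ c f : cintble f ->
  cintegral mu (fun x => c * f x) = c * cintegral mu f.
Proof.
move=> hf; have rf := cintble_Re hf; have mf := cintble_Im hf.
have rZ k (h : T -> K) : mu.-integrable setT (EFin \o h) ->
    mu.-integrable setT (EFin \o (fun x => k * h x)).
  by move=> ih; have := integrableZl measurableT k ih; apply: eq_integrable => // x _.
apply: cplxP.
  rewrite reM !re_cintegral im_cintegral -!RintegralZl// -RintegralB//; try exact: rZ.
  by apply: eq_Rintegral => x _; rewrite reM.
rewrite imM im_cintegral re_cintegral -!RintegralZl// -RintegralD//; try exact: rZ.
by apply: eq_Rintegral => x _; rewrite imM.
Qed.

(** The factor 2 comes from bounding real and imaginary parts separately; it is harmless in growth
    estimates. *)
Lemma cmod_cintegral_le f b : cmeas f -> mu.-integrable setT (EFin \o b) ->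
  (forall x, cmod (f x) <= b x) -> cmod (cintegral mu f) <= 2 * \int[mu]_x b x.
Proof.
move=> mf ib hb; have hf : cintble f by split=> //; exists b.
have bound (h : T -> K) : mu.-integrable setT (EFin \o h) ->
    (forall x, `|h x| <= b x) -> `|\int[mu]_x h x| <= \int[mu]_x b x.
  move=> ih hh; apply: le_trans (le_normr_Rintegral measurableT ih) _.
  by apply: le_Rintegral => //; have := integrable_norm ih.
have h1 := bound _ (cintble_Re hf) (fun x => le_trans (ler_Re_cmod _) (hb x)).
have h2 := bound _ (cintble_Im hf) (fun x => le_trans (ler_Im_cmod _) (hb x)).
apply: (le_trans (cmod_le_ReIm _)); rewrite re_cintegral im_cintegral.
by move: h1 h2; set I := \int[mu]_x b x; lra.
Qed.

End complex_integral.

(** * Transforms at complex arguments *)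

Section exponential_moments.
Variables (K : realType) (p : nat) (mu : probability 'rV[K]_p K).
Local Notation C := K[i].

Definition exp_moments := forall l : 'rV[K]_p,
  mu.-integrable setT (EFin \o (fun x => expR (dotv l x))).

Lemma subexp_class_moments rho : subexp_class rho mu -> exp_moments.
Proof.
move=> [A [B [A0 B0 h]]] l; apply/integrableP; split.
  apply/measurable_EFinP; apply: measurableT_comp; first exact: measurable_expR.
  exact: measurable_dotv.
rewrite (eq_integral (fun x => (expR (dotv l x))%:E)); last first.
  by move=> x _; rewrite /= ger0_norm ?expR_ge0.
exact: le_lt_trans (h l) (ltry _).
Qed.

Hypothesis hmu : exp_moments.

Definition toC (x : 'rV[K]_p) : 'rV[C]_p := map_mx (real_complex K) x.

Definition rer (z : 'rV[C]_p) : 'rV[K]_p := map_mx (@complex.Re K) z.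
Definition imr (z : 'rV[C]_p) : 'rV[K]_p := map_mx (@complex.Im K) z.

Lemma re_dotv_toC z x : complex.Re (dotv z (toC x)) = dotv (rer z) x.
Proof.
by rewrite /dotv re_sum; apply: eq_bigr => i _; rewrite !mxE reM/= mulr0 subr0.
Qed.

Lemma im_dotv_toC z x : complex.Im (dotv z (toC x)) = dotv (imr z) x.
Proof.
by rewrite /dotv im_sum; apply: eq_bigr => i _; rewrite !mxE imM/= mulr0 add0r.
Qed.

Lemma cmeas_dotv z : cmeas (fun x => dotv z (toC x)).
Proof.
split; [under eq_fun do rewrite re_dotv_toC|under eq_fun do rewrite im_dotv_toC];
  exact: measurable_dotv.
Qed.

Lemma measurable_absdot (s : seq 'rV[K]_p) :
  measurable_fun setT (fun x : 'rV[K]_p => \sum_(u <- s) `|dotv u x|).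
Proof.
apply: (@measurable_sum _ _ _ _ _ _ (fun u (x : 'rV[K]_p) => `|dotv u x|)) => u.
by apply: measurableT_comp => //; exact: measurable_dotv.
Qed.

(** As exp |y| <= exp y + exp(- y), each absolute value is absorbed into l with either sign, so l
    varies in the induction. *)
Lemma expR_absdot_integrable (s : seq 'rV[K]_p) (l : 'rV[K]_p) :
  mu.-integrable setT (EFin \o (fun x => expR (dotv l x + \sum_(u <- s) `|dotv u x|))).
Proof.
elim: s l => [|u s IH] l.
  by under eq_fun do rewrite big_nil addr0; exact: hmu.
have h := integrableD measurableT (IH (l + u)) (IH (l + (- 1) *: u)).
apply: (@le_bound_integrable _ _ _ _ _ (fun x => expR (dotv (l + u) x + \sum_(u <- s) `|dotv u x|) +
   expR (dotv (l + (- 1) *: u) x + \sum_(u <- s) `|dotv u x|))).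
- apply: measurableT_comp; first exact: measurable_expR.
  by apply: measurable_funD; [exact: measurable_dotv|exact: measurable_absdot].
- move=> x; rewrite ger0_norm ?expR_ge0// big_cons.
  rewrite !dotvDl dotvZl mulN1r.
  have e1 := expR_ge0 (dotv l x + dotv u x + \sum_(u <- s) `|dotv u x|).
  have e2 := expR_ge0 (dotv l x - dotv u x + \sum_(u <- s) `|dotv u x|).
  rewrite addrA; case: (ger0P (dotv u x)) => _; first by rewrite lerDl.
  by rewrite lerDr.
- by move: h; apply: eq_integrable => // x _.
Qed.

Definition absdot (z : 'rV[C]_p) x := `|dotv (rer z) x| + `|dotv (imr z) x|.

Lemma cmod_dotv_le z x : cmod (dotv z (toC x)) <= absdot z x.
Proof. by rewrite (le_trans (cmod_le_ReIm _))// re_dotv_toC im_dotv_toC. Qed.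

Lemma expR_absdot2_integrable z q (r : K) : 0 <= r ->
  mu.-integrable setT (EFin \o (fun x => expR (absdot z x + r * absdot q x))).
Proof.
move=> r0; have := expR_absdot_integrable
  [:: rer z; imr z; r *: rer q; r *: imr q] 0.
apply: eq_integrable => // x _; rewrite /= dotv0l add0r !big_cons big_nil addr0.
rewrite !dotvZl !normrM (ger0_norm r0) /absdot; congr (expR _)%:E; ring.
Qed.

Definition charf (z : 'rV[C]_p) : C :=
  cintegral mu (fun x => cexp ('i%C * dotv z (toC x))).

Lemma cmod_imul (z : C) : cmod ('i%C * z) = cmod z.
Proof. by rewrite cmodM cmodi mul1r. Qed.

(** Taylor coefficients at w = 0 of the transform along the line z + w q, obtained by expanding
    exp(i w q.x) under the integral. *)
Definition charf_coef z q k : C := cintegral mu (fun x =>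
  cexp ('i%C * dotv z (toC x)) * ('i%C * dotv q (toC x)) ^+ k / k`!%:R).

Lemma cmeas_idot z : cmeas (fun x => 'i%C * dotv z (toC x)).
Proof. by apply: cmeasM; [exact: cmeas_cst|exact: cmeas_dotv]. Qed.

Lemma charf_term_meas z q k : cmeas (fun x =>
  cexp ('i%C * dotv z (toC x)) * ('i%C * dotv q (toC x)) ^+ k / k`!%:R).
Proof.
apply: cmeasM; last exact: cmeas_cst.
apply: cmeasM; last by apply: cmeasX; exact: cmeas_idot.
by apply: cmeas_cexp; exact: cmeas_idot.
Qed.

Lemma cmod_cexp_idot z x : cmod (cexp ('i%C * dotv z (toC x))) <= expR (absdot z x).
Proof.
by rewrite (le_trans (cmod_cexp_le _))// ler_expR cmod_imul cmod_dotv_le.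
Qed.

Lemma charf_term_int z q k : cintble mu (fun x =>
  cexp ('i%C * dotv z (toC x)) * ('i%C * dotv q (toC x)) ^+ k / k`!%:R).
Proof.
split; first exact: charf_term_meas.
exists (fun x => expR (absdot z x + 1 * absdot q x)) => [|x].
  exact: expR_absdot2_integrable.
rewrite mul1r expRD -mulrA cmodM ler_pM ?cmod_ge0 ?cmod_cexp_idot//.
rewrite cmodM cmodX cmodV cmod_nat cmod_imul.
rewrite (le_trans (powfact_le_expR _ (cmod_ge0 _)))// ler_expR; exact: cmod_dotv_le.
Qed.

(** Only finite sums cross the integral: the remainder is the integral of the Taylor remainder of
    the exponential, at most 2^-n exp(3 r |q.x|) up to the factor from z, and all such exponentials
    are integrable. *)
Lemma hasps_charf z q : hasps (fun w => charf (z + w *: q)) (charf_coef z q).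
Proof.
move=> r; have [r0|r0] := leP 0 r; last first.
  by exists 0 => n w wr; have := cmod_ge0 w; lra.
exists (2 * \int[mu]_x expR (absdot z x + (3 * r) * absdot q x)) => n w wr.
pose term k x := cexp ('i%C * dotv z (toC x)) * ('i%C * dotv q (toC x)) ^+ k / k`!%:R.
have int0 : cintble mu (fun x => cexp ('i%C * dotv (z + w *: q) (toC x))).
  split; first by apply: cmeas_cexp; exact: cmeas_idot.
  exists (fun x => expR (absdot (z + w *: q) x + 0 * absdot q x)) => [|x].
    exact: expR_absdot2_integrable.
  by rewrite mul0r addr0 cmod_cexp_idot.
have E : charf (z + w *: q) - psum (charf_coef z q) n w =
    cintegral mu (fun x => cexp ('i%C * dotv z (toC x)) *
      (cexp (w * ('i%C * dotv q (toC x))) - ctaylor (w * ('i%C * dotv q (toC x))) n)) /\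
    cintble mu (fun x => cexp ('i%C * dotv z (toC x)) *
      (cexp (w * ('i%C * dotv q (toC x))) - ctaylor (w * ('i%C * dotv q (toC x))) n)).
  elim: n => [|n [IH1 IH2]].
    have E0 x : cexp ('i%C * dotv (z + w *: q) (toC x)) =
       cexp ('i%C * dotv z (toC x)) *
       (cexp (w * ('i%C * dotv q (toC x))) - ctaylor (w * ('i%C * dotv q (toC x))) 0).
      rewrite /ctaylor big_ord0 subr0 -cexpD dotvDl dotvZl; congr cexp; ring.
    rewrite psum0 subr0; split; first exact: eq_cintegral.
    by rewrite -(funext E0).
  have E1 x : cexp ('i%C * dotv z (toC x)) *
      (cexp (w * ('i%C * dotv q (toC x))) - ctaylor (w * ('i%C * dotv q (toC x))) n.+1)
    = cexp ('i%C * dotv z (toC x)) *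
      (cexp (w * ('i%C * dotv q (toC x))) - ctaylor (w * ('i%C * dotv q (toC x))) n)
     + (- w ^+ n) * term n x.
    by rewrite /ctaylor big_ord_recr/= /term exprMn; move: (n`!%:R^-1 : C) => y; ring.
  rewrite (funext E1); split; last by apply: cintbleD => //; apply: cintbleZ; exact: charf_term_int.
  rewrite cintegralD//; last by apply: cintbleZ; exact: charf_term_int.
  rewrite -IH1 cintegralZ; last exact: charf_term_int.
  by rewrite psumS -/(charf_coef z q n) opprD addrA mulNr [charf_coef z q n * _]mulrC.
have [-> [mE _]] := E.
have r30 : 0 <= 3 * r by rewrite mulr_ge0.
have int3 := expR_absdot2_integrable z q r30.
rewrite -mulrA -RintegralZr//; apply: cmod_cintegral_le => //.
  have := integrableZr measurableT (2 ^+ n)^-1 int3.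
  by apply: eq_integrable => // x _.
move=> x; rewrite cmodM expRD -mulrA ler_pM ?cmod_ge0 ?cmod_cexp_idot//.
apply: (le_trans (cexp_taylor n _)).
set m := cmod _; have m0 : 0 <= m by exact: cmod_ge0.
have mr : m <= r * absdot q x.
  by rewrite /m cmodM cmod_imul ler_pM ?cmod_ge0// cmod_dotv_le.
rewrite ler_pdivlMr ?exprn_gt0//.
have -> : m ^+ n / n`!%:R * expR m * 2 ^+ n = (2 * m) ^+ n / n`!%:R * expR m.
  by rewrite [in RHS]exprMn; move: (n`!%:R^-1 : K) (2 ^+ n : K) => y1 y2; ring.
apply: (@le_trans _ _ (expR (2 * m) * expR m)).
  by rewrite ler_wpM2r ?expR_ge0// powfact_le_expR// mulr_ge0.
by rewrite -expRD ler_expR; lra.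
Qed.

(** For real z, |exp(i w z.x)| = exp(- Im(w) z.x), so the integral is a Laplace transform at a
    vector of norm at most |w| times that of z. The + 1 keeps the constant positive. *)
Lemma charf_growth z rho : subexp_class rho mu -> 0 <= rho ->
  exists A B : K, [/\ 0 < A, 0 < B &
    forall w, cmod (charf (w *: toC z)) <= A * expR (B * cmod w `^ rho)].
Proof.
move=> [A [B [A0 B0 h]]] rho0.
exists (2 * A), (B * enorm z `^ rho + 1); split; first by rewrite mulr_gt0.
  by rewrite ltr_wpDl// mulr_ge0 ?powR_ge0// ltW.
move=> w; pose l := (- complex.Im w) *: z.
have re_i x : complex.Re ('i%C * dotv (w *: toC z) (toC x)) = dotv l x.
  rewrite reM/= mul0r sub0r mul1r im_dotv_toC -mulN1r -dotvZl; congr dotv.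
  by apply/rowP => i; rewrite !mxE imM/= mulr0 add0r mulN1r mulNr.
apply: (@le_trans _ _ (2 * \int[mu]_x expR (dotv l x))).
  apply: cmod_cintegral_le; last by move=> x; rewrite cmod_cexp re_i.
    by apply: cmeas_cexp; exact: cmeas_idot.
  exact: hmu.
rewrite -mulrA ler_wpM2l//.
have il : \int[mu]_x expR (dotv l x) <= A * expR (B * enorm l `^ rho).
  rewrite -lee_fin /Rintegral fineK; first exact: h.
  exact: integrable_fin_num (hmu l).
apply: (le_trans il); rewrite ler_wpM2l ?(ltW A0)// ler_expR.
have el : enorm l <= cmod w * enorm z.
  rewrite /enorm /l dotvZl dotvZr mulrA -expr2 sqrrN sqrtrM ?sqr_ge0// sqrtr_sqr.
  by rewrite ler_wpM2r ?sqrtr_ge0// ler_Im_cmod.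
have h1 : enorm l `^ rho <= (cmod w * enorm z) `^ rho.
  by rewrite ge0_ler_powR// nnegrE ?sqrtr_ge0// mulr_ge0 ?cmod_ge0// sqrtr_ge0.
apply: (@le_trans _ _ (B * (cmod w * enorm z) `^ rho)); first by rewrite ler_wpM2l// ltW.
rewrite powRM ?cmod_ge0 ?sqrtr_ge0// mulrA mulrAC mulrDl mul1r lerDl powR_ge0//.
Qed.

End exponential_moments.

(** * Product laws and image laws *)

Section products_of_probabilities.
Context d1 d2 (T1 : measurableType d1) (T2 : measurableType d2) (K : realType).
Variables (P1 : probability T1 K) (P2 : probability T2 K).
Local Notation C := K[i].

Lemma bmeas_comp d d' (T : measurableType d) (T' : measurableType d')
  (phi : T -> T') (h : T' -> K) :
  measurable_fun setT phi -> bmeas h -> bmeas (fun x => h (phi x)).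
Proof.
move=> mphi [mh [M hM]]; split; last by exists M => x; exact: hM.
exact: measurableT_comp mh mphi.
Qed.

Lemma Rintegral_prodM (f : T1 -> K) (g : T2 -> K) : bmeas f -> bmeas g ->
  \int[(P1 \x P2)%E]_z (f z.1 * g z.2) = (\int[P1]_x f x) * (\int[P2]_y g y).
Proof.
move=> bf bg.
have bfg : bmeas (fun z : T1 * T2 => f z.1 * g z.2).
  by apply: bmeasM; [exact: (bmeas_comp measurable_fst)|exact: (bmeas_comp measurable_snd)].
have ifg := bmeas_integrable (P1 \x P2)%E bfg.
rewrite [LHS]/Rintegral -(fubini1 ifg) /fubini_F.
have inner x : (\int[P2]_y ((f x * g y)%R%:E))%E = (f x * \int[P2]_y g y)%:E.
  rewrite /= -RintegralZl//; last exact: bmeas_integrable.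
  rewrite /Rintegral fineK//; apply: integrable_fin_num => //.
  by apply: bmeas_integrable; apply: bmeasM => //; exact: bmeas_cst.
rewrite (eq_integral (fun x => (f x * \int[P2]_y g y)%:E)); last by move=> x _; exact: inner.
by rewrite -[LHS]/(\int[P1]_x (f x * \int[P2]_y g y)) RintegralZr//; exact: bmeas_integrable.
Qed.

Definition cbmeas d (T : measurableType d) (f : T -> C) :=
  bmeas (fun x => complex.Re (f x)) /\ bmeas (fun x => complex.Im (f x)).

Lemma cintegral_prodM (f : T1 -> C) (g : T2 -> C) : cbmeas f -> cbmeas g ->
  cintegral (P1 \x P2)%E (fun z => f z.1 * g z.2) = cintegral P1 f * cintegral P2 g.
Proof.
move=> [fr fi] [gr gi].
have int (a : T1 -> K) (b : T2 -> K) : bmeas a -> bmeas b ->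
    (P1 \x P2)%E.-integrable setT (EFin \o (fun z : T1 * T2 => a z.1 * b z.2)).
  move=> ba bb; apply: (@bmeas_integrable _ _ _ (P1 \x P2)%E); apply: bmeasM.
    exact: (bmeas_comp measurable_fst).
  exact: (bmeas_comp measurable_snd).
apply: cplxP.
  rewrite reM re_cintegral /cintegral/= -!Rintegral_prodM// -RintegralB//; [|exact: (int _ _ fr gr)|exact: (int _ _ fi gi)].
  by apply: eq_Rintegral => z _; rewrite reM.
rewrite imM im_cintegral /cintegral/= -!Rintegral_prodM// -RintegralD//; [|exact: (int _ _ fr gi)|exact: (int _ _ fi gr)].
by apply: eq_Rintegral => z _; rewrite imM.
Qed.

End products_of_probabilities.

Section transfer.
Context d (T : measurableType d) (K : realType) (p : nat).
Local Notation C := K[i].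
Variables (P : probability T K) (phi : T -> 'rV[K]_p).
Hypothesis mphi : measurable_fun setT phi.

Lemma Rintegral_transfer (h : 'rV[K]_p -> K) : bmeas h ->
  fine (\int[pushforward P phi]_x (h x)%:E)%E = \int[P]_x h (phi x).
Proof.
move=> bh; rewrite integral_pushforward ?preimage_setT//.
  by apply/measurable_EFinP; exact: bh.1.
exact: (bmeas_integrable P (bmeas_comp mphi bh)).
Qed.

End transfer.

(** * Characteristic functions at real vectors *)

Section characteristic_functions.
Variables (K : realType) (p : nat).
Local Notation C := K[i].
Implicit Types mu nu : probability 'rV[K]_p K.

Lemma dotv_toCE (t x : 'rV[K]_p) : dotv (toC t) (toC x) = (dotv t x)%:C.
Proof.
by rewrite /dotv rmorph_sum/=; apply: eq_bigr => i _; rewrite !mxE rmorphM.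
Qed.

Lemma cexp_i (y : K) : cexp ('i%C * y%:C) = cos y +i* sin y.
Proof.
have -> : 'i%C * y%:C = 0 +i* y :> C by apply: cplxP; rewrite (reM, imM)/=; ring.
by apply: cplxP; rewrite /cexp (reM, imM)/= expR0; ring.
Qed.

Lemma cexp_dotE (t x : 'rV[K]_p) :
  cexp ('i%C * dotv (toC t) (toC x)) = cos (dotv t x) +i* sin (dotv t x).
Proof. by rewrite dotv_toCE cexp_i. Qed.

Lemma cbmeas_cexp_dot (t : 'rV[K]_p) :
  cbmeas (fun x : 'rV[K]_p => cexp ('i%C * dotv (toC t) (toC x))).
Proof.
split; [under eq_fun do rewrite cexp_dotE /=|under eq_fun do rewrite cexp_dotE /=].
  by apply: bmeas_cos; exact: measurable_dotv.
by apply: bmeas_sin; exact: measurable_dotv.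
Qed.

Lemma charf_realE mu t : charf mu (toC t) =
  (\int[mu]_x cos (dotv t x)) +i* (\int[mu]_x sin (dotv t x)).
Proof.
by rewrite /charf /cintegral; congr (_ +i* _); apply: eq_Rintegral => x _; rewrite cexp_dotE.
Qed.

Lemma Rintegral_cos_shift mu t c : \int[mu]_x cos (dotv t x + c) =
  complex.Re (charf mu (toC t)) * cos c - complex.Im (charf mu (toC t)) * sin c.
Proof.
have ic : mu.-integrable setT (EFin \o (fun x => cos (dotv t x))).
  by apply: bmeas_integrable; apply: bmeas_cos; exact: measurable_dotv.
have is_ : mu.-integrable setT (EFin \o (fun x => sin (dotv t x))).
  by apply: bmeas_integrable; apply: bmeas_sin; exact: measurable_dotv.
rewrite charf_realE /= -!RintegralZr// -RintegralB//.
- by apply: eq_Rintegral => x _; rewrite cosD.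
- by apply: bmeas_integrable; apply: bmeasM; [apply: bmeas_cos; exact: measurable_dotv|exact: bmeas_cst].
- by apply: bmeas_integrable; apply: bmeasM; [apply: bmeas_sin; exact: measurable_dotv|exact: bmeas_cst].
Qed.

Lemma charf_uniqueness mu nu :
  (forall t, charf mu (toC t) = charf nu (toC t)) -> eq_law mu nu.
Proof.
by move=> h; apply: fourier_uniqueness => t c; rewrite !Rintegral_cos_shift h.
Qed.

Lemma measurable_addr (m : 'rV[K]_p) : measurable_fun setT (fun x : 'rV[K]_p => x + m).
Proof.
apply: measurable_fun_rV => i; under eq_fun do rewrite mxE.
by apply: measurable_funD => //; exact: measurable_rV_coord.
Qed.

Lemma toCD (x y : 'rV[K]_p) : toC (x + y) = toC x + toC y.
Proof. by apply/rowP => i; rewrite !mxE rmorphD. Qed.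

Lemma toCZ (c : K) (x : 'rV[K]_p) : toC (c *: x) = c%:C *: toC x.
Proof. by apply/rowP => i; rewrite !mxE rmorphM. Qed.

Lemma toC0 : toC (0 : 'rV[K]_p) = 0.
Proof. by apply/rowP => i; rewrite !mxE. Qed.

Lemma cbmeas_cintble mu (f : 'rV[K]_p -> C) : cbmeas f -> cintble mu f.
Proof.
move=> [[mr [M hM]] [mi [L hL]]]; split=> //.
exists (fun=> M + L); first exact/bmeas_integrable/bmeas_cst.
by move=> x; rewrite (le_trans (cmod_le_ReIm _))// lerD.
Qed.

(** Packaged so that the image law under a translation is again a [probability]. *)
Definition addv_mfun (m : 'rV[K]_p) : {mfun 'rV[K]_p >-> 'rV[K]_p} :=
  MeasurableFun.Pack (MeasurableFun.Class
    (isMeasurableFun.Build _ _ _ _ _ (measurable_addr m))).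

Lemma charf_translate mu (m t : 'rV[K]_p) :
  charf (distribution mu (addv_mfun m)) (toC t) =
  cexp ('i%C * (dotv t m)%:C) * charf mu (toC t).
Proof.
rewrite [LHS]charf_realE.
have tr (g : 'rV[K]_p -> K) : bmeas g ->
    \int[distribution mu (addv_mfun m)]_x g x = \int[mu]_x g (x + m).
  by move=> bg; rewrite -(Rintegral_transfer mu (measurable_addr m)).
rewrite !tr; last first.
- by apply: bmeas_cos; exact: measurable_dotv.
- by apply: bmeas_sin; exact: measurable_dotv.
rewrite /charf -cintegralZ; last exact/cbmeas_cintble/cbmeas_cexp_dot.
rewrite /cintegral; congr (_ +i* _); apply: eq_Rintegral => x _;
  by rewrite cexp_dotE cexp_i (reM, imM)/= dotvDr (cosD, sinD); ring.
Qed.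

Lemma charf0 mu : charf mu 0 = 1.
Proof.
rewrite -toC0 charf_realE.
have e0 (x : 'rV[K]_p) : dotv 0 x = 0 by rewrite dotv0l.
have cE (c : K) : \int[mu]_x (cst c x : K) = c.
  rewrite Rintegral_cst//; transitivity (c * fine (1%E : \bar K)); last by rewrite mulr1.
  by congr (_ * fine _); exact: probability_setT.
have -> : \int[mu]_x cos (dotv 0 x) = \int[mu]_x (cst 1 x : K).
  by apply: eq_Rintegral => x _; rewrite e0 cos0.
have -> : \int[mu]_x sin (dotv 0 x) = \int[mu]_x (cst 0 x : K).
  by apply: eq_Rintegral => x _; rewrite e0 sin0.
by rewrite !cE.
Qed.

(** Dominated convergence with the constant 1, without moments, so it applies to the noise laws. *)
Lemma charf_cvg mu (t s : 'rV[K]_p) :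
  (fun n => complex.Re (charf mu (toC (t + n.+1%:R^-1 *: s)))) @ \oo -->
    complex.Re (charf mu (toC t)) /\
  (fun n => complex.Im (charf mu (toC (t + n.+1%:R^-1 *: s)))) @ \oo -->
    complex.Im (charf mu (toC t)).
Proof.
have arg (x : 'rV[K]_p) : (fun n => dotv (t + n.+1%:R^-1 *: s) x) @ \oo --> dotv t x.
  under eq_fun do rewrite dotvDl dotvZl.
  have : (fun n => dotv t x + n.+1%:R^-1 * dotv s x) @ \oo --> dotv t x + 0 * dotv s x.
    apply: cvgD; first exact: cvg_cst.
    by apply: cvgM; [exact: cvg_harmonic|exact: cvg_cst].
  by rewrite mul0r addr0.
split; under eq_fun do rewrite charf_realE; rewrite charf_realE /=.
  apply: (@Rintegral_lim _ _ _ mu (fun n x => cos (dotv (t + n.+1%:R^-1 *: s) x)) _ 1) => [n|n x|x].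
  - by have [] := @bmeas_cos _ _ K _ (measurable_dotv (t + n.+1%:R^-1 *: s)).
  - by rewrite ler_norml cos_geN1 cos_le1.
  - by apply: continuous_cvg; [exact: continuous_cos|exact: arg].
apply: (@Rintegral_lim _ _ _ mu (fun n x => sin (dotv (t + n.+1%:R^-1 *: s) x)) _ 1) => [n|n x|x].
- by have [] := @bmeas_sin _ _ K _ (measurable_dotv (t + n.+1%:R^-1 *: s)).
- by rewrite ler_norml sin_geN1 sin_le1.
- by apply: continuous_cvg; [exact: continuous_sin|exact: arg].
Qed.

Lemma charf_neq_near mu nu (t s : 'rV[K]_p) : charf mu (toC t) != charf nu (toC t) ->
  exists N, forall n, (N <= n)%N ->
    charf mu (toC (t + n.+1%:R^-1 *: s)) != charf nu (toC (t + n.+1%:R^-1 *: s)).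
Proof.
have key (u v : K^nat) (l l' : K) : u @ \oo --> l -> v @ \oo --> l' -> l != l' ->
    exists N, forall n, (N <= n)%N -> u n != v n.
  move=> ul vl ll; have h : (fun n => u n - v n) @ \oo --> l - l' by exact: cvgB.
  have ll0 : 0 < `|l - l'| by rewrite normr_gt0 subr_eq0.
  have /cvgrPdist_lt/(_ _ ll0)[N _ hN] := h.
  exists N => n Nn; apply/eqP => uv; have := hN n Nn.
  by rewrite /= uv subrr subr0 ltxx.
move=> h; have [m1 m2] := charf_cvg mu t s; have [n1 n2] := charf_cvg nu t s.
have [e|re] := eqVneq (complex.Re (charf mu (toC t))) (complex.Re (charf nu (toC t))).
  have ie : complex.Im (charf mu (toC t)) != complex.Im (charf nu (toC t)).
    by apply: contra_neq h => e'; exact: cplxP.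
  have [N hN] := key _ _ _ _ m2 n2 ie.
  by exists N => n /hN; apply: contra_neq => ->.
have [N hN] := key _ _ _ _ m1 n1 re.
by exists N => n /hN; apply: contra_neq => ->.
Qed.

Lemma charf_neq0_near mu (s : 'rV[K]_p) :
  exists N, forall n, (N <= n)%N -> charf mu (toC (n.+1%:R^-1 *: s)) != 0.
Proof.
have [h _] := charf_cvg mu 0 s; rewrite toC0 charf0 in h.
have /cvgrPdist_lt/(_ 1 ltr01)[N _ hN] := h.
exists N => n Nn; apply/eqP => e; have := hN n Nn.
by rewrite (add0r (n.+1%:R^-1 *: s)) e /= subr0 normr1 ltxx.
Qed.

End characteristic_functions.

(** * The characteristic function of the noisy vector *)

Section noisy_charf.
Variables (K : realType) (d1 d2 : nat).
Local Notation C := K[i].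

Lemma dotv_row_mx (F : pzRingType) (u1 v1 : 'rV[F]_d1) (u2 v2 : 'rV[F]_d2) :
  dotv (row_mx u1 u2) (row_mx v1 v2) = dotv u1 v1 + dotv u2 v2.
Proof.
rewrite /dotv big_split_ord/=; congr (_ + _); apply: eq_bigr => i _.
  by rewrite !row_mxEl.
by rewrite !row_mxEr.
Qed.

Lemma toC_row_mx (x1 : 'rV[K]_d1) (x2 : 'rV[K]_d2) :
  toC (row_mx x1 x2) = row_mx (toC x1) (toC x2).
Proof. by rewrite /toC map_row_mx. Qed.

Lemma PhiE (R : probability 'rV[K]_(d1 + d2) K) z1 z2 :
  Phi R z1 z2 = charf R (row_mx z1 z2).
Proof.
rewrite /Phi /charf; apply: eq_cintegral => x; congr cexp.
transitivity ('i%C * dotv (row_mx z1 z2) (toC (row_mx (lsubmx x) (rsubmx x)))).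
  by rewrite toC_row_mx dotv_row_mx mulrDr.
by rewrite hsubmxK.
Qed.

Definition noise_sum (w : 'rV[K]_(d1 + d2) * ('rV[K]_d1 * 'rV[K]_d2)) :=
  w.1 + row_mx w.2.1 w.2.2.

Lemma measurable_noise_sum : measurable_fun setT noise_sum.
Proof.
apply: measurable_fun_rV => i; under eq_fun do rewrite /noise_sum mxE.
apply: measurable_funD.
  exact: measurableT_comp (measurable_rV_coord i) measurable_fst.
case: (fintype.splitP i) => j ij.
  have -> : i = lshift d2 j by exact/val_inj.
  under eq_fun do rewrite row_mxEl.
  apply: (measurableT_comp (measurable_rV_coord j)).
  exact: measurableT_comp measurable_fst measurable_snd.
have -> : i = rshift d1 j by exact/val_inj.
under eq_fun do rewrite row_mxEr.
apply: (measurableT_comp (measurable_rV_coord j)).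
exact: measurableT_comp measurable_snd measurable_snd.
Qed.

Definition joint_law (R : probability 'rV[K]_(d1 + d2) K)
  (Q1 : probability 'rV[K]_d1 K) (Q2 : probability 'rV[K]_d2 K) :
  probability ('rV[K]_(d1 + d2) * ('rV[K]_d1 * 'rV[K]_d2))%type K :=
  (R \x (Q1 \x Q2))%E.

Lemma noisy_charf (R : probability 'rV[K]_(d1 + d2) K)
  (Q1 : probability 'rV[K]_d1 K) (Q2 : probability 'rV[K]_d2 K)
  (t1 : 'rV[K]_d1) (t2 : 'rV[K]_d2) :
  cintegral (joint_law R Q1 Q2) (fun w =>
    cexp ('i%C * dotv (toC (row_mx t1 t2)) (toC (noise_sum w)))) =
  charf R (toC (row_mx t1 t2)) * (charf Q1 (toC t1) * charf Q2 (toC t2)).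
Proof.
pose e1 x := cexp ('i%C * dotv (toC t1) (toC x)).
pose e2 x := cexp ('i%C * dotv (toC t2) (toC x)).
pose e x := cexp ('i%C * dotv (toC (row_mx t1 t2)) (toC x)).
have E12 : charf Q1 (toC t1) * charf Q2 (toC t2) =
    cintegral (Q1 \x Q2)%E (fun y => e1 y.1 * e2 y.2).
  by rewrite cintegral_prodM//; exact: cbmeas_cexp_dot.
have m12 : cbmeas (fun y : 'rV[K]_d1 * 'rV[K]_d2 => e1 y.1 * e2 y.2).
  have [r1 i1] := cbmeas_cexp_dot t1; have [r2 i2] := cbmeas_cexp_dot t2.
  have B (u v : 'rV[K]_d1 -> K) (u' v' : 'rV[K]_d2 -> K) (c : K) :
      bmeas u -> bmeas v -> bmeas u' -> bmeas v' ->
      bmeas (fun y : 'rV[K]_d1 * 'rV[K]_d2 => u y.1 * u' y.2 + c * (v y.1 * v' y.2)).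
    move=> bu bv bu' bv'; apply: bmeasD; last apply: bmeasM; first apply: bmeasM.
    - exact: (bmeas_comp measurable_fst bu).
    - exact: (bmeas_comp measurable_snd bu').
    - exact: bmeas_cst.
    - by apply: bmeasM; [exact: (bmeas_comp measurable_fst bv)|exact: (bmeas_comp measurable_snd bv')].
  split.
    have := B _ _ _ _ (-1) r1 i1 r2 i2.
    by under [X in _ -> bmeas X]eq_fun do rewrite reM -mulN1r.
  have := B _ _ _ _ 1 r1 i1 i2 r2.
  by under [X in _ -> bmeas X]eq_fun do rewrite imM -[X in _ + X]mul1r.
rewrite E12 -[charf R _]/(cintegral R e) -(cintegral_prodM R (Q1 \x Q2)%E) //; last exact: cbmeas_cexp_dot.
apply: eq_cintegral => w; rewrite -!cexpD; congr cexp.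
by rewrite /noise_sum toCD dotvDr !toC_row_mx dotv_row_mx; ring.
Qed.

Lemma noisy_law_charf (R R' : probability 'rV[K]_(d1 + d2) K)
  (Q1 Q1' : probability 'rV[K]_d1 K) (Q2 Q2' : probability 'rV[K]_d2 K) :
  eq_law (noisy_law R Q1 Q2) (noisy_law R' Q1' Q2') -> forall t1 t2,
  charf R (toC (row_mx t1 t2)) * (charf Q1 (toC t1) * charf Q2 (toC t2)) =
  charf R' (toC (row_mx t1 t2)) * (charf Q1' (toC t1) * charf Q2' (toC t2)).
Proof.
move=> h t1 t2; rewrite -!noisy_charf.
have tr (g : 'rV[K]_(d1 + d2) -> K) : bmeas g ->
   \int[joint_law R Q1 Q2]_w g (noise_sum w) = \int[joint_law R' Q1' Q2']_w g (noise_sum w).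
  move=> bg; rewrite -!(Rintegral_transfer _ measurable_noise_sum bg); congr fine.
  by apply: eq_measure_integral => [||? ? B mB _]; [exact: measurable_noise_sum|exact: measurable_noise_sum|exact: h].
have [br bi] := cbmeas_cexp_dot (row_mx t1 t2).
by apply: cplxP; [exact: tr br|exact: tr bi].
Qed.

End noisy_charf.

(** * Deconvolution *)

Section sections_zeros.
Variable K : realType.
Local Notation C := K[i].
Variables (U V : lmodType C) (F G : U -> V -> C).
Hypotheses (F1 : forall u q v, ent (fun w : C => F (u + w *: q) v))
  (F2 : forall u v q, ent (fun w : C => F u (v + w *: q)))
  (G1 : forall u q v, ent (fun w : C => G (u + w *: q) v))
  (G2 : forall u v q, ent (fun w : C => G u (v + w *: q)))
  (F00 : F 0 0 = 1)
  (FG : forall u v, F u v * (G u 0 * G 0 v) = G u v * (F u 0 * F 0 v))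
  (Gnz : forall u, exists v, G u v != 0).

Lemma ent_ext (f g : C -> C) : (forall w, f w = g w) -> ent f -> ent g.
Proof. by move=> /funext ->. Qed.

(* At a zero z of G(., 0), pick t with G(z s, t) F(0, t) nonzero: the identity FG
   then bounds the multiplicity of z for G(., 0) by the one for F(., 0). *)
Lemma zeros_le_sections (s : U) :
  zeros_le (fun w => G (w *: s) 0) (fun w => F (w *: s) 0).
Proof.
move=> z.
have [t ht] : exists t, G (z *: s) t * F 0 t != 0.
  have [t0 ht0] := Gnz (z *: s).
  have [//|no] := pselect (exists t, G (z *: s) t * F 0 t != 0).
  (* Otherwise the product vanishes on the whole line through t0. As F(0, .) is 1 at 0 it cancels,
     and G(z s, .) vanishes at t0. *)
  have h0 : forall w : C, G (z *: s) (w *: t0) = 0.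
    apply: (@ent_mul_eq0 _ _ (fun w => F 0 (w *: t0))).
    - by apply: ent_ext (G2 (z *: s) 0 t0) => w; rewrite add0r.
    - by apply: ent_ext (F2 0 0 t0) => w; rewrite add0r.
    - by rewrite scale0r F00 oner_neq0.
    - by move=> w; apply/eqP; apply: contraPT no => h; apply; exists (w *: t0).
  by have := h0 1; rewrite scale1r => /eqP; rewrite (negbTE ht0).
exists (fun w => F (w *: s) t * G 0 t), (fun w => G (w *: s) t * F 0 t); split=> //.
- have [c hc] := F1 0 s t; exists (fun k => G 0 t * c k).
  by apply: hasps_ext (haspsZ (G 0 t) hc) => w; rewrite add0r mulrC.
- have [c hc] := G1 0 s t; exists (fun k => F 0 t * c k).
  by apply: hasps_ext (haspsZ (F 0 t) hc) => w; rewrite add0r mulrC.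
- by move=> w; have := FG (w *: s) t; rewrite mulrCA mulrA => ->; rewrite mulrCA mulrA.
Qed.

End sections_zeros.

(** * Means, and the quotient of two transforms on a line *)

Section mean.
Variables (K : realType) (p : nat).
Local Notation C := K[i].
Implicit Types mu nu : probability 'rV[K]_p K.

Definition meanv mu : 'rV[K]_p := \row_j \int[mu]_x (x ord0 j).

Lemma coord_integrable mu j : exp_moments mu ->
  mu.-integrable setT (EFin \o (fun x : 'rV[K]_p => x ord0 j)).
Proof.
move=> hmu; have := expR_absdot_integrable hmu [:: delta_mx 0 j] 0.
apply: le_bound_integrable; first exact: measurable_rV_coord.
move=> x; rewrite big_cons big_nil addr0 dotv0l add0r dotv_delta.
by have := expR_ge1Dx `|x ord0 j|; lra.
Qed.

Lemma Rintegral_dotv mu t : exp_moments mu ->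
  \int[mu]_x dotv t x = dotv t (meanv mu).
Proof.
move=> hmu; rewrite /dotv.
have h (s : seq 'I_p) : \int[mu]_x (\sum_(j <- s) t ord0 j * x ord0 j) =
    \sum_(j <- s) t ord0 j * meanv mu ord0 j /\
    mu.-integrable setT (EFin \o (fun x : 'rV[K]_p => \sum_(j <- s) t ord0 j * x ord0 j)).
  have iZ j : mu.-integrable setT (EFin \o (fun x : 'rV[K]_p => t ord0 j * x ord0 j)).
    have := integrableZl measurableT (t ord0 j) (coord_integrable j hmu).
    by apply: eq_integrable => // x _.
  elim: s => [|j s [IH1 IH2]].
    split; last by under eq_fun do rewrite big_nil; apply: bmeas_integrable; exact: bmeas_cst.
    rewrite big_nil (@eq_Rintegral _ _ _ mu setT (fun=> 0)) => [|x _]; last by rewrite big_nil.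
    by rewrite Rintegral_cst// mul0r.
  split.
    rewrite big_cons -IH1 mxE -RintegralZl//; last exact: coord_integrable.
    by rewrite -RintegralD//; apply: eq_Rintegral => x _; rewrite big_cons.
  have := integrableD measurableT (iZ j) IH2.
  by apply: eq_integrable => // x _; rewrite /= big_cons.
exact: (h _).1.
Qed.

Lemma charf_coef_at0 mu t : charf_coef mu 0 (toC t) 0 = 1.
Proof.
rewrite /charf_coef -[RHS](charf0 mu); apply: eq_cintegral => x.
by rewrite expr0 fact0 divr1 mulr1.
Qed.

(** The mean is real, so the exponent of the quotient is i times a real number: a translation. *)
Lemma charf_coef_at1 mu t : exp_moments mu ->
  charf_coef mu 0 (toC t) 1 = 'i%C * (dotv t (meanv mu))%:C.
Proof.
move=> hmu; rewrite -Rintegral_dotv//.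
have iE (y : K) : 'i%C * y%:C = 0 +i* y :> C.
  by apply: cplxP; rewrite (reM, imM)/=; ring.
have E x : cexp ('i%C * dotv 0 (toC x)) * ('i%C * dotv (toC t) (toC x)) ^+ 1 / 1`!%:R =
    0 +i* dotv t x :> C.
  by rewrite dotv0l mulr0 cexp0 mul1r expr1 factS fact0 muln1 divr1 dotv_toCE iE.
rewrite /charf_coef (eq_cintegral _ E) iE; apply: cplxP => //.
by rewrite re_cintegral/= Rintegral_cst// mul0r.
Qed.

Lemma charf_quotient mu nu rho t : 0 <= rho < 2 ->
  subexp_class rho mu -> subexp_class rho nu ->
  zeros_le (fun w : C => charf nu (w *: toC t)) (fun w => charf mu (w *: toC t)) ->
  zeros_le (fun w : C => charf mu (w *: toC t)) (fun w => charf nu (w *: toC t)) ->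
  forall w : C, charf mu (w *: toC t) = charf nu (w *: toC t) *
    cexp ('i%C * (dotv t (meanv mu - meanv nu))%:C * w).
Proof.
move=> hrho smu snu z1 z2.
have [rho0 _] := andP hrho.
have hmu := subexp_class_moments smu; have hnu := subexp_class_moments snu.
have [A [B [A0 B0 hA]]] := charf_growth hmu t smu rho0.
have [A' [B' [A'0 B'0 hA']]] := charf_growth hnu t snu rho0.
have line m : exp_moments m -> hasps (fun w : C => charf m (w *: toC t)) (charf_coef m 0 (toC t)).
  by move=> hm; apply: hasps_ext (hasps_charf hm 0 (toC t)) => w; rewrite add0r.
have up (a b a' b' : K) (w : C) : 0 < a -> 0 < b -> 0 < a' -> 0 < b' ->
    a * expR (b * cmod w `^ rho) <= (a + a') * expR ((b + b') * cmod w `^ rho).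
  move=> a0 b0 a'0 b'0; have x0 : 0 <= cmod w `^ rho by exact: powR_ge0.
  rewrite ler_pM ?expR_ge0 ?(ltW a0)//; first by rewrite lerDl ltW.
  by rewrite ler_expR ler_wpM2r// lerDl ltW.
apply: (@entire_quotient_exp K _ _ _ _ _ (A + A') (B + B') rho
  ('i%C * (dotv t (meanv mu - meanv nu))%:C) (line _ hmu) (line _ hnu)) => //.
- exact: charf_coef_at0.
- exact: charf_coef_at0.
- by rewrite addr_gt0.
- by rewrite addr_gt0.
- by move=> w; rewrite (le_trans (hA w))// up.
- by move=> w; rewrite (le_trans (hA' w))// addrC (addrC B) up.
- exact: hasps_cexp.
- rewrite !charf_coef_at1// -mulrBr -rmorphB; congr (_ * _%:C).
  by rewrite dotvDr -scaleN1r dotvZr mulN1r.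
Qed.

End mean.

(** Elimination of the noise: f, f1, f2 are the values for R at (s, t), (s, 0), (0, t), the g's
    those for R', and a, b, a', b' the noise factors. *)
Lemma cross_cancel (F : idomainType) (f g f1 g1 f2 g2 a b a' b' : F) :
  a != 0 -> b != 0 -> a' != 0 -> b' != 0 ->
  f * (a * b) = g * (a' * b') -> f1 * a = g1 * a' -> f2 * b = g2 * b' ->
  f * (g1 * g2) - g * (f1 * f2) = 0.
Proof.
move=> a0 b0 a'0 b'0 e e1 e2.
have nz : a * b * (a' * b') != 0 by rewrite !mulf_neq0.
apply: (mulIf nz); rewrite mul0r.
have -> : (f * (g1 * g2) - g * (f1 * f2)) * (a * b * (a' * b')) =
  f * (a * b) * (g1 * a' * (g2 * b')) - g * (a' * b') * (f1 * a * (f2 * b)) by ring.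
by rewrite e e1 e2 subrr.
Qed.

Lemma mul_swap (F : comPzRingType) (f g a b c d : F) :
  f * (a * b) = g * (c * d) -> f * (b * a) = g * (d * c).
Proof. by rewrite (mulrC a) (mulrC c). Qed.

Lemma twist_cancel (F : comPzRingType) (g g1 g2 a b : F) :
  g * (g1 * a * (g2 * b)) - g * (a * b) * (g1 * g2) = 0.
Proof. by ring. Qed.

(** * The identity without noise, from real points near 0 to all complex ones *)

Section cross_identity.
Variables (K : realType) (d1 d2 : nat).
Local Notation C := K[i].
Implicit Types R : probability 'rV[K]_(d1 + d2) K.

Lemma row_mx_line (z1 q1 : 'rV[C]_d1) (z2 q2 : 'rV[C]_d2) (w : C) :
  row_mx (z1 + w *: q1) (z2 + w *: q2) = row_mx z1 z2 + w *: row_mx q1 q2.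
Proof. by rewrite scale_row_mx add_row_mx. Qed.

Lemma ent_Phi R z1 q1 z2 q2 : exp_moments R ->
  ent (fun w => Phi R (z1 + w *: q1) (z2 + w *: q2)).
Proof.
move=> hR; exists (charf_coef R (row_mx z1 z2) (row_mx q1 q2)).
by apply: hasps_ext (hasps_charf hR _ _) => w; rewrite PhiE row_mx_line.
Qed.

Lemma ent_Phi1 R z1 q1 z2 : exp_moments R ->
  ent (fun w => Phi R (z1 + w *: q1) z2).
Proof.
by move=> hR; apply: ent_ext (ent_Phi z1 q1 z2 0 hR) => w; rewrite scaler0 addr0.
Qed.

Lemma ent_Phi2 R z1 z2 q2 : exp_moments R ->
  ent (fun w => Phi R z1 (z2 + w *: q2)).
Proof.
by move=> hR; apply: ent_ext (ent_Phi z1 0 z2 q2 hR) => w; rewrite scaler0 addr0.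
Qed.

Lemma Phi00 R : Phi R 0 0 = 1.
Proof. by rewrite PhiE row_mx0 charf0. Qed.

Lemma PhiC R s t : Phi R (toC s) (toC t) = charf R (toC (row_mx s t)).
Proof. by rewrite PhiE toC_row_mx. Qed.

Lemma PhiC10 R s : Phi R (toC s) 0 = charf R (toC (row_mx s 0)).
Proof. by rewrite -PhiC toC0. Qed.

Lemma PhiC01 R t : Phi R 0 (toC t) = charf R (toC (row_mx 0 t)).
Proof. by rewrite -PhiC toC0. Qed.

Variables (R R' : probability 'rV[K]_(d1 + d2) K)
  (Q1 Q1' : probability 'rV[K]_d1 K) (Q2 Q2' : probability 'rV[K]_d2 K).
Hypotheses (hR : exp_moments R) (hR' : exp_moments R')
  (hP : eq_law (noisy_law R Q1 Q2) (noisy_law R' Q1' Q2')).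

Definition cross_diff z1 z2 := Phi R z1 z2 * (Phi R' z1 0 * Phi R' 0 z2) -
  Phi R' z1 z2 * (Phi R z1 0 * Phi R 0 z2).

Lemma ent_cross_diff z1 q1 z2 q2 :
  ent (fun w => cross_diff (z1 + w *: q1) (z2 + w *: q2)).
Proof.
apply: entB.
  apply: entM; first exact: ent_Phi.
  by apply: entM; [exact: ent_Phi1|exact: ent_Phi2].
apply: entM; first exact: ent_Phi.
by apply: entM; [exact: ent_Phi1|exact: ent_Phi2].
Qed.

Lemma cross_diff_small (s : 'rV[K]_d1) (t : 'rV[K]_d2) :
  exists N, forall n, (N <= n)%N ->
    cross_diff (inv_seq K n *: toC s) (inv_seq K n *: toC t) = 0.
Proof.
have [N1 h1] := charf_neq0_near Q1 s; have [N2 h2] := charf_neq0_near Q2 t.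
have [N1' h1'] := charf_neq0_near Q1' s; have [N2' h2'] := charf_neq0_near Q2' t.
exists (maxn (maxn N1 N2) (maxn N1' N2')) => n.
rewrite !geq_max => /andP[/andP[/h1 n1 /h2 n2] /andP[/h1' n1' /h2' n2']].
rewrite /inv_seq -!toCZ; move: (n.+1%:R^-1 *: s) (n.+1%:R^-1 *: t) n1 n2 n1' n2' => x y n1 n2 n1' n2'.
have e := noisy_law_charf hP x y.
have e1 := noisy_law_charf hP x 0.
have e2 := noisy_law_charf hP 0 y.
rewrite /cross_diff PhiC PhiC !PhiC10 !PhiC01.
rewrite !toC0 !charf0 !(mulr1, mul1r) in e1 e2.
exact: (cross_cancel n1 n2 n1' n2' e e1 e2).
Qed.

(** The identity theorem on the complex line through 0 and (s, t), read at w = 1. *)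
Lemma cross_diff_real (s : 'rV[K]_d1) (t : 'rV[K]_d2) : cross_diff (toC s) (toC t) = 0.
Proof.
have [N hN] := cross_diff_small s t.
have [c hc] := ent_cross_diff 0 (toC s) 0 (toC t).
have := @identity_theorem _ _ _ N hc _ 1; rewrite !scale1r !add0r; apply=> n Nn.
by rewrite !add0r hN.
Qed.

Lemma toC_ReIm p (z : 'rV[C]_p) : z = toC (rer z) + 'i%C *: toC (imr z).
Proof. by apply/rowP => i; rewrite !mxE; exact: complexE. Qed.

(** A complex vector is the value at w = i of Re z + w Im z, a line whose points with real w are
    real vectors. *)
Lemma cross_identity z1 z2 :
  Phi R z1 z2 * (Phi R' z1 0 * Phi R' 0 z2) = Phi R' z1 z2 * (Phi R z1 0 * Phi R 0 z2).
Proof.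
apply/eqP; rewrite -subr_eq0 -/(cross_diff z1 z2); apply/eqP.
rewrite (toC_ReIm z1) (toC_ReIm z2).
have [c hc] := ent_cross_diff (toC (rer z1)) (toC (imr z1)) (toC (rer z2)) (toC (imr z2)).
apply: (identity_theorem (N := 0) hc) => n _.
by rewrite /inv_seq -!toCZ -!toCD cross_diff_real.
Qed.

End cross_identity.

(** * Identification of the signal up to translation *)

Section deconvolution.
Variables (K : realType) (d1 d2 : nat).
Local Notation C := K[i].

Lemma nonnull_exists (U : Type) (f : U -> C) : f <> cst 0 -> exists u, f u != 0.
Proof.
move=> h; have [//|no] := pselect (exists u, f u != 0).
exfalso; apply: h; apply/funext => u; apply/eqP.
by apply: contraPT no => hu; apply; exists u.
Qed.

Variables (R R' : probability 'rV[K]_(d1 + d2) K)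
  (Q1 Q1' : probability 'rV[K]_d1 K) (Q2 Q2' : probability 'rV[K]_d2 K) (rho : K).
Hypotheses (hrho : 0 <= rho < 2) (sR : subexp_class rho R) (sR' : subexp_class rho R')
  (nR : nonnull_sections R) (nR' : nonnull_sections R')
  (hP : eq_law (noisy_law R Q1 Q2) (noisy_law R' Q1' Q2')).

Let hR : exp_moments R := subexp_class_moments sR.
Let hR' : exp_moments R' := subexp_class_moments sR'.

(** The only candidate: the translation must carry the mean of R to that of R'. *)
Definition shift : 'rV[K]_(d1 + d2) := meanv R - meanv R'.

Let line1 S (s : 'rV[K]_d1) (w : C) :
  charf S (w *: toC (row_mx s (0 : 'rV[K]_d2))) = Phi S (w *: toC s) 0.
Proof. by rewrite PhiE toC_row_mx toC0 scale_row_mx scaler0. Qed.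

Let line2 S (t : 'rV[K]_d2) (w : C) :
  charf S (w *: toC (row_mx (0 : 'rV[K]_d1) t)) = Phi S 0 (w *: toC t).
Proof. by rewrite PhiE toC_row_mx toC0 scale_row_mx scaler0. Qed.

(** The zeros are compared in both directions by exchanging R and R': one direction uses the
    sections of R', the other those of R. *)
Lemma Phi_marginal1 (s : 'rV[K]_d1) (w : C) : Phi R (w *: toC s) 0 =
  Phi R' (w *: toC s) 0 * cexp ('i%C * (dotv (row_mx s 0) shift)%:C * w).
Proof.
have E S : (fun w : C => charf S (w *: toC (row_mx s (0 : 'rV[K]_d2)))) = (fun w => Phi S (w *: toC s) 0).
  by apply/funext => z; exact: line1.
rewrite -!line1; apply: (charf_quotient hrho sR sR'); rewrite !E.
  apply: (@zeros_le_sections _ _ _ (Phi R) (Phi R')).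
  - by move=> *; exact: ent_Phi1.
  - by move=> *; exact: ent_Phi2.
  - by move=> *; exact: ent_Phi1.
  - by move=> *; exact: ent_Phi2.
  - exact: Phi00.
  - by move=> u v; exact: (cross_identity hR hR' hP u v).
  - by move=> u; apply: nonnull_exists; exact: nR'.1.
apply: (@zeros_le_sections _ _ _ (Phi R') (Phi R)).
- by move=> *; exact: ent_Phi1.
- by move=> *; exact: ent_Phi2.
- by move=> *; exact: ent_Phi1.
- by move=> *; exact: ent_Phi2.
- exact: Phi00.
- by move=> u v; apply/esym; exact: (cross_identity hR hR' hP u v).
- by move=> u; apply: nonnull_exists; exact: nR.1.
Qed.

Lemma Phi_marginal2 (t : 'rV[K]_d2) (w : C) : Phi R 0 (w *: toC t) =
  Phi R' 0 (w *: toC t) * cexp ('i%C * (dotv (row_mx 0 t) shift)%:C * w).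
Proof.
have E S : (fun w : C => charf S (w *: toC (row_mx (0 : 'rV[K]_d1) t))) = (fun w => Phi S 0 (w *: toC t)).
  by apply/funext => z; exact: line2.
rewrite -!line2; apply: (charf_quotient hrho sR sR'); rewrite !E.
  apply: (@zeros_le_sections _ _ _ (fun u v => Phi R v u) (fun u v => Phi R' v u)).
  - by move=> *; exact: ent_Phi2.
  - by move=> *; exact: ent_Phi1.
  - by move=> *; exact: ent_Phi2.
  - by move=> *; exact: ent_Phi1.
  - exact: Phi00.
  - by move=> u v; exact: (mul_swap (cross_identity hR hR' hP v u)).
  - by move=> u; apply: nonnull_exists; exact: nR'.2.
apply: (@zeros_le_sections _ _ _ (fun u v => Phi R' v u) (fun u v => Phi R v u)).
- by move=> *; exact: ent_Phi2.
- by move=> *; exact: ent_Phi1.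
- by move=> *; exact: ent_Phi2.
- by move=> *; exact: ent_Phi1.
- exact: Phi00.
- by move=> u v; exact: (esym (mul_swap (cross_identity hR hR' hP v u))).
- by move=> u; apply: nonnull_exists; exact: nR.2.
Qed.

(** Inserting the two marginal quotients in [cross_identity] gives the claim times both marginals of
    R'. Their product is 1 at w = 0, so it cancels along the line through x, whatever its zeros. *)
Lemma charf_shift (x : 'rV[K]_(d1 + d2)) :
  charf R (toC x) = charf R' (toC x) * cexp ('i%C * (dotv x shift)%:C).
Proof.
pose s := lsubmx x; pose t := rsubmx x.
have xE : x = row_mx s 0 + row_mx 0 t by rewrite add_row_mx addr0 add0r hsubmxK.
pose c : C := 'i%C * (dotv x shift)%:C.
pose H (w : C) := Phi R (w *: toC s) (w *: toC t) -
  Phi R' (w *: toC s) (w *: toC t) * cexp (c * w).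
have eL S : exp_moments S -> ent (fun w => Phi S (w *: toC s) (w *: toC t)).
  by move=> hS; apply: ent_ext (ent_Phi 0 (toC s) 0 (toC t) hS) => w; rewrite !add0r.
have H0 w : H w = 0.
  apply: (@ent_mul_eq0 _ _ (fun w => Phi R' (w *: toC s) 0 * Phi R' 0 (w *: toC t))).
  - apply: entB; first exact: eL.
    by apply: entM; [exact: eL|exists (fun k => c ^+ k / k`!%:R); exact: hasps_cexp].
  - apply: entM.
      by apply: ent_ext (ent_Phi1 0 (toC s) 0 hR') => {}w; rewrite add0r.
    by apply: ent_ext (ent_Phi2 0 0 (toC t) hR') => {}w; rewrite add0r.
  - by rewrite !scale0r Phi00 mulr1 oner_neq0.
  - move=> {}w; rewrite /H mulrBl (cross_identity hR hR' hP).
    rewrite Phi_marginal1 Phi_marginal2.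
    have -> : cexp (c * w) = cexp ('i%C * (dotv (row_mx s 0) shift)%:C * w) *
        cexp ('i%C * (dotv (row_mx 0 t) shift)%:C * w).
      by rewrite -cexpD -mulrDl -mulrDr -rmorphD -dotvDl -xE.
    exact: twist_cancel.
have := H0 1; rewrite /H !scale1r mulr1 !PhiC hsubmxK => /eqP.
by rewrite subr_eq0 => /eqP.
Qed.

Lemma eq_law_signal : eq_law (pushforward R (fun x => x - shift)) R'.
Proof.
apply: (@charf_uniqueness _ _ (distribution R (addv_mfun (- shift)))) => t.
rewrite charf_translate charf_shift mulrCA -cexpD -mulrDr -rmorphD.
by rewrite -dotvDr addNr dotvC dotv0l mulr0 cexp0 mulr1.
Qed.

End deconvolution.

(* The zeros of F along a real line through 0 are isolated, and characteristic functions
   are continuous, so F can be cancelled. *)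
Lemma eq_law_noise (K : realType) p (mu nu : probability 'rV[K]_p K) (F : 'rV[K[i]]_p -> K[i])
    (m : 'rV[K]_p) :
  (forall z q, ent (fun w : K[i] => F (z + w *: q))) -> F 0 != 0 ->
  (forall t, F (toC t) * (cexp ('i%C * (dotv t m)%:C) * charf mu (toC t)) =
             F (toC t) * charf nu (toC t)) ->
  eq_law (pushforward mu (fun x => x + m)) nu.
Proof.
move=> eF F0 h.
apply: (@charf_uniqueness _ _ (distribution mu (addv_mfun m))) => t.
have [//|ne] := eqVneq (charf (distribution mu (addv_mfun m)) (toC t)) (charf nu (toC t)).
have [N hN] := charf_neq_near t ne.
(* The line t + w t starts at t, where the two characteristic functions differ, and reaches 0 at w =
   -1, where F is nonzero. *)
have [c hc] := eF (toC t) (toC t).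
have z : forall w, F (toC t + w *: toC t) = 0.
  apply: (identity_theorem (N := N) hc) => n Nn.
  rewrite /inv_seq -toCZ -toCD; have := h (t + n.+1%:R^-1 *: t).
  rewrite -charf_translate => /eqP; rewrite -subr_eq0 -mulrBr mulf_eq0.
  by rewrite subr_eq0 (negbTE (hN n Nn)) orbF => /eqP.
by have := z (-1); rewrite scaleN1r subrr => /eqP; rewrite (negbTE F0).
Qed.

Theorem theorem1 (K : realType) (d1 d2 : nat)
    (hd1 : (1 <= d1)%N) (hd2 : (1 <= d2)%N)
    (R R' : probability 'rV[K]_(d1 + d2) K)
    (Q1 Q1' : probability 'rV[K]_d1 K) (Q2 Q2' : probability 'rV[K]_d2 K)
    (hrho : exists rho : K,
        [/\ 0 <= rho, rho < 2, subexp_class rho R & subexp_class rho R'])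
    (hR : nonnull_sections R) (hR' : nonnull_sections R')
    (hP : eq_law (noisy_law R Q1 Q2) (noisy_law R' Q1' Q2')) :
  eq_up_to_translation R Q1 Q2 R' Q1' Q2'.
Proof.
have [rho [rho0 rho2 sR sR']] := hrho.
have rho02 : 0 <= rho < 2 by rewrite rho0.
have mR' := subexp_class_moments sR'.
pose m := shift R R'.
have sh := charf_shift rho02 sR sR' hR hR' hP.
exists (lsubmx m), (rsubmx m); split.
- by rewrite hsubmxK; exact: (eq_law_signal rho02 sR sR' hR hR' hP).
(* At (t, 0) the second noise has factor 1. The exponential relating R to R' passes to the first
   noise, which moves by + m while the signal moves by - m. *)
- apply: (@eq_law_noise _ _ _ _ (fun z => Phi R' z 0)) => [z q||t].
  + exact: ent_Phi1.
  + by rewrite Phi00 oner_neq0.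
  + have := noisy_law_charf hP t 0; rewrite toC0 !charf0 !mulr1 sh => e.
    have dm : dotv (row_mx t 0) m = dotv t (lsubmx m).
      by rewrite -{1}(hsubmxK m) dotv_row_mx dotv0l addr0.
    by rewrite PhiC10 -e -mulrA -dm.
- apply: (@eq_law_noise _ _ _ _ (fun z => Phi R' 0 z)) => [z q||t].
  + exact: ent_Phi2.
  + by rewrite Phi00 oner_neq0.
  + have := noisy_law_charf hP 0 t; rewrite toC0 !charf0 !mul1r sh => e.
    have dm : dotv (row_mx 0 t) m = dotv t (rsubmx m).
      by rewrite -{1}(hsubmxK m) dotv_row_mx dotv0l add0r.
    by rewrite PhiC01 -e -mulrA -dm.
Qed.
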